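(* If $K$ is an almost classical knot such that $\operatorname{span}_p\Delta_K>0$ for all primes $p$, then $K$ admits only finitely many periods.
   Context: A virtual knot diagram is an immersed oriented circle in the plane with transverse double points marked classical (with over/under information) or virtual; virtual knots are equivalence classes of such diagrams under planar isotopy, Reidemeister moves and detour moves (an arc all of whose crossings are virtual may be replaced by any other arc with the same endpoints, all of whose new crossings are virtual). An integer $q\ge2$ is a period of a virtual knot if the knot is represented by a virtual knot diagram that misses the origin and is invariant under rotation of the plane by $2\pi/q$ about the origin. A virtual knot is almost classical if it has a diagram admitting an Alexander numbering: an integer-valued function on its short arcs (arcs between consecutive classical crossing points) such that at each classical crossing, drawn with both strands oriented downwards, the two left-hand arcs have a common number $\lambda$ and the two right-hand arcs have number $\lambda+1$ (numbers are unchanged through virtual crossings). Alexander polynomial: for a diagram with $n$ classical crossings, label the arcs running from one undercrossing to the next $x_1,\dots,x_n$ consecutively, so that at the $i$-th crossing (of sign $\varepsilon_i$) $x_i$ is the incoming under-arc, $x_{i+1}$ (indices mod $n$) the outgoing under-arc and $x_{k(i)}$ the over-arc. Let $A$ be the $n\times n$ matrix over $\mathbb{Z}[t^{\pm1}]$ whose $i$-th row is the sum of $t^{-\varepsilon_i}$ in column $i$, $-1$ in column $i+1$, and $1-t^{-\varepsilon_i}$ in column $k(i)$. For an almost classical knot $K$ the ideal generated by the $(n-1)\times(n-1)$ minors of $A$ is principal, and $\Delta_K(t)$ is a generator (well defined up to $\pm t^m$; equal to $1$ if $n=0$). One has $\Delta_K(1)=\pm1$, so $\Delta_K\bmod p\neq0$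 for every prime $p$. For a nonzero Laurent polynomial $g=\sum_{j=m}^na_jt^j$ with $a_m,a_n\ne0$, $\operatorname{span}g=n-m$; $\operatorname{span}_pg$ is the span of the reduction $g\bmod p\in\mathbb{F}_p[t^{\pm1}]$. *)

(* Defs.v *)
From mathcomp Require Import all_boot all_order all_algebra fraction.
From mathcomp Require Import all_classical all_reals all_analysis.
From Stdlib Require Import Relation_Operators.

Set Implicit Arguments.
Unset Strict Implicit.
Unset Printing Implicit Defensive.

Import Order.TTheory GRing.Theory Num.Theory numFieldNormedType.Exports.
Local Open Scope classical_set_scope.
Local Open Scope ring_scope.

Section Diagrams.
Variable R : realType.

Definition det2 (u v : R * R) : R := u.1 * v.2 - u.2 * v.1.

(* Curves are parametrized by the circle R/Z, i.e. they are 1-periodic. *)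
Definition same_param (s t : R) : bool := s - t \is a Num.int.

(* The double points of [curve] that are not listed in [classical_crossings]
   are the virtual crossings. *)
Record diagram := Diagram {
  curve : R -> R * R;
  (* pairs (parameter of the over-strand, parameter of the under-strand) *)
  classical_crossings : seq (R * R);
  curve_periodic : forall t, curve (t + 1) = curve t;
  curve_derivable : forall t, derivable curve t 1;
  curve_C1 : continuous (derive1 curve);
  curve_immersed : forall t, derive1 curve t != 0;
  curve_transverse : forall s t, curve s = curve t -> ~~ same_param s t ->
    det2 (derive1 curve s) (derive1 curve t) != 0;
  curve_no_triple : forall s t u, curve s = curve t -> curve t = curve u ->
    [|| same_param s t, same_param t u | same_param s u];
  crossings_range : forall c, c \in classical_crossings ->
    (0 <= c.1 < 1) && (0 <= c.2 < 1);
  crossings_double : forall c, c \in classical_crossings ->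
    c.1 != c.2 /\ curve c.1 = curve c.2;
  crossings_asym : forall o u, (o, u) \in classical_crossings ->
    (u, o) \notin classical_crossings;
  (* the crossings are enumerated in the order in which the knot passes
     under them, starting from the parameter 0 *)
  crossings_sorted : sorted <%R [seq c.2 | c <- classical_crossings]
}.

Definition classical (D : diagram) (o u : R) : bool :=
  has (fun c => same_param o c.1 && same_param u c.2) (classical_crossings D).

(* The over-strand, turned counterclockwise by less than a half turn, gives
   the under-strand: right-handed crossings have sign +1. *)
Definition positive (D : diagram) (c : R * R) : bool :=
  0 < det2 (derive1 (curve D) c.1) (derive1 (curve D) c.2).

Definition reparametrization (phi : R -> R) : Prop :=
  [/\ forall t, phi (t + 1) = phi t + 1,
      forall t, derivable phi t 1,
      continuous (derive1 phi) &
      forall t, 0 < derive1 phi t].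

(* [f] maps [D1] onto [D2] as oriented diagrams; [phi] is the induced map of
   parameters. *)
Definition carries (f : R * R -> R * R) (phi : R -> R) (D1 D2 : diagram) :=
  [/\ reparametrization phi,
      forall t, curve D2 (phi t) = f (curve D1 t) &
      forall s t, classical D2 (phi s) (phi t) = classical D1 s t].

(* [H s] is the stage s of the isotopy, 0 <= s <= 1; an isotopy is extended to
   all real s by making it constant outside [0, 1]. *)
Definition planar_ambient_isotopy (H : R -> R * R -> R * R) : Prop :=
  let d1 (w : R * (R * R)) : R * R := 'D_((1, 0) : R * R) (H w.1) w.2 in
  let d2 (w : R * (R * R)) : R * R := 'D_((0, 1) : R * R) (H w.1) w.2 in
  [/\ forall z, H 0 z = z,
      forall s, bijective (H s) /\ (forall z, differentiable (H s) z),
      continuous (fun w : R * (R * R) => H w.1 w.2),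
      continuous d1 /\ continuous d2 &
      forall w, det2 (d1 w) (d2 w) != 0].

Definition planar_isotopic (D1 D2 : diagram) : Prop :=
  exists H phi, planar_ambient_isotopy H /\ carries (H 1) phi D1 D2.

Definition arc (a b : R) : set R :=
  [set t | exists k : int, a <= t + k%:~R <= b].

Definition detour_move (D1 D2 : diagram) : Prop :=
  exists a b, [/\ a < b < a + 1,
    forall t, ~ arc a b t -> curve D1 t = curve D2 t,
    forall s t, classical D1 s t = classical D2 s t &
    forall s t, arc a b s -> ~~ classical D1 s t /\ ~~ classical D1 t s].

(* The Reidemeister moves are stated in the unit disc; since planar isotopy is
   one of the generators of the equivalence, this covers all discs. *)
Definition unit_disc : set (R * R) := [set z | z.1 ^+ 2 + z.2 ^+ 2 <= 1].

(* [S] is the set of the parameters of the part of both diagrams in the disc. *)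
Definition local_change (S : set R) (D1 D2 : diagram) : Prop :=
  [/\ forall t, unit_disc (curve D1 t) <-> S t,
      forall t, unit_disc (curve D2 t) <-> S t,
      forall t, ~ S t -> curve D1 t = curve D2 t &
      forall s t, ~ S s -> ~ S t -> classical D1 s t = classical D2 s t].

(* The double points of [D] met by [S] are those of the list [l] of
   (over, under) pairs, and they are all classical. *)
Definition crossings_on (D : diagram) (S : set R) (l : seq (R * R)) : Prop :=
  (forall c, c \in l -> S c.1 /\ classical D c.1 c.2) /\
  (forall s t, S s -> curve D s = curve D t ->
     same_param s t \/
     exists2 c, c \in l & (same_param s c.1 && same_param t c.2)
                       || (same_param s c.2 && same_param t c.1)).

Definition reidemeister1 (D1 D2 : diagram) : Prop :=
  exists a b o u, [/\ a < b < a + 1,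
    local_change (arc a b) D1 D2,
    crossings_on D1 (arc a b) [:: (o, u)] &
    crossings_on D2 (arc a b) [::]].

(* The upper strand is pushed off the lower one, which is a diameter. *)
Definition reidemeister2 (D1 D2 : diagram) : Prop :=
  exists a b c d o1 u1 o2 u2,
    let upper := arc a b in let lower := arc c d in
    let S := upper `|` lower in
    [/\ [/\ a < b < a + 1, c < d < c + 1 & upper `&` lower = set0],
      local_change S D1 D2,
      forall t, lower t -> curve D1 t = curve D2 t /\ (curve D1 t).2 = 0,
      forall t, upper t -> 0 < (curve D2 t).2 &
      [/\ upper o1 /\ lower u1, upper o2 /\ lower u2, ~~ same_param o1 o2,
          crossings_on D1 S [:: (o1, u1); (o2, u2)] &
          crossings_on D2 S [::]]].

(* The top strand runs from the left to the right of two crossing diameters,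
   above their intersection in [D1] and below it in [D2]. Each third move is of
   this form, seen from the top one of its three strands; [sigma] tells which
   of the two diameters is the upper one. *)
Definition reidemeister3 (D1 D2 : diagram) : Prop :=
  exists a b c d e f (sigma : bool) o1 u1 o2 u2 p1 v1 p2 v2 m n,
    let top := arc a b in let mid := arc c d in let bot := arc e f in
    let S := top `|` mid `|` bot in
    let sg : R := (-1) ^+ sigma in
    [/\ [/\ a < b < a + 1, c < d < c + 1 & e < f < e + 1] /\
        [/\ top `&` mid = set0, top `&` bot = set0 & mid `&` bot = set0],
      local_change S D1 D2,
      [/\ forall t, mid t ->
            curve D1 t = curve D2 t /\ (curve D1 t).2 = sg * (curve D1 t).1,
          forall t, bot t ->
            curve D1 t = curve D2 t /\ (curve D1 t).2 = - sg * (curve D1 t).1,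
          (curve D1 a).1 < - `|(curve D1 a).2| &
          `|(curve D1 b).2| < (curve D1 b).1],
      [/\ mid m /\ bot n,
          [/\ top o1, mid u1, top o2 & bot u2] &
          [/\ top p1, mid v1, top p2 & bot v2]] &
      [/\ crossings_on D1 S [:: (m, n); (o1, u1); (o2, u2)],
          0 < (curve D1 o1).2 /\ 0 < (curve D1 o2).2,
          crossings_on D2 S [:: (m, n); (p1, v1); (p2, v2)] &
          (curve D2 p1).2 < 0 /\ (curve D2 p2).2 < 0]].

Definition move (D1 D2 : diagram) : Prop :=
  [\/ planar_isotopic D1 D2, detour_move D1 D2, reidemeister1 D1 D2 |
      reidemeister2 D1 D2 \/ reidemeister3 D1 D2].

Definition equivalent : diagram -> diagram -> Prop :=
  clos_refl_sym_trans diagram move.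

Record virtual_knot := VirtualKnot {
  represented_by :> set diagram;
  virtual_knot_class : exists D, represented_by = [set D' | equivalent D D']
}.

Definition rotation (q : nat) (z : R * R) : R * R :=
  let theta := 2 * pi / q%:R in
  (cos theta * z.1 - sin theta * z.2, sin theta * z.1 + cos theta * z.2).

Definition period (K : virtual_knot) (q : nat) : Prop :=
  (2 <= q)%N /\
  exists D, [/\ represented_by K D, forall t, curve D t != 0 &
                exists phi, carries (rotation q) phi D D].

Definition crossing_params (D : diagram) : seq R :=
  sort <=%R ([seq c.1 | c <- classical_crossings D] ++
             [seq c.2 | c <- classical_crossings D]).

(* A short arc is represented by the parameter of its initial crossing point,
   so that [nu x] is the number of the arc leaving x and
   [nu (prev (crossing_params D) x)] the number of the arc arriving at x.
   Turned so that both strands point downwards, the crossing has strand a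
   descending from left to right and strand b descending from right to left:
   the left-hand arcs are the arc arriving along a and the one leaving
   along b. *)
Definition alexander_numbering (D : diagram) (nu : R -> int) : Prop :=
  forall c, c \in classical_crossings D ->
    let: (a, b) := if positive D c then (c.2, c.1) else c in
    let arriving x := nu (prev (crossing_params D) x) in
    exists lam : int,
      [/\ arriving a = lam, nu b = lam, arriving b = lam + 1 & nu a = lam + 1].

Definition almost_classical (K : virtual_knot) : Prop :=
  exists D, represented_by K D /\ exists nu, alexander_numbering D nu.

End Diagrams.

(* Z[t, t^-1] is seen inside the field of fractions of Z[t]. *)
Definition laurent (P : {poly int}) (k : nat) : {fraction {poly int}} :=
  tofrac P / tofrac 'X ^+ k.

Definition is_laurent (g : {fraction {poly int}}) : Prop :=
  exists P k, g = laurent P k.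

(* [find] gives the lowest exponent of a monomial of P. *)
Definition poly_span (F : fieldType) (P : {poly F}) : nat :=
  ((size P).-1 - find (fun a : F => a != 0%R) P)%N.

Definition span_mod (p : nat) (g : {fraction {poly int}}) (s : nat) : Prop :=
  exists P k, let Pp : {poly 'F_p} := map_poly intr P in
    [/\ g = laurent P k, Pp != 0 & s = poly_span Pp].

Section Alexander.
Variable R : realType.
Implicit Type D : diagram R.

Definition num_crossings D : nat := size (classical_crossings D).

Definition crossing D (i : nat) : R * R :=
  nth (0, 0) (classical_crossings D) i.

(* t ^ (- sign of the crossing) *)
Definition twist D (c : R * R) : {fraction {poly int}} :=
  if positive D c then (tofrac 'X)^-1 else tofrac 'X.

(* For 0 < i < n, the arc x_i consists of the parameters between the (i-1)-st
   and the i-th undercrossings, and x_0 goes through the parameter 0. *)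
Definition arc_index D (x : R) : nat :=
  (count (fun c : R * R => (c.2 < x)%R) (classical_crossings D)
     %% num_crossings D)%N.

Definition alexander_matrix D : 'M[{fraction {poly int}}]_(num_crossings D) :=
  \matrix_(i, j)
    let c := crossing D i in
    (twist D c *+ (j == i :> nat)
     - 1 *+ (j == i.+1 %% num_crossings D :> nat)%N
     + (1 - twist D c) *+ (j == arc_index D c.1 :> nat)).

(* The maps f, g choose the rows and columns; a choice with a repetition has
   determinant 0. Without crossings the only minor is the empty one, which is
   equal to 1. *)
Definition minors_ideal D : set {fraction {poly int}} :=
  let n := num_crossings D in
  [set h | exists2 c : {ffun 'I_n.-1 -> 'I_n} -> {ffun 'I_n.-1 -> 'I_n} ->
                       {fraction {poly int}},
     forall f g, is_laurent (c f g) &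
     h = \sum_f \sum_g c f g * \det (mxsub f g (alexander_matrix D))].

Definition alexander_polynomial (K : virtual_knot R)
    (Delta : {fraction {poly int}}) : Prop :=
  is_laurent Delta /\
  exists D, represented_by K D /\
    minors_ideal D = [set h | exists2 c, is_laurent c & h = c * Delta].

End Alexander.

(* Main.v *)
(* The rows of the Alexander matrix are the relations of a Z[t, t^-1]-module
   whose homomorphisms are the colorings of the diagram by Alexander quandles.
   Seen as a function of the parameter of the curve, a coloring is constant off
   the undercrossings, and each move changes it only on a few arcs, where it is
   determined by its values on the rest of the diagram. Diagrams of the same
   virtual knot thus have isomorphic modules, hence the same ideal of minors.

   Let q be a period, p^r the exact power of a prime p dividing q, and n the
   number of classical crossings. The rotation by 2 pi / p^r shifts the rows and
   columns of the matrix by n / p^r. Since (s - 1)^(p^r) = s^(p^r) - 1 modulo p,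
   passing to the basis of the powers of s - 1 makes the matrix block triangular
   modulo p. This gives Murasugi's congruence: up to units, Delta is a multiple
   of d^(p^r - 1) and a divisor of d^(p^r) modulo p, for some d. As Delta has
   positive span modulo p, so has d, hence p^r - 1 is at most the span of Delta
   modulo p. The latter is bounded by a number B that does not depend on p, so
   every period divides (B + 1)!. *)

From mathcomp Require Import all_boot all_order all_algebra fraction all_fingroup.
From mathcomp Require Import all_classical all_reals all_analysis.
From mathcomp Require Import ring lra zify.
Require Import Defs.
Set Implicit Arguments.
Unset Strict Implicit.
Unset Printing Implicit Defensive.
Import Order.TTheory GRing.Theory Num.Theory numFieldNormedType.Exports.
Local Open Scope ring_scope.

(** * Fitting ideals *)

(** Minors of order one less than the number of generators are hard to compare between presentations
    of different sizes. The ideal is therefore generated by determinants of square matrices with all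
    rows but one in the relation module; in this form a surjection of modules is enough for an
    inclusion of ideals. The moves act on parametrized curves, not on Gauss diagrams. The signs of
    the crossings of a Reidemeister move and their order along the strands are not given; the
    intermediate value theorem extracts them from the position of the curves. In the congruence,
    write the matrix as A(s) with s^q = 1 and q = p^r. In the basis of the powers of u = s - 1 all
    diagonal blocks are A(1), which is singular because the row sums vanish, while one column has to
    be removed. In each degree, let the sum of all columns replace the first one: it vanishes in its
    own diagonal block. Shifting the block division by one column moves this sum into the preceding
    block, where the linear coefficient of A(s) contributes. So q - 1 blocks have the same
    determinant d, and the last one receives the free column that selects a minor. *)

Section Fitting.
Variables (K : comNzRingType) (L : set K).

Record subring := Subring {
  subring1 : L 1;
  subringB : forall x y, L x -> L y -> L (x - y);
  subringM : forall x y, L x -> L y -> L (x * y) }.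

Hypothesis HL : subring.

Lemma subring0 : L 0. Proof. by rewrite -(subrr 1); apply: (subringB HL) (subring1 HL) (subring1 HL). Qed.
Lemma subringN x : L x -> L (- x).
Proof. by move=> Lx; rewrite -sub0r; apply: (subringB HL) => //; exact: subring0. Qed.
Lemma subringD x y : L x -> L y -> L (x + y).
Proof. by move=> Lx Ly; rewrite -[y]opprK; apply: (subringB HL) => //; exact: subringN. Qed.
Lemma subring_sum I (r : seq I) (P : pred I) (F : I -> K) :
  (forall i, P i -> L (F i)) -> L (\sum_(i <- r | P i) F i).
Proof. by move=> h; apply: (big_ind L) => //; [exact: subring0 | exact: subringD]. Qed.
Lemma subring_prod I (r : seq I) (P : pred I) (F : I -> K) :
  (forall i, P i -> L (F i)) -> L (\prod_(i <- r | P i) F i).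
Proof. by move=> h; apply: (big_ind L) => //; [exact: subring1 HL | exact: subringM HL]. Qed.
Lemma subring_sign n : L ((-1) ^+ n).
Proof. by rewrite -signr_odd; case: odd; [exact/subringN/(subring1 HL) | exact: subring1 HL]. Qed.
Lemma subring_nat n : L n%:R.
Proof. by elim: n => [|n IH]; [exact: subring0 | rewrite -natr1; apply: subringD => //; exact: subring1]. Qed.

Definition mx_in m n (M : 'M[K]_(m, n)) := forall i j, L (M i j).

Lemma mx_in_mul m n p (M : 'M[K]_(m, n)) (N : 'M[K]_(n, p)) :
  mx_in M -> mx_in N -> mx_in (M *m N).
Proof. by move=> hM hN i j; rewrite mxE; apply: subring_sum => k _; apply: (subringM HL). Qed.

Lemma mx_in1 n : mx_in (1%:M : 'M[K]_n).
Proof. by move=> i j; rewrite mxE; apply: subring_nat. Qed.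

Record ideal (I : set K) := Ideal {
  ideal0 : I 0;
  idealD : forall x y, I x -> I y -> I (x + y);
  idealM : forall c x, L c -> I x -> I (c * x) }.

Lemma ideal_sum (I : set K) J (r : seq J) (P : pred J) (F : J -> K) : ideal I ->
  (forall i, P i -> I (F i)) -> I (\sum_(i <- r | P i) F i).
Proof. by move=> hI h; apply: (big_ind I) => //; [exact: ideal0 hI | exact: idealD hI]. Qed.

(** The exempted index is a natural number, possibly out of range, so that the condition survives
    the deletion of any row, the exempted one included. *)
Definition almost_in g (Rel : set 'rV[K]_g) m (M : 'M[K]_(m, g)) :=
  exists k : nat, forall i : 'I_m, i != k :> nat -> Rel (row i M).

(* The ideal of the minors of order g - 1 of the matrices with rows in Rel,
   given by the expansion of det M along its row that need not be in Rel. *)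
Definition fitting g (Rel : set 'rV[K]_g) (h : K) :=
  forall I : set K, ideal I ->
    (forall M : 'M[K]_g, mx_in M -> almost_in Rel M -> I (\det M)) -> I h.

Lemma almost_in_row' g (Rel : set 'rV[K]_g) m (M : 'M[K]_(m.+1, g)) i :
  almost_in Rel M -> almost_in Rel (row' i M).
Proof.
case=> k hk; exists (unbump i k) => j hj.
have -> : row j (row' i M) = row (lift i j) M by apply/rowP => l; rewrite !mxE.
apply: hk; apply: contra hj => /eqP <-.
by rewrite /= bumpK.
Qed.

(** Repeated expansion along the first column removes the [k] columns on the left; what remains are
    determinants of order [g] formed by rows of the right block. *)
Lemma ideal_det_rsubmx g (Rel : set 'rV[K]_g) (I : set K) : ideal I ->
  (forall M : 'M[K]_g, mx_in M -> almost_in Rel M -> I (\det M)) ->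
  forall k (N : 'M[K]_(k + g)), mx_in N -> almost_in Rel (rsubmx N) -> I (\det N).
Proof.
move=> hI h; elim=> [|k IH] N hN hR.
  apply: h => //; case: hR => k hk; exists k => i hi.
  suff <- : row i (rsubmx N) = row i N by apply: hk.
  by apply/rowP => j; rewrite !mxE; congr (N _ _); apply: val_inj.
rewrite (expand_det_col N ord0); apply: ideal_sum => // i _.
apply: (idealM hI); first exact: hN.
apply: (idealM hI); first exact: subring_sign.
apply: IH; first by move=> a b; rewrite !mxE; apply: hN.
have -> : rsubmx (row' i (col' (ord0 : 'I_(k.+1 + g)) N)) = row' i (rsubmx N).
  apply/matrixP => a b; rewrite !mxE; congr (N _ _).
  by apply: val_inj.
exact: almost_in_row'.
Qed.

Record submodule g (Rel : set 'rV[K]_g) := Submodule {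
  submod0 : Rel 0;
  submodD : forall x y, Rel x -> Rel y -> Rel (x + y);
  submodZ : forall c x, L c -> Rel x -> Rel (c *: x) }.

(** [X] induces a map between the modules presented by [Rel] and [Rel'], and [Y] lifts the
    generators, so the map is onto. Surjectivity suffices because a determinant over [Rel] can be
    rewritten as that of a larger matrix whose right block has its rows in [Rel']. *)
Lemma fitting_sub g g' (Rel : set 'rV[K]_g) (Rel' : set 'rV[K]_g')
    (X : 'M[K]_(g, g')) (Y : 'M[K]_(g', g)) :
  mx_in X -> mx_in Y ->
  (forall v, Rel v -> Rel' (v *m X)) ->
  (forall j, Rel' (row j (1%:M - Y *m X))) ->
  forall h, fitting Rel h -> fitting Rel' h.
Proof.
move=> LX LY hX hY h hh I hI hdet; apply: hh => // M LM [k hk].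
(* The product has the block rows (M, M X) and (-Y, 1 - Y X): all rows but one of its right block
   are in [Rel']. *)
have -> : \det M = \det (block_mx M 0 (- Y) 1%:M *m block_mx 1%:M X 0 1%:M).
  by rewrite det_mulmx det_lblock det_ublock !det1 !mulr1.
rewrite mulmx_block !mulmx1 !mulmx0 ?mul0mx !addr0 ?mul1mx mulNmx.
apply: (ideal_det_rsubmx hI hdet).
  move=> i j; rewrite -[i]splitK -[j]splitK.
  case: (fintype.split i) => i'; case: (fintype.split j) => j'; rewrite /unsplit.
  - by rewrite block_mxEul.
  - by rewrite block_mxEur; apply: mx_in_mul.
  - by rewrite block_mxEdl mxE; apply/subringN/LY.
  - rewrite block_mxEdr mxE; apply: subringD; last exact: mx_in1.
    by rewrite mxE; apply: subringN; apply: mx_in_mul.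
exists k => i hi.
rewrite block_mxEh row_mxKr; move: hi; rewrite -[i]splitK.
case: (fintype.split i) => i'; rewrite /unsplit => hi.
  have -> : row (lshift g' i') (col_mx (M *m X) (- (Y *m X) + 1%:M)) = row i' M *m X.
    by rewrite -row_mul; apply/rowP => j; rewrite mxE col_mxEu [RHS]mxE.
  exact/hX/hk.
have -> : row (rshift g i') (col_mx (M *m X) (- (Y *m X) + 1%:M)) =
  row i' (1%:M - Y *m X).
  by apply/rowP => j; rewrite mxE col_mxEd [RHS]mxE addrC.
exact: hY.
Qed.

End Fitting.

Lemma inj_lift_perm n (f : 'I_n -> 'I_n.+1) : injective f ->
  exists (i : 'I_n.+1) (s : 'S_n), forall j, f j = lift i (s j).
Proof.
move=> injf; have [i hi] : exists i, i \notin codom f.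
  apply/existsP; rewrite -negb_forall; apply/negP => /forallP h.
  have /subset_leq_card : 'I_n.+1 \subset codom f by apply/fintype.subsetP => i _; exact: h.
  by rewrite card_codom // !card_ord ltnn.
have hf j : exists k, f j = lift i k.
  have : i != f j by apply: contraNneq hi => ->; exact: codom_f.
  by case/unlift_some => k -> _; exists k.
have [g hg] := boolp.choice hf.
have injg : injective g by move=> x y e; apply: injf; rewrite !hg e.
by exists i, (perm injg) => j; rewrite permE hg.
Qed.

(** [None] stands for a repeated row or column, [Some b] for the sign left over when the chosen rows
    and columns are sorted. *)
Lemma det_mxsub_cofactor (K : comNzRingType) n (A : 'M[K]_n.+1) (f g : 'I_n -> 'I_n.+1) :
  exists (i j : 'I_n.+1) (b : option bool),
    \det (mxsub f g A) = oapp (fun b : bool => (-1) ^+ b) 0 b * cofactor A i j.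
Proof.
have noninj (B : 'M[K]_(n.+1, n)) (h : 'I_n -> 'I_n.+1) : ~ injective h ->
    \det (rowsub h B) = 0.
  move=> ninj; have [x [y [xy e]]] : exists x y, x != y /\ h x = h y.
    apply: contrapT => hno; apply: ninj => x y e; apply/eqP/negPn/negP => xy.
    by apply: hno; exists x, y.
  by apply: (determinant_alternate xy) => j; rewrite !mxE e.
have [injf|ninjf] := pselect (injective f); last first.
  exists ord0, ord0, None; rewrite /= mul0r -(noninj (colsub g A) f ninjf).
  by congr (\det _); apply/matrixP => i j; rewrite !mxE.
have [injg|ninjg] := pselect (injective g); last first.
  exists ord0, ord0, None; rewrite /= mul0r -det_tr -(noninj (rowsub f A)^T g ninjg).
  by congr (\det _); apply/matrixP => i j; rewrite !mxE.
have [i [s hs]] := inj_lift_perm injf; have [j [t ht]] := inj_lift_perm injg.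
(* Besides the signs of the two permutations, the sign (-1)^(i + j) built into [cofactor] has to be
   cancelled. *)
exists i, j, (Some (odd (s + t + (i + j)))).
have -> : mxsub f g A = row_perm s (col_perm t (row' i (col' j A))).
  by apply/matrixP => k l; rewrite !mxE hs ht.
rewrite row_permE col_permE !det_mulmx !det_perm odd_permV /cofactor /=.
rewrite signr_odd [RHS]mulrA exprD -[(-1) ^+ _ * _ * _]mulrA -expr2 sqrr_sign mulr1 exprD.
by rewrite -[RHS]mulrA; congr (_ * _); rewrite mulrC.
Qed.

(** Puts cofactors into the shape required by [fitting]: only row [i] fails to be a row of [A]. *)
Lemma cofactor_det_row (K : comNzRingType) n (A : 'M[K]_n) i j :
  cofactor A i j = \det (\matrix_(k, l) if k == i then (l == j)%:R else A k l).
Proof.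
rewrite (expand_det_row _ i) (bigD1 j) //= big1 ?addr0 => [|l lj].
  rewrite mxE !eqxx mul1r /cofactor; congr (_ * \det _).
  by apply/matrixP => k l; rewrite !mxE eq_sym (negPf (neq_lift _ _)).
by rewrite mxE eqxx (negPf lj) mul0r.
Qed.

(** Multilinearity in the rows of the product. The sum runs over all maps and not only over the
    increasing ones; this uncollected form is enough for membership in an ideal. *)
Lemma cauchy_binet (K : comNzRingType) m n (C : 'M[K]_(m, n)) (B : 'M[K]_(n, m)) :
  \det (C *m B) = \sum_(f : {ffun 'I_m -> 'I_n})
     (\prod_i C i (f i)) * \det (rowsub f B).
Proof.
rewrite /determinant; under eq_bigr => s _.
  under eq_bigr do rewrite mxE.
  rewrite bigA_distr_bigA big_distrr /=.
  over.
rewrite exchange_big /=; apply: eq_bigr => f _.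
rewrite big_distrr /=; apply: eq_bigr => s _.
rewrite big_split /= mulrCA; congr (_ * (_ * _)).
by apply: eq_bigr => i _; rewrite mxE.
Qed.

Section Minors.
Variables (K : comNzRingType) (L : set K).
Hypothesis HL : subring L.

Definition minors n (A : 'M[K]_n) : set K :=
  [set h | exists2 c : {ffun 'I_n.-1 -> 'I_n} -> {ffun 'I_n.-1 -> 'I_n} -> K,
     forall f g, L (c f g) &
     h = \sum_f \sum_g c f g * \det (mxsub f g A)].

Definition row_span n g (A : 'M[K]_(n, g)) : set 'rV[K]_g :=
  [set v | exists2 w : 'rV[K]_n, mx_in L w & v = w *m A].

Lemma ideal_minors n (A : 'M[K]_n) : ideal L (minors A).
Proof.
split.
- exists (fun _ _ => 0) => [*|]; first exact: subring0.
  by rewrite big1 // => f _; rewrite big1 // => g _; rewrite mul0r.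
- move=> _ _ [c hc ->] [c' hc' ->]; exists (fun f g => c f g + c' f g).
    by move=> f g; apply: subringD.
  rewrite -big_split; apply: eq_bigr => f _ /=; rewrite -big_split.
  by apply: eq_bigr => g _ /=; rewrite mulrDl.
- move=> a _ La [c hc ->]; exists (fun f g => a * c f g).
    by move=> f g; apply: subringM.
  rewrite big_distrr; apply: eq_bigr => f _ /=; rewrite big_distrr.
  by apply: eq_bigr => g _ /=; rewrite mulrA.
Qed.

Lemma minors_mxsub n (A : 'M[K]_n) (f g : {ffun 'I_n.-1 -> 'I_n}) :
  minors A (\det (mxsub f g A)).
Proof.
exists (fun f' g' => ((f' == f) && (g' == g))%:R).
  by move=> *; apply: subring_nat.
rewrite (bigD1 f) //= (bigD1 g) //= !eqxx mul1r big1 => [|g' /negPf->]; last by rewrite mul0r.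
rewrite addr0 big1 ?addr0 // => f' /negPf-> /=.
by rewrite big1 // => g' _; rewrite mul0r.
Qed.

Lemma row_span_submodule n g (A : 'M[K]_(n, g)) : submodule L (row_span A).
Proof.
split.
- by exists 0; [move=> i j; rewrite mxE; exact: subring0 | rewrite mul0mx].
- move=> _ _ [v hv ->] [w hw ->]; exists (v + w); last by rewrite mulmxDl.
  by move=> i j; rewrite mxE; apply: subringD.
- move=> c _ hc [v hv ->]; exists (c *: v); last by rewrite scalemxAl.
  by move=> i j; rewrite mxE; apply: subringM.
Qed.

Lemma row_in_span n g (A : 'M[K]_(n, g)) i : row_span A (row i A).
Proof.
by exists (delta_mx 0 i); [move=> a b; rewrite mxE; apply: subring_nat | rewrite rowE].
Qed.

(** A minor is, up to sign, the determinant of [A] with one row replaced by a unit vector.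
    Conversely, expansion along the exempted row leaves minors of a product with [A], to which the
    Cauchy-Binet formula applies. *)
Lemma minors_fitting n (A : 'M[K]_n) : (0 < n)%N -> mx_in L A ->
  minors A = fitting L (row_span A).
Proof.
case: n A => // n A _ LA; apply/seteqP; split=> h.
  move=> [c hc ->] I hI hdet.
  apply: (ideal_sum _ hI) => f _; apply: (ideal_sum _ hI) => g _.
  apply: (idealM hI) => //.
  have [i [j [b ->]]] := det_mxsub_cofactor A f g.
  apply: (idealM hI).
    by case: b => [b|]; [exact: subring_sign | exact: subring0].
  rewrite cofactor_det_row; apply: hdet.
    by move=> k l; rewrite mxE; case: eqP => // _; apply: subring_nat.
  exists i => k ki; rewrite (_ : row k _ = row k A); first exact: row_in_span.
  by apply/rowP => l; rewrite !mxE ifN.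
move/(_ (minors A)); apply; first exact: ideal_minors.
move=> M LM [k hk].
(* If [k] is out of range, all rows are relations and any row may play the role of the exempted
   one. *)
have [i0 hi0] : exists i0 : 'I_n.+1, forall i, i != i0 -> row_span A (row i M).
  have [kn|kn] := ltnP k n.+1; first by exists (Ordinal kn) => i; apply: hk.
  by exists ord0 => i _; apply: hk; rewrite neq_ltn (leq_trans (ltn_ord i) kn).
rewrite (expand_det_row _ i0); apply: (ideal_sum _ (ideal_minors A)) => j _.
apply: (idealM (ideal_minors A)) => //.
apply: (idealM (ideal_minors A)); first exact: subring_sign.
have hrow i : exists w : 'rV[K]_n.+1, mx_in L w /\ row (lift i0 i) M = w *m A.
  by have [|w] := hi0 (lift i0 i); [rewrite eq_sym neq_lift | exists w].
have [w hw] := boolp.choice hrow.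
have -> : row' i0 (col' j M) = (\matrix_(i, k) w i 0 k) *m (col' j A).
  apply/matrixP => a b; rewrite !mxE.
  have [_ /rowP /(_ (lift j b))] := hw a; rewrite !mxE => ->.
  by apply: eq_bigr => l _; rewrite !mxE.
rewrite cauchy_binet; apply: (ideal_sum _ (ideal_minors A)) => f _.
apply: (idealM (ideal_minors A)).
  by apply: subring_prod => // i _; rewrite mxE; have [+ _] := hw i; apply.
have -> : rowsub f (col' j A) = mxsub f [ffun l => lift j l] A.
  by apply/matrixP => a b; rewrite !mxE ffunE.
exact: minors_mxsub.
Qed.

End Minors.

(** The difference of the cofactors is the determinant of [A] with row [i] replaced by e_j - e_k.
    That matrix kills the all-ones vector; multiplying by its adjugate shows that its determinant is
    0. *)
Lemma cofactor_row_sum0 (K : idomainType) n (A : 'M[K]_n) i j k :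
  (forall l, \sum_m A l m = 0) -> cofactor A i j = cofactor A i k.
Proof.
move=> hA; apply/eqP; rewrite -subr_eq0; apply/eqP.
have [->|jk] := eqVneq j k; first by rewrite subrr.
pose M := \matrix_(l, m) if l == i then (m == j)%:R - (m == k)%:R else A l m.
have cM m : cofactor M i m = cofactor A i m.
  rewrite /cofactor; congr (_ * \det _); apply/matrixP => a b.
  by rewrite !mxE eq_sym (negPf (neq_lift _ _)).
have -> : cofactor A i j - cofactor A i k = \det M.
  rewrite (expand_det_row _ i) (bigD1 j) //= (bigD1 k) 1?eq_sym //= !mxE !eqxx.
  rewrite (negPf jk) eq_sym (negPf jk) !cM subr0 sub0r mul1r mulN1r big1 ?addr0 //.
  by move=> l /andP[/negPf lj /negPf lk]; rewrite mxE eqxx lj lk subrr mul0r.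
have hM : M *m const_mx 1 = 0 :> 'cV_n.
  apply/matrixP => a b; rewrite !mxE.
  under eq_bigr => l _ do rewrite [const_mx _ _ _]mxE mulr1 mxE.
  case: eqP => [_|_]; last exact: hA.
  rewrite sumrB (bigD1 j) //= eqxx big1 => [|l /negPf->//].
  by rewrite (bigD1 k) //= eqxx [X in _ - (_ + X)]big1 => [|l /negPf->//]; rewrite subrr.
have := mulmxA (\adj M) M (const_mx 1 : 'cV_n).
rewrite hM mulmx0 mul_adj_mx mul_scalar_mx => /matrixP /(_ i 0).
by rewrite !mxE mulr1.
Qed.

(** * Periodic matrices in characteristic p *)

Lemma sum_ord_mul (V : nmodType) q m (F : nat -> V) : (0 < m)%N ->
  \sum_(y < q * m) F y = \sum_(j < q) \sum_(b < m) F (j * m + b)%N.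
Proof.
move=> m0; elim: q => [|q IH]; first by rewrite mul0n !big_ord0.
rewrite big_ord_recr /= -IH mulSn addnC.
by rewrite big_split_ord /=.
Qed.

Lemma det_block_utriangular (K : comNzRingType) m k (h : nat -> nat -> K) : (0 < m)%N ->
  (forall i j, (i < k * m)%N -> (j < k * m)%N -> (j %/ m < i %/ m)%N -> h i j = 0) ->
  \det (\matrix_(i < k * m, j < k * m) h i j) =
  \prod_(l < k) \det (\matrix_(a < m, b < m) h (l * m + a)%N (l * m + b)%N).
Proof.
move=> m0; elim: k h => [|k IH] h h0; first by rewrite big_ord0 det_mx00.
rewrite big_ord_recl /=.
have -> : \matrix_(i < k.+1 * m, j < k.+1 * m) h i j =
  block_mx (\matrix_(a < m, b < m) h a b) (\matrix_(a < m, b < k * m) h a (m + b)%N)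
     0 (\matrix_(a < k * m, b < k * m) h (m + a)%N (m + b)%N)
  :> 'M[K]_(m + k * m).
  apply/matrixP => i j; rewrite -[i](@splitK m (k * m)) -[j](@splitK m (k * m)).
  case: (fintype.split i) => i'; case: (fintype.split j) => j'; rewrite /unsplit.
  - by rewrite block_mxEul !mxE.
  - by rewrite block_mxEur !mxE.
  - rewrite block_mxEdl !mxE /=; apply: h0.
    + by rewrite mulSn ltn_add2l.
    + by rewrite mulSn (leq_trans (ltn_ord j')) ?leq_addr.
    + by rewrite divn_small // divnDl // divnn m0 add1n.
  - by rewrite block_mxEdr !mxE.
rewrite det_ublock; congr (_ * _); rewrite (IH (fun i j => h (m + i)%N (m + j)%N)).
  apply: eq_bigr => l _; congr (\det _); apply/matrixP => a b; rewrite !mxE.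
  by rewrite /bump leq0n mulnDl mul1n !addnA.
move=> i j hi hj hij; apply: h0; rewrite ?mulSn ?ltn_add2l //.
by rewrite !divnDl // divnn m0 !add1n ltnS.
Qed.

(** Column 0 is dropped, the others move one place to the left, and [v] fills the last place. Moving
    [v] to the front costs the sign (-1)^n. *)
Lemma det_cofactor_col0 (K : comNzRingType) n (f : nat -> nat -> K) (v : nat -> K) :
  \det (\matrix_(i < n.+1, k < n.+1) if (k < n)%N then f i k.+1 else v i) =
  (-1) ^+ n * \sum_(i < n.+1) v i * cofactor (\matrix_(i < n.+1, j < n.+1) f i j) i 0.
Proof.
rewrite (expand_det_col _ ord_max) big_distrr; apply: eq_bigr => i _ /=.
rewrite mxE ltnn /cofactor [RHS]mulrCA; congr (_ * _).
rewrite addn0 [RHS]mulrA [X in _ = X * _]mulrC -exprD; congr (_ * \det _).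
by apply/matrixP => a b; rewrite !mxE lift_max ltn_ord lift0.
Qed.

Section Pascal.
Variables (K : comNzRingType) (p r : nat).
Hypothesis pK : p \in [pchar K].
Let q := (p ^ r)%N.

(** The image in [K] of the binomial coefficient j over i. With s = 1 + u, it is the coefficient of
    u^i in s^j. *)
Definition pascal j i : K := (('X + 1 : {poly K}) ^+ j)`_i.

Lemma pascalD j k i : pascal (j + k) i = \sum_(l < i.+1) pascal j l * pascal k (i - l).
Proof. by rewrite /pascal exprD coefM. Qed.

Let X1E : 'X + 1 = 'X - (-1)%:P :> {poly K}. Proof. by rewrite polyCN opprK. Qed.

Lemma pascal_small j i : (j < i)%N -> pascal j i = 0.
Proof. by move=> ji; rewrite /pascal X1E nth_default // size_exp_XsubC. Qed.

Lemma pascal_diag j : pascal j j = 1.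
Proof.
have /monicP := monic_exp j (monicXsubC (-1 : K)).
by rewrite /lead_coef size_exp_XsubC /pascal X1E.
Qed.

Lemma pascal0r j : pascal j 0 = 1.
Proof. by rewrite /pascal -horner_coef0 !hornerE /= ?add0r ?expr1n. Qed.

(** In characteristic p, (1 + u)^q = 1 + u^q, so s^q is 1 up to terms of degree at least q. *)
Lemma pascal_modq j i : (i < q)%N -> pascal (j %% q) i = pascal j i.
Proof.
move=> iq; rewrite [in RHS](divn_eq j q); elim: (j %/ q)%N => [|d IH]; first by rewrite mul0n add0n.
rewrite IH mulSn -addnA [(q + _)%N]addnC /pascal [in RHS]exprD.
have -> : ('X + 1 : {poly K}) ^+ q = 'X^q + 1.
  rewrite exprDn_pchar ?expr1n //.
  by rewrite (eq_pnat _ (@pchar_poly K)) (eq_pnat _ (pcharf_eq pK)) pnatX pnat_id ?(pcharf_prime pK).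
by rewrite mulrDr mulr1 coefD coefMXn iq add0r.
Qed.

End Pascal.

Lemma modn_mulDl q m x b : (b < m)%N -> ((x * m + b) %% (q * m) = (x %% q) * m + b)%N.
Proof.
move=> bm; case: (posnP q) => [->|q0]; first by rewrite mul0n !modn0.
rewrite [in LHS](divn_eq x q) mulnDl -addnA -mulnA modnMDl modn_small //.
by rewrite (@leq_trans ((x %% q).+1 * m)) ?leq_mul2r ?ltn_mod ?q0 ?orbT // mulSn addnC ltn_add2r.
Qed.

Lemma ltn_mulD q m x b : (x < q)%N -> (b < m)%N -> (x * m + b < q * m)%N.
Proof.
by move=> xq bm; rewrite (@leq_trans (x.+1 * m)) ?leq_mul2r ?xq ?orbT // mulSn addnC ltn_add2r.
Qed.

Lemma sum_ord_modD (V : nmodType) q j (G : nat -> V) :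
  \sum_(k < q) G k = \sum_(k < q) G ((k + j) %% q)%N.
Proof.
case: q => [|q]; first by rewrite !big_ord0.
rewrite (reindex_inj (addIr (inZp j : 'I_q.+1))) /=.
by apply: eq_bigr => k _; rewrite /= modnDmr.
Qed.

Section Periodic.
Variables (K : comNzRingType) (p r m : nat) (f : nat -> nat -> K).
Hypotheses (pK : p \in [pchar K]) (m0 : (0 < m)%N).
Let q := (p ^ r)%N.
Let n := (q * m)%N.
Hypothesis f_row : forall i, (i < n)%N -> \sum_(j < n) f i j = 0.
Hypothesis f_shift : forall i j, (i < n)%N -> (j < n)%N ->
  f ((i + m) %% n)%N ((j + m) %% n)%N = f i j.

(** Block k of the first block row. By [f_shift] the matrix is block circulant, hence determined by
    these blocks. *)
Let F k a b := f a ((k %% q) * m + b)%N.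

Let q0 : (0 < q)%N. Proof. by rewrite expn_gt0 (prime_gt0 (pcharf_prime pK)). Qed.
Let n0 : (0 < n)%N. Proof. by rewrite muln_gt0 q0. Qed.

Let f_shiftE j k a b : (j < q)%N -> (a < m)%N -> (b < m)%N ->
  f (j * m + a)%N (((k + j) %% q) * m + b)%N = F k a b.
Proof.
move=> jq am bm; elim: j jq => [|j IH] jq; first by rewrite mul0n addn0.
rewrite -IH ?(ltnW jq) // -[RHS]f_shift; last 2 first.
- by apply: ltn_mulD => //; exact: ltnW.
- by apply: ltn_mulD => //; rewrite ltn_mod.
have e x c : (c < m)%N -> ((x * m + c + m) %% n = (x.+1 %% q) * m + c)%N.
  by move=> cm; rewrite addnAC -mulSnr modn_mulDl.
by rewrite !e // (modn_small jq) -[((k + j) %% q).+1]addn1 modnDml addn1 addnS.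
Qed.

(* Multiplication by A(s) = \sum_k F k s^k in the basis of the powers of
   u = s - 1, where u^q = s^q - 1 = 0 in characteristic p. *)
Let N l a i b : K := if (l <= i)%N then \sum_(k < q) F k a b * pascal K k (i - l) else 0.

(** Both sides are the coefficient of u^i in the entry (a, b) of s^j A(s): on the left s^j A(s) is
    expanded in powers of s, on the right s^j is expanded in powers of u. *)
Let mul_pascal j a i b : (j < q)%N -> (a < m)%N -> (i < q)%N -> (b < m)%N ->
  \sum_(k < q) f (j * m + a)%N (k * m + b)%N * pascal K k i =
  \sum_(l < q) pascal K j l * N l a i b.
Proof.
move=> jq am iq bm.
rewrite (sum_ord_modD _ j (fun k => f (j * m + a)%N (k * m + b)%N * pascal K k i)).
under eq_bigr => k _.
  rewrite f_shiftE // (pascal_modq pK) // addnC pascalD big_distrr /=.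
  over.
rewrite exchange_big /=.
rewrite (@big_ord_widen _ _ _ i.+1 q (fun l => \sum_(k < q) F k a b * (pascal K j l * pascal K k (i - l)))) //.
rewrite big_mkcond; apply: eq_bigr => l _; rewrite /N ltnS; case: leqP => _; last by rewrite mulr0.
by rewrite big_distrr; apply: eq_bigr => k _; rewrite mulrCA.
Qed.

Let pascal_mx := \matrix_(i < n, y < n)
  (pascal K (i %/ m) (y %/ m) *+ (i %% m == y %% m)%N).

(** Column c = i m + b reads off the coefficient of u^i at position b, except that for b = 0 it
    reads the sum of these coefficients over all positions. Column 0 thus produces the row sums of
    [f], which vanish. *)
Let g y c := if (c %% m == 0)%N then pascal K (y %/ m) (c %/ m)
  else pascal K (y %/ m) (c %/ m) *+ (y %% m == c %% m)%N.

Let basis_mx := \matrix_(y < n, k < n)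
  (if (k < n.-1)%N then (if (y < n.-1)%N then g y.+1 k.+1 else 0) else (y == k)%:R).

Definition augmented (v : nat -> K) :=
  \matrix_(i < n, k < n) (if (k < n.-1)%N then f i k.+1 else v i).

Let Nc y c := if (c %% m == 0)%N then \sum_(b < m) N (y %/ m) (y %% m) (c %/ m) b
  else N (y %/ m) (y %% m) (c %/ m) (c %% m).

Let graded (w : nat -> K) y k := if (k < n.-1)%N then Nc y k.+1 else w y.

Let det_pascal : \det pascal_mx = 1.
Proof.
rewrite det_trig.
  by rewrite big1 // => i _; rewrite mxE eqxx pascal_diag.
apply/is_trig_mxP => i j ij; rewrite mxE.
have [e|ne] := eqVneq (i %/ m)%N (j %/ m)%N; last first.
  by rewrite pascal_small ?mul0rn // ltn_neqAle ne leq_div2r // ltnW.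
case: eqP => // e'; move: ij; rewrite (divn_eq i m) (divn_eq j m) e e' ltnn; by [].
Qed.

Let det_basis : \det basis_mx = 1.
Proof.
rewrite det_trig.
  rewrite big1 // => i _; rewrite mxE eqxx; case: ifP => // h.
  by rewrite h /g eqxx pascal_diag mulr1n if_same.
apply/is_trig_mxP => i j ij; rewrite mxE.
case: ifP => jn; last by rewrite -val_eqE /= (ltn_eqF ij).
case: ifP => // _; rewrite /g.
have [e|ne] := eqVneq (i.+1 %/ m)%N (j.+1 %/ m)%N; last first.
  by rewrite pascal_small ?mul0rn ?if_same // ltn_neqAle ne leq_div2r // ltnW.
have lt : (i.+1 %% m < j.+1 %% m)%N.
  by have : (i.+1 < j.+1)%N by []; rewrite {1}(divn_eq i.+1 m) {1}(divn_eq j.+1 m) e ltn_add2l.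
by rewrite gtn_eqF ?(leq_ltn_trans _ lt) // (ltn_eqF lt).
Qed.

(** Column 0 of [f] is absent from [augmented]. This puts it back into the sums: its coefficient
    [g 0 c] is 0 for c > 0. *)
Let sum_shift (H : nat -> K) : H 0%N = 0 ->
  \sum_(y < n) (if (y < n.-1)%N then H y.+1 else 0) = \sum_(y < n) H y.
Proof.
move=> H0; case: n n0 => // k _ /=.
rewrite big_ord_recr big_ord_recl /= ltnn addr0 H0 add0r.
by apply: eq_bigr => i _; rewrite ltn_ord.
Qed.

(** The change of columns by [basis_mx] becomes a change of rows by [pascal_mx]. The extra column is
    untouched by the former, so it must be written as the image of some [w] under the latter. *)
Let graded_mul (v w : nat -> K) :
  (forall i : 'I_n, v i = \sum_(y < n) pascal_mx i y * w y) ->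
  augmented v *m basis_mx = pascal_mx *m \matrix_(y < n, k < n) graded w y k.
Proof.
move=> vw; apply/matrixP => i k; rewrite !mxE.
have [kn|/negbTE kn] := boolP (k < n.-1)%N; last first.
  rewrite (bigD1 k) //= big1 => [|y yk]; last by rewrite !mxE kn (negPf yk) mulr0.
  rewrite addr0 !mxE kn eqxx mulr1 vw /=.
  by apply: eq_bigr => y _; rewrite !mxE /graded kn.
have divE j b : (b < m)%N -> ((j * m + b) %/ m = j)%N.
  by move=> bm; rewrite divnMDl // divn_small // addn0.
have modE j b : (b < m)%N -> ((j * m + b) %% m = b)%N.
  by move=> bm; rewrite modnMDl modn_small.
have iq : (i %/ m < q)%N by rewrite ltn_divLR.
have im : (i %% m < m)%N by rewrite ltn_mod.
have cq : (k.+1 %/ m < q)%N.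
  by rewrite ltn_divLR // -ltn_predRL.
have cm : (k.+1 %% m < m)%N by rewrite ltn_mod.
transitivity (\sum_(y < n) f i y * g y k.+1).
  rewrite -(sum_shift (H := fun y => f i y * g y k.+1)).
    by apply: eq_bigr => y _; rewrite !mxE kn; case: ifP => h; rewrite ?h ?mulr0.
  rewrite /g div0n mod0n; have [c0|/negPf c0] := eqVneq (k.+1 %% m)%N 0%N.
    rewrite pascal_small ?mulr0 // divn_gt0 // dvdn_leq //; exact/eqP.
  by rewrite ?[X in _ *+ X]eq_sym ?c0 ?mulr0n mulr0.
rewrite (sum_ord_mul _ (fun y => f i y * g y k.+1)) //.
have pick a0 x (G : nat -> K) : (a0 < m)%N ->
    \sum_(a < m) (x *+ (a0 == a)) * G a = x * G a0.
  move=> am; rewrite (bigD1 (Ordinal am)) //= eqxx mulr1n big1 ?addr0 // => a.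
  by rewrite eq_sym -val_eqE /= => /negPf ->; rewrite mul0r.
transitivity (\sum_(l < q) pascal K (i %/ m) l * Nc (l * m + i %% m)%N k.+1); last first.
  transitivity (\sum_(y < n) (pascal K (i %/ m) (y %/ m) *+ (i %% m == y %% m)%N) * Nc y k.+1).
    rewrite (sum_ord_mul _ (fun y => (pascal K (i %/ m) (y %/ m) *+ (i %% m == y %% m)%N) * Nc y k.+1)) //.
    apply: eq_bigr => l _; rewrite -(pick _ _ (fun a => Nc (l * m + a)%N k.+1)) //.
    by apply: eq_bigr => a _; rewrite divE ?modE.
  by apply: eq_bigr => y _; rewrite !mxE /graded kn.
have mp b : (b < m)%N ->
    \sum_(j < q) f i (j * m + b)%N * pascal K j (k.+1 %/ m) =
    \sum_(l < q) pascal K (i %/ m) l * N l (i %% m) (k.+1 %/ m) b.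
  by move=> bm; rewrite -(mul_pascal iq im cq bm) -(divn_eq i m).
rewrite /g /Nc; case: (k.+1 %% m == 0)%N.
  transitivity (\sum_(b < m) \sum_(j < q) f i (j * m + b)%N * pascal K j (k.+1 %/ m)).
    rewrite exchange_big; apply: eq_bigr => j _; apply: eq_bigr => b _ /=.
    by rewrite divE.
  under eq_bigr => b _ do rewrite mp //.
  rewrite exchange_big; apply: eq_bigr => l _ /=.
  by rewrite divE // modE // big_distrr.
under [RHS]eq_bigr => l _ do rewrite divE // modE //.
rewrite -(mp _ cm); apply: eq_bigr => j _.
rewrite mulrC -(pick _ _ (fun b => f i (j * m + b)%N)) //.
by apply: eq_bigr => b _; rewrite divE // modE // mulrC eq_sym.
Qed.

(** The block division is shifted by one: block l holds the columns from l m + 1 to l m + m. Its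
    last column is therefore the sum column of degree l + 1, except in the last block, where it is
    the free column. *)
Let blk (w : nat -> K) l a b :=
  if (b < m.-1)%N then N l a l b.+1
  else if (l < q.-1)%N then \sum_(b < m) N l a l.+1 b else w (l * m + a)%N.

(** u^l A(s) has no terms of degree below l. Under the diagonal blocks this leaves only the sum
    columns in their own degree, and these are row sums of A(1). *)
Let det_graded w : \det (\matrix_(y < n, k < n) graded w y k) =
  \prod_(l < q) \det (\matrix_(a < m, b < m) blk w l a b).
Proof.
have N_gt l a i b : (i < l)%N -> N l a i b = 0 by move=> il; rewrite /N leqNgt il.
have lastq k : (k < n)%N -> ~~ (k < n.-1)%N -> (k = q.-1 * m + m.-1)%N.
  move=> kn; rewrite -leqNgt => nk.
  have -> : k = n.-1 by apply/eqP; rewrite eqn_leq nk -ltnS (prednK n0) kn.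
  by rewrite /n -{1}(prednK q0) mulSn -{1}(prednK m0) addSn addnC.
rewrite det_block_utriangular // => [|i k iN kN ki].
  apply: eq_bigr => l _; congr (\det _); apply/matrixP => a b; rewrite !mxE /graded /blk.
  case: ifPn => kn; last first.
    have e := lastq _ (ltn_mulD (ltn_ord l) (ltn_ord b)) kn.
    have /(congr1 (modn^~ m)) := e; rewrite !modnMDl !modn_small ?prednK // => eb.
    have /(congr1 (divn^~ m)) := e; rewrite !divnMDl // !divn_small ?prednK // !addn0 => el.
    by rewrite eb el !ltnn.
  rewrite /Nc -addnS !divnMDl // !modnMDl (divn_small (ltn_ord a)) (modn_small (ltn_ord a)) addn0.
  have [bm|bm] := boolP (b < m.-1)%N.
    have bm' : (b.+1 < m)%N by rewrite -ltn_predRL.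
    by rewrite modn_small // divn_small //= addn0.
  have eb : b = m.-1 :> nat by apply/eqP; rewrite eqn_leq -ltnS (prednK m0) ltn_ord leqNgt.
  rewrite eb prednK // modnn divnn m0 addn1; case: ifPn => // lq; exfalso; move: kn lq.
  rewrite eb -leqNgt => kn lq; have el : l = q.-1 :> nat.
    by apply/eqP; rewrite eqn_leq lq -ltnS (prednK q0) ltn_ord.
  move: kn; rewrite el; have -> : (q.-1 * m + m.-1 = n.-1)%N; last by rewrite ltnn.
  by apply/eqP; rewrite -eqSS -addnS !prednK // addnC -mulSn prednK.
rewrite /graded; case: ifPn => kn; last first.
  move: ki; rewrite (lastq _ kN kn) divnMDl // divn_small ?prednK // addn0.
  by rewrite ltnNge -ltnS prednK // ltn_divLR // iN.
rewrite /Nc; have := divn_eq k m; set j := (k %/ m)%N in ki *; set b := (k %% m)%N => ek.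
have bm : (b < m)%N by rewrite ltn_mod.
have [bm1|bm1] := eqVneq b m.-1.
  have -> : (k.+1 = j.+1 * m)%N by rewrite ek bm1 -addnS prednK // mulSn addnC.
  (* The sum column of degree j + 1 vanishes by degree in the rows beyond block j + 1, and by
     [f_row] in that block itself. *)
  rewrite modnMl mulnK //=; case: (ltngtP j.+1 (i %/ m)) ki => // [lt _|e _].
    by rewrite big1 // => b' _; rewrite N_gt.
  rewrite e /N leqnn subnn.
  under eq_bigr => b' _ do under eq_bigr => x _ do rewrite pascal0r mulr1.
  have jq : (i %/ m < q)%N by rewrite ltn_divLR.
  have im : (i %% m < m)%N by rewrite ltn_mod.
  rewrite exchange_big /=; transitivity (\sum_(y < n) f (i %% m)%N y).
    rewrite (sum_ord_mul _ (fun y => f (i %% m)%N y)) //.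
    by apply: eq_bigr => x _; apply: eq_bigr => b2 _; rewrite /F (modn_small (ltn_ord x)).
  by apply: f_row; rewrite (leq_trans im) ?leq_pmull.
have bm' : (b.+1 < m)%N.
  by rewrite -ltn_predRL ltn_neqAle bm1 -ltnS prednK.
have -> : (k.+1 %% m = b.+1)%N by rewrite ek -addnS modnMDl modn_small.
have -> : (k.+1 %/ m = j)%N by rewrite ek -addnS divnMDl // divn_small // addn0.
by rewrite /= N_gt.
Qed.

(** A(1) without its first column, completed by the row sums of the coefficient of u in A(s). [N]
    depends on its degrees only through their difference, so all diagonal blocks but the last are
    equal to this one. *)
Let D := \matrix_(a < m, b < m)
  if (b < m.-1)%N then N 0 a 0 b.+1 else \sum_(b < m) N 0 a 1 b.

Let det_augmented (v w : nat -> K) :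
  (forall i : 'I_n, v i = \sum_(y < n) pascal_mx i y * w y) ->
  \det (augmented v) = \det D ^+ q.-1 * \det (\matrix_(a < m, b < m) blk w q.-1 a b).
Proof.
move=> /graded_mul /(congr1 determinant); rewrite !det_mulmx det_pascal det_basis mulr1 mul1r => ->.
rewrite det_graded -[in LHS](prednK q0) big_ord_recr /=; congr (_ * _).
rewrite -[in RHS](card_ord q.-1) -prodr_const; apply: eq_bigr => l _.
congr (\det _); apply/matrixP => a b; rewrite !mxE /blk ltn_ord.
case: ifP => _; first by rewrite /N !leqnn !subnn.
by apply: eq_bigr => b' _; rewrite /N leqnSn leq0n subSnn.
Qed.

(* Murasugi's congruence: the minors of order n - 1 of the periodic matrix
   generate the same ideal as the products of d ^ (q - 1) with the minors of
   the quotient matrix A(1), and d belongs to the ideal of the latter. *)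
Theorem periodic_minors : exists d : K,
  (forall v, exists e, \det (augmented v) = d ^+ q.-1 * e) /\
  (exists v, \det (augmented v) = d ^+ q).
Proof.
exists (\det D); split.
  move=> v.
  (* [pascal_mx] has determinant 1, so its adjugate is its inverse and every [v] comes from some
     [w]. *)
  pose w y := if insub y is Some y' then \sum_(i < n) \adj pascal_mx y' i * v i else 0.
  have hw (i : 'I_n) : v i = \sum_(y < n) pascal_mx i y * w y.
    have := mul_mx_adj pascal_mx; rewrite det_pascal => /matrixP h.
    transitivity (\sum_(j < n) (pascal_mx *m \adj pascal_mx) i j * v j).
      rewrite (bigD1 i) //= big1 => [|j ji]; rewrite h mxE ?eqxx ?mul1r ?addr0 //.
      by rewrite eq_sym (negPf ji) mul0r.
    under eq_bigr => j _ do rewrite mxE big_distrl /=.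
    rewrite exchange_big; apply: eq_bigr => y _ /=.
    by rewrite /w valK big_distrr /=; apply: eq_bigr => j _; rewrite mulrA.
  by exists (\det (\matrix_(a < m, b < m) blk w q.-1 a b)); rewrite (det_augmented hw).
(* The free column that makes the last block equal to [D] as well. *)
pose w y := \sum_(b < m) N 0 (y %% m)%N 1 b.
pose v i := if insub i is Some i' then \sum_(y < n) pascal_mx i' y * w y else 0.
exists v; rewrite (@det_augmented v w) => [|i]; last by rewrite /v valK.
rewrite -[in RHS](prednK q0) exprSr; congr (_ * \det _).
apply/matrixP => a b; rewrite !mxE /blk ltnn /w modnMDl modn_small //.
by case: ifP => _ //; rewrite /N !leqnn !subnn.
Qed.

End Periodic.

(** * Laurent polynomials and spans modulo p *)

Local Notation X := (tofrac ('X : {poly int})).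

Lemma X_neq0 : X != 0. Proof. by rewrite tofrac_eq0 polyX_eq0. Qed.

Lemma XnE k : X ^+ k = tofrac ('X^k : {poly int}). Proof. by rewrite tofracXn. Qed.

Lemma is_laurentP g : is_laurent g <-> exists k P, X ^+ k * g = tofrac P.
Proof.
split=> [[P [k ->]]|[k [P e]]]; last first.
  by exists P, k; rewrite /laurent -e mulrC mulKf // expf_neq0 // X_neq0.
by exists k, P; rewrite /laurent mulrC divfK // expf_neq0 // X_neq0.
Qed.

Lemma is_laurent_subring : subring is_laurent.
Proof.
split; first by apply/is_laurentP; exists 0%N, 1; rewrite expr0 tofrac1 mulr1.
- move=> x y /is_laurentP [k [P hP]] /is_laurentP [l [S hS]].
  apply/is_laurentP; exists (k + l)%N, ('X^l * P - 'X^k * S).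
  by rewrite tofracB !tofracM -!XnE -hP -hS exprD mulrBr !mulrA [X ^+ l * _]mulrC.
- move=> x y /is_laurentP [k [P hP]] /is_laurentP [l [S hS]].
  apply/is_laurentP; exists (k + l)%N, (P * S).
  by rewrite tofracM -hP -hS exprD mulrACA.
Qed.

Lemma laurent_tofrac P : is_laurent (tofrac P).
Proof. by apply/is_laurentP; exists 0%N, P; rewrite expr0 mul1r. Qed.

Lemma laurent_Xinv : is_laurent X^-1.
Proof. by apply/is_laurentP; exists 1%N, 1; rewrite expr1 tofrac1 divff // X_neq0. Qed.

Lemma laurentM P S k l : laurent P k * laurent S l = laurent (P * S) (k + l).
Proof. by rewrite /laurent mulf_div tofracM exprD. Qed.

Lemma laurentXM n P k : laurent ('X^n * P) k = X ^+ n * laurent P k.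
Proof. by rewrite /laurent tofracM -XnE mulrA. Qed.

Lemma laurent0E P : laurent P 0 = tofrac P.
Proof. by rewrite /laurent expr0 divr1. Qed.

Section Span.
Variable F : fieldType.
Implicit Types P S : {poly F}.

Lemma poly_span_XnM a P : P`_0 != 0 -> poly_span ('X^a * P) = (size P).-1.
Proof.
move=> P0; have Pn0 : P != 0 by apply: contraNneq P0 => ->; rewrite coef0.
have sP : (0 < size P)%N by rewrite size_poly_gt0.
have sX : size ('X^a * P)%R = (a + size P)%N by rewrite mulrC size_mulXn.
rewrite /poly_span sX.
suff -> : find (fun c : F => c != 0%R) ('X^a * P)%R = a by rewrite -(prednK sP) addnS /= addKn.
have hs : (a < size ('X^a * P)%R)%N by rewrite sX -[X in (X < _)%N]addn0 ltn_add2l.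
have : (find (fun c : F => c != 0%R) ('X^a * P)%R <= a)%N.
  rewrite leqNgt; apply/negP => /(before_find 0) /=.
  by rewrite coefXnM ltnn subnn P0.
rewrite leq_eqVlt => /orP[/eqP //|lt].
have : has (fun c : F => c != 0%R) ('X^a * P)%R by rewrite has_find (ltn_trans lt).
by move/(nth_find 0); rewrite coefXnM lt eqxx.
Qed.

Lemma poly_valuation P : P != 0 -> exists a S, P = 'X^a * S /\ S`_0 != 0.
Proof.
have [k] := ubnP (size P); elim: k P => // k IH P; rewrite ltnS => sP P0.
have [e|ne] := eqVneq P`_0 0; last by exists 0%N, P; rewrite expr0 mul1r.
have /dvdpP[S PE] : 'X %| P.
  by rewrite -['X]subr0 -polyC0 dvdp_XsubCl rootE horner_coef0 e.
have S0 : S != 0 by apply: contraNneq P0 => S0; rewrite PE S0 mul0r.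
have [|a [T [TE T0]]] := IH S _ S0.
  by move: sP; rewrite PE size_mulX.
by exists a.+1, T; rewrite PE TE exprSr -!mulrA ['X * _]mulrC.
Qed.

Lemma poly_spanM P S : P != 0 -> S != 0 ->
  poly_span (P * S) = (poly_span P + poly_span S)%N.
Proof.
move=> P0 S0; have [a [P' [-> hP]]] := poly_valuation P0.
have [b [S' [-> hS]]] := poly_valuation S0.
have P'0 : P' != 0 by apply: contraNneq hP => ->; rewrite coef0.
have S'0 : S' != 0 by apply: contraNneq hS => ->; rewrite coef0.
rewrite mulrACA -exprD !poly_span_XnM ?coef0M ?mulf_neq0 // size_mul //.
by rewrite -(ltn_predK (_ : (0 < size P')%N)) ?size_poly_gt0 //
  -{1}(ltn_predK (_ : (0 < size S')%N)) ?size_poly_gt0 // addSn addnS.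
Qed.

Lemma poly_span_Xn a : poly_span ('X^a : {poly F}) = 0%N.
Proof. by rewrite -['X^a]mulr1 poly_span_XnM ?size_poly1 // coef1 oner_neq0. Qed.

Lemma poly_span_exp P k : P != 0 -> poly_span (P ^+ k) = (k * poly_span P)%N.
Proof.
move=> P0; elim: k => [|k IH]; first by rewrite expr0 (poly_span_Xn 0).
by rewrite exprS poly_spanM ?expf_neq0 // IH mulSn.
Qed.

Lemma poly_span_dvdp P S : S != 0 -> P %| S -> (poly_span P <= poly_span S)%N.
Proof.
move=> S0 /dvdpP[T e]; move: S0; rewrite e mulf_eq0 negb_or => /andP[T0 P0].
by rewrite poly_spanM // leq_addl.
Qed.

End Span.

Local Notation modp p := (map_poly (intr : int -> 'F_p)).

Lemma laurent_inj P S k l : laurent P k = laurent S l -> 'X^l * P = 'X^k * S.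
Proof.
have tE T j : tofrac T = X ^+ j * laurent T j.
  by rewrite /laurent mulrC divfK // expf_neq0 // X_neq0.
move=> e; apply/eqP; rewrite -tofrac_eq !tofracM -!XnE.
by rewrite (tE P k) (tE S l) e mulrCA.
Qed.

(** One numerator [P0] over the integers serves all primes at once: any other numerator differs from
    it by powers of X, which do not affect spans. *)
Lemma span_mod_bounded Delta : exists B, forall p s,
  prime p -> span_mod p Delta s -> (s <= B)%N.
Proof.
have [[P0 [k0 D0]]|nL] := pselect (is_laurent Delta); last first.
  by exists 0%N => p s _ [P [k [D _ _]]]; case: nL; exists P, k.
exists (size P0) => p s pp [P [k [D Pp ->]]].
have /(congr1 (modp p)) := laurent_inj (etrans (esym D) D0).
rewrite !rmorphM /= !map_polyXn => e.
have P0p : modp p P0 != 0.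
  apply/eqP => h; move/eqP: e.
  by rewrite h mulr0 mulf_eq0 (negPf Pp) expf_eq0 polyX_eq0 andbF.
have := congr1 (@poly_span _) e.
rewrite !poly_spanM ?expf_neq0 ?polyX_eq0 // !poly_span_Xn !add0n => ->.
rewrite /poly_span (leq_trans (leq_subr _ _)) // (leq_trans (leq_pred _)) //.
exact: size_poly.
Qed.

(** Meant for diagrams without crossings, whose ideal contains 1: modulo p, the numerator of Delta
    then divides a power of X. *)
Lemma span_mod_unit p Delta s : prime p -> is_laurent Delta ->
  (exists2 c, is_laurent c & 1 = c * Delta) -> span_mod p Delta s -> s = 0%N.
Proof.
move=> pp _ [c [C [l ->]] e] [P [k [D Pp ->]]].
have /laurent_inj : laurent (C * P) (l + k) = laurent 1 0.
  by rewrite -laurentM laurent0E tofrac1 e D.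
rewrite expr0 mul1r mulr1 => /(congr1 (modp p)); rewrite rmorphM /= map_polyXn => h.
have : modp p P %| 'X^(l + k) by rewrite -h dvdp_mull.
move/poly_span_dvdp => /(_ _); rewrite poly_span_Xn leqn0 => hh.
by apply/eqP/hh; rewrite expf_neq0 // polyX_eq0.
Qed.

Section PeriodicSpan.
Variables (f : nat -> nat -> {poly int}) (p r m n : nat).
Hypotheses (p_pr : prime p) (m0 : (0 < m)%N).
Let q := (p ^ r)%N.
Hypothesis nE : n.+1 = (q * m)%N.
Hypothesis f_row : forall i, (i < n.+1)%N -> \sum_(j < n.+1) f i j = 0.
Hypothesis f_shift : forall i j, (i < n.+1)%N -> (j < n.+1)%N ->
  f ((i + m) %% n.+1)%N ((j + m) %% n.+1)%N = f i j.
Variable Delta : {fraction {poly int}}.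
Let A := \matrix_(i < n.+1, j < n.+1) (X^-1 * tofrac (f i j)).
Hypothesis minorsE : minors is_laurent A = [set h | exists2 c, is_laurent c & h = c * Delta]%classic.

Let B := \matrix_(i < n.+1, j < n.+1) f i j.
Let Bp := \matrix_(i < n.+1, j < n.+1) modp p (f i j).

Let minorA (g h : 'I_n -> 'I_n.+1) :
  X ^+ n * \det (mxsub g h A) = tofrac (\det (mxsub g h B)).
Proof.
rewrite -det_map_mx.
have -> : map_mx (@tofrac {poly int}) (mxsub g h B) = X *: mxsub g h A.
  by apply/matrixP => i j; rewrite !mxE mulrA divff ?mul1r // X_neq0.
by rewrite detZ.
Qed.

Let cofactorBp i j : modp p (cofactor B i j) = cofactor Bp i j.
Proof.
rewrite /cofactor rmorphM rmorphXn rmorphN1 -det_map_mx; congr (_ * \det _).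
by apply/matrixP => a b; rewrite !mxE.
Qed.

Let pchar_poly_Fp : p \in [pchar {poly 'F_p}].
Proof. by rewrite pchar_poly pchar_Fp. Qed.

Lemma periodic_span s : (1 < q)%N -> span_mod p Delta s -> (0 < s)%N -> (q.-1 <= s)%N.
Proof.
move=> q1 [P [k [DE Pp ->]]].
have f_row' i : (i < q * m)%N -> \sum_(j < q * m) modp p (f i j) = 0.
  by rewrite -nE => /f_row /(congr1 (modp p)); rewrite rmorph_sum rmorph0.
have f_shift' i j : (i < q * m)%N -> (j < q * m)%N ->
  modp p (f ((i + m) %% (q * m)) ((j + m) %% (q * m)))%N = modp p (f i j).
  by rewrite -nE => hi hj; rewrite f_shift.
have [d [hd [v0 hv0]]] := periodic_minors pchar_poly_Fp m0 f_row' f_shift'.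
have augE v : \det (augmented p r m (fun i j => modp p (f i j)) v) =
    (-1) ^+ n * \sum_(i < n.+1) v i * cofactor Bp i 0.
  by rewrite /Bp -(det_cofactor_col0 n (fun i j => modp p (f i j))) /augmented -nE.
(* Taking the unit vector e_i as the free column isolates a single cofactor. *)
have cof_dvd i : d ^+ q.-1 %| cofactor Bp i 0.
  have [e he] := hd (fun j => (j == i)%:R).
  have := augE (fun j => (j == i)%:R); rewrite he (bigD1 i) //= eqxx mul1r big1.
    rewrite addr0 => ce.
    have -> : cofactor Bp i 0 = d ^+ q.-1 * ((-1) ^+ n * e).
      by rewrite mulrCA ce mulrA -expr2 sqrr_sign mul1r.
    by rewrite dvdp_mulr.
  by move=> j ji; rewrite val_eqE (negPf ji) mul0r.
(* The minor is a Laurent multiple of Delta; clearing the denominators costs a power of X. *)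
have cof_mul i : exists N, modp p P %| 'X^N * cofactor Bp i 0.
  pose g := [ffun a : 'I_n => lift i a]; pose h := [ffun a : 'I_n => lift (0 : 'I_n.+1) a].
  have := @minors_mxsub _ _ is_laurent_subring n.+1 A g h.
  rewrite minorsE => -[c [C [l cE]]] /(congr1 (fun x => X ^+ n * x)).
  rewrite minorA cE DE => e.
  have /laurent_inj : laurent (\det (mxsub g h B)) 0 = laurent ('X^n * (C * P)) (l + k).
    by rewrite laurent0E e laurentXM -laurentM.
  rewrite expr0 mul1r => e'; exists (l + k)%N.
  have -> : cofactor Bp i 0 = (-1) ^+ (i + 0)%N * modp p (\det (mxsub g h B)).
    rewrite -cofactorBp /cofactor rmorphM rmorphXn rmorphN1; congr (_ * modp p (\det _)).
    by apply/matrixP => a b; rewrite !mxE !ffunE.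
  rewrite mulrCA dvdp_mull // -(map_polyXn (intr : int -> 'F_p)) -rmorphM e' !rmorphM /=.
  by rewrite !dvdp_mull.
have d_mul : exists N, modp p P %| 'X^N * d ^+ q.
  rewrite -hv0 augE; suff [N hN] : exists N, modp p P %| 'X^N * \sum_(i < n.+1) v0 i * cofactor Bp i 0.
    by exists N; rewrite mulrCA dvdp_mull.
  apply: (big_ind (fun x => exists N, modp p P %| 'X^N * x)).
  - by exists 0%N; rewrite mulr0 dvdp0.
  - move=> x y [N hN] [M hM]; exists (N + M)%N; rewrite exprD mulrDr dvdp_add //.
      by rewrite mulrAC dvdp_mulr.
    by rewrite -mulrA dvdp_mull.
  - by move=> i _; have [N hN] := cof_mul i; exists N; rewrite mulrCA dvdp_mull.
(* The Laurent polynomials with a numerator divisible by d^(q - 1) modulo p. As they form an ideal,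
   Delta is reached once the minors, which generate it, are known to belong to it. *)
pose I : set _ := [set h | exists N G, X ^+ N * h = tofrac G /\ d ^+ q.-1 %| modp p G]%classic.
have idI : ideal is_laurent I.
  split.
  - by exists 0%N, 0; rewrite mulr0 tofrac0 rmorph0 dvdp0.
  - move=> x y [N [G [hG dG]]] [M [H [hH dH]]].
    exists (N + M)%N, ('X^M * G + 'X^N * H); split.
      by rewrite tofracD !tofracM -!XnE -hG -hH exprD mulrDr !mulrA [X ^+ M * _]mulrC.
    by rewrite rmorphD !rmorphM dvdp_add // dvdp_mull.
  - move=> c x /is_laurentP [M [H hH]] [N [G [hG dG]]].
    exists (M + N)%N, (H * G); split; first by rewrite tofracM -hH -hG exprD mulrACA.
    by rewrite rmorphM dvdp_mull.
have : I Delta.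
  have : minors is_laurent A Delta.
    by rewrite minorsE; exists 1; [exact: subring1 is_laurent_subring | rewrite mul1r].
  case=> c hc ->; apply: (ideal_sum _ idI) => g _; apply: (ideal_sum _ idI) => h _.
  apply: (idealM idI) => //; exists n, (\det (mxsub g h B)); split; first exact: minorA.
  have [i [j [b ->]]] := det_mxsub_cofactor B g h.
  (* [cof_dvd] only concerns column 0; since the row sums vanish, the other columns give the same
     cofactors. *)
  rewrite rmorphM dvdp_mull // (cofactor_row_sum0 _ _ 0) /= ?cofactorBp // => l.
  by rewrite (eq_bigr (fun j' : 'I_n.+1 => f l j')) ?f_row // => j' _; rewrite mxE.
case=> N [G [e dG]].
have /laurent_inj : laurent ('X^N * P) k = laurent G 0.
  by rewrite laurent0E -e DE laurentXM.
rewrite expr0 mul1r => /(congr1 (modp p)); rewrite !rmorphM /= !map_polyXn => eG.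
have [M hM] := d_mul.
have Xn0 a : 'X^a != 0 :> {poly 'F_p} by rewrite expf_neq0 // polyX_eq0.
have Gp0 : modp p G != 0.
  by apply/eqP => h; move/eqP: eG; rewrite h mulr0 mulf_eq0 (negPf Pp) (negPf (Xn0 _)).
have d0 : d != 0.
  apply: contraNneq Gp0 => h; move: dG; rewrite h expr0n.
  by case: (q) q1 => // -[|q'] //= _; rewrite dvd0p.
have := poly_span_dvdp Gp0 dG; rewrite poly_span_exp // => le1.
have dq0 : d ^+ q != 0 by rewrite expf_neq0.
have Xd0 : 'X^M * d ^+ q != 0 by rewrite mulf_neq0 ?Xn0.
have := poly_span_dvdp Xd0 hM.
rewrite poly_spanM ?Xn0 // poly_span_Xn add0n poly_span_exp // => le2 s0.
have := congr1 (@poly_span _) eG; rewrite !poly_spanM // !poly_span_Xn !add0n => ->.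
(* The span of Delta is at most q times that of d, so d cannot have span 0. *)
have d1 : (0 < poly_span d)%N.
  by have := leq_trans s0 le2; rewrite muln_gt0 => /andP[].
by rewrite (leq_trans _ le1) // leq_pmulr.
Qed.

End PeriodicSpan.

Local Open Scope classical_set_scope.


(** * Germs and arc labels *)

Section Germs.
Variable R : realType.
Implicit Types (t s a b e : R) (P Q S : R -> Prop).

(** Punctured one-sided neighbourhoods: colors jump at undercrossings, so the two sides and the
    point itself have to be told apart. *)
Definition leftof t P := exists2 e, 0 < e & forall s, t - e < s < t -> P s.
Definition rightof t P := exists2 e, 0 < e & forall s, t < s < t + e -> P s.

Lemma leftof_true t P : (forall s, s < t -> P s) -> leftof t P.
Proof. by move=> h; exists 1 => // s /andP[_ /h]. Qed.

Lemma rightof_true t P : (forall s, t < s -> P s) -> rightof t P.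
Proof. by move=> h; exists 1 => // s /andP[/h]. Qed.

Lemma leftof_and t P Q S : leftof t P -> leftof t Q ->
  (forall s, s < t -> P s -> Q s -> S s) -> leftof t S.
Proof.
move=> [e e0 he] [d d0 hd] h; exists (Num.min e d); first by rewrite lt_min e0.
move=> s /andP[]; rewrite ltrBlDr -ltrBlDl lt_min => /andP[h1 h2] st.
by apply: h => //; [apply: he | apply: hd]; rewrite st andbT; lra.
Qed.

Lemma rightof_and t P Q S : rightof t P -> rightof t Q ->
  (forall s, t < s -> P s -> Q s -> S s) -> rightof t S.
Proof.
move=> [e e0 he] [d d0 hd] h; exists (Num.min e d); first by rewrite lt_min e0.
move=> s /andP[st]; rewrite -ltrBlDl lt_min => /andP[h1 h2].
by apply: h => //; [apply: he | apply: hd]; rewrite st /=; lra.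
Qed.

Lemma leftof_imp t P Q : leftof t P -> (forall s, s < t -> P s -> Q s) -> leftof t Q.
Proof. by move=> hP h; apply: (leftof_and hP hP) => s st + _; exact: h. Qed.

Lemma rightof_imp t P Q : rightof t P -> (forall s, t < s -> P s -> Q s) -> rightof t Q.
Proof. by move=> hP h; apply: (rightof_and hP hP) => s st + _; exact: h. Qed.

Lemma leftof_gt t a : a < t -> leftof t (fun s => a < s).
Proof. by move=> h; exists (t - a); [lra | move=> s; lra]. Qed.

Lemma rightof_lt t a : t < a -> rightof t (fun s => s < a).
Proof. by move=> h; exists (a - t); [lra | move=> s; lra]. Qed.

Lemma leftof_shift t k P : leftof (t + k) P -> leftof t (fun s => P (s + k)).
Proof. by case=> e e0 h; exists e => // s st; apply: h; lra. Qed.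

Lemma rightof_shift t k P : rightof (t + k) P -> rightof t (fun s => P (s + k)).
Proof. by case=> e e0 h; exists e => // s st; apply: h; lra. Qed.

Lemma leftof_ex t P : leftof t P -> exists2 s, s < t & P s.
Proof. by case=> e e0 h; exists (t - e / 2); [lra | apply: h; lra]. Qed.

Lemma rightof_ex t P : rightof t P -> exists2 s, t < s & P s.
Proof. by case=> e e0 h; exists (t + e / 2); [lra | apply: h; lra]. Qed.

Lemma leftof_seq (T : eqType) t (r : seq T) (P : T -> R -> Prop) :
  (forall x, x \in r -> leftof t (P x)) -> leftof t (fun s => forall x, x \in r -> P x s).
Proof.
elim: r => [|y r IH] h; first by apply: leftof_true.
apply: (leftof_and (h y (mem_head _ _)) (IH _)).
  by move=> x xr; apply: h; rewrite inE xr orbT.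
by move=> s _ Py Pr x; rewrite inE => /orP[/eqP-> | /Pr].
Qed.

Lemma rightof_seq (T : eqType) t (r : seq T) (P : T -> R -> Prop) :
  (forall x, x \in r -> rightof t (P x)) -> rightof t (fun s => forall x, x \in r -> P x s).
Proof.
elim: r => [|y r IH] h; first by apply: rightof_true.
apply: (rightof_and (h y (mem_head _ _)) (IH _)).
  by move=> x xr; apply: h; rewrite inE xr orbT.
by move=> s _ Py Pr x; rewrite inE => /orP[/eqP-> | /Pr].
Qed.

(** The infimum [c] of the counterexamples satisfies P by the third hypothesis; the second one then
    keeps counterexamples away from [c], a contradiction. *)
Lemma real_induction P a b : P a ->
  (forall t, a <= t < b -> P t -> rightof t P) ->
  (forall t, a < t <= b -> (forall s, a <= s < t -> P s) -> P t) ->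
  forall t, a <= t <= b -> P t.
Proof.
move=> Pa Pr Pl t0 /andP[at0 t0b]; apply: contrapT => nP.
pose E := [set t | a <= t <= b /\ ~ P t].
have E0 : E t0 by split=> //; rewrite at0.
have Elb : lbound E a by move=> x [/andP[]].
have hE : has_lbound E by exists a.
set c := inf E.
have ac : a <= c by apply: lb_le_inf => //; exists t0.
have ct0 : c <= t0 by apply: ge_inf.
have cb : c <= b by apply: le_trans t0b.
have Plt s : a <= s < c -> P s.
  move=> /andP[as_ sc]; apply: contrapT => nPs.
  have : c <= s by apply: ge_inf => //; split=> //; lra.
  by lra.
have Pc : P c.
  have [->//|ne] := eqVneq c a.
  by apply: Pl => //; rewrite cb andbT lt_neqAle eq_sym ne.
have ct : c < t0 by rewrite lt_neqAle ct0 andbT; apply: contra_notN nP => /eqP <-.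
have [e e0 he] : rightof c P by apply: Pr => //; lra.
have : c + e <= c; last by lra.
apply: lb_le_inf; first by exists t0.
move=> x [xab nPx]; rewrite leNgt; apply/negP => xe; apply: nPx.
have [cx|xc|<-//] := ltgtP c x; first by apply: he; rewrite cx.
by apply: Plt; lra.
Qed.

End Germs.

Section Params.
Variable R : realType.
Implicit Types (s t x : R).

Lemma same_paramP s t : reflect (exists k : int, s = t + k%:~R) (same_param s t).
Proof.
apply: (iffP idP) => [/intrP[k e]|[k ->]]; first by exists k; rewrite -e addrC subrK.
by rewrite /same_param addrC addKr intr_int.
Qed.

Lemma same_param_refl t : same_param t t.
Proof. by apply/same_paramP; exists 0; rewrite addr0. Qed.
Hint Resolve same_param_refl : core.

Lemma same_param_sym s t : same_param s t = same_param t s.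
Proof. by rewrite /same_param -rpredN opprB. Qed.

Lemma same_param_trans t s x : same_param s t -> same_param t x -> same_param s x.
Proof. by rewrite /same_param => h1 h2; have := rpredD h1 h2; rewrite addrA subrK. Qed.

Lemma same_paramDl k s t : same_param (s + k%:~R) t = same_param s t.
Proof.
apply/idP/idP; apply: same_param_trans; apply/same_paramP; last by exists k.
by exists (- k); rewrite intrN addrK.
Qed.

Lemma same_paramDr k s t : same_param s (t + k%:~R) = same_param s t.
Proof. by rewrite same_param_sym same_paramDl same_param_sym. Qed.

Lemma same_param_l s t : same_param s t -> same_param s =1 same_param t.
Proof.
move=> st x; apply/idP/idP; apply: same_param_trans => //.
by rewrite same_param_sym.
Qed.

Lemma same_param_r s t x : same_param s t -> same_param x s = same_param x t.
Proof. by move=> st; rewrite ![same_param x _]same_param_sym (same_param_l st). Qed.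

Lemma same_param_eq s t : same_param s t -> `|s - t| < 1 -> s = t.
Proof.
move/same_paramP => [k ->]; rewrite [_ - t]addrC addKr => h.
suff -> : k = 0 by rewrite addr0.
by move: h; rewrite -intr_norm ltrz1; lia.
Qed.

Definition frac x : R := x - (Num.floor x)%:~R.

Lemma frac_itv x : 0 <= frac x < 1.
Proof. by have := floor_itv x; rewrite intrD /frac; lra. Qed.

Lemma frac_same x : same_param (frac x) x.
Proof. by apply/same_paramP; exists (- Num.floor x); rewrite intrN. Qed.

Lemma frac_eq x y : same_param x y -> 0 <= y < 1 -> frac x = y.
Proof.
move=> xy y01; have x01 := frac_itv x.
apply: same_param_eq; first exact: same_param_trans (frac_same _) xy.
by rewrite ltr_norml; lra.
Qed.

Lemma frac_id y : 0 <= y < 1 -> frac y = y.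
Proof. exact: frac_eq. Qed.

Lemma fracE x : x = frac x + (Num.floor x)%:~R.
Proof. by rewrite /frac subrK. Qed.

Lemma frac_same_eq x y : same_param x y -> frac x = frac y.
Proof. by move=> xy; apply: frac_eq (frac_itv _); rewrite (same_param_l xy) same_param_sym frac_same. Qed.

Variable D : diagram R.
Let us := [seq c.2 | c <- classical_crossings D].
Let n := num_crossings D.

Lemma size_us : size us = n. Proof. by rewrite size_map. Qed.

Definition under t := has (fun c => same_param t c.2) (classical_crossings D).

(** [arc_index] counts with a strict inequality, so an undercrossing gets the label of its incoming
    arc and labels are locally constant from the left everywhere. *)
Definition label t := arc_index D (frac t).

Lemma under_same s t : same_param s t -> under s = under t.
Proof. by move=> st; apply: eq_has => c; rewrite (same_param_l st). Qed.

Lemma us_itv x : x \in us -> 0 <= x < 1.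
Proof. by case/mapP => c /crossings_range /andP[_ h] ->. Qed.

Lemma underE t : under t = (frac t \in us).
Proof.
apply/hasP/mapP => -[c cD h]; exists c => //.
  by apply: frac_eq h _; apply: us_itv; apply: map_f.
by rewrite -h same_param_sym frac_same.
Qed.

Lemma classical_under o t : classical D o t -> under t.
Proof. by case/hasP => c cD /andP[_ h]; apply/hasP; exists c. Qed.

Lemma under_classical t : under t -> exists o, classical D o t.
Proof. by case/hasP => c cD h; exists c.1; apply/hasP; exists c; rewrite ?same_param_refl. Qed.

Lemma classical_same o o' t t' : same_param o o' -> same_param t t' ->
  classical D o t = classical D o' t'.
Proof. by move=> h h'; apply: eq_has => c; rewrite (same_param_l h) (same_param_l h'). Qed.

Let cnt x := count (< x) us.

Lemma labelE t : label t = (cnt (frac t) %% n)%N.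
Proof. by rewrite /label /arc_index /cnt count_map. Qed.

Lemma cnt_leftof x : leftof x (fun s => cnt s = cnt x).
Proof.
apply: (@leftof_imp _ _ (fun s => forall u, u \in us -> (u < s) = (u < x))).
  apply: leftof_seq => u _; have [ux|xu] := ltP u x.
    exact: (leftof_imp (leftof_gt ux)).
  by apply: leftof_true => s sx; apply/negbTE; rewrite -leNgt; lra.
by move=> s _ h; apply: eq_in_count.
Qed.

Lemma cnt_rightof x : rightof x (fun s => cnt s = count (<= x) us).
Proof.
apply: (@rightof_imp _ _ (fun s => forall u, u \in us -> (u < s) = (u <= x))).
  apply: rightof_seq => u _; have [ux|xu] := leP u x.
    by apply: rightof_true => s sx; lra.
  by apply: (rightof_imp (rightof_lt xu)) => s _ su; apply/negbTE; rewrite -leNgt ltW.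
by move=> s _ h; apply: eq_in_count.
Qed.

Lemma us_uniq : uniq us.
Proof. exact: lt_sorted_uniq (crossings_sorted D). Qed.

Lemma count_leE x : count (<= x) us = (cnt x + (x \in us))%N.
Proof.
rewrite -(count_uniq_mem x us_uniq) addnC /cnt.
have := count_predUI (pred1 x) (< x) us.
have -> : count (predI (pred1 x) (< x)) us = 0%N.
  rewrite (@eq_count _ _ pred0) ?count_pred0 // => y /=.
  by case: eqP => //= ->; rewrite ltxx.
by rewrite addn0 => <-; apply: eq_count => y /=; rewrite le_eqVlt.
Qed.

Lemma cnt1 : cnt 1 = n.
Proof.
rewrite -size_us; apply/eqP; rewrite -all_count; apply/allP => u /us_itv.
by case/andP.
Qed.

Lemma cnt0 : cnt 0 = 0%N.
Proof.
apply/eqP; rewrite -leqn0 leqNgt -has_count; apply/hasPn => u /us_itv /andP[h _].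
by rewrite -leNgt.
Qed.

Lemma cnt_ltn x y w : w \in us -> x <= w < y -> (cnt x < cnt y)%N.
Proof.
move=> wu /andP[xw wy].
have : (cnt x < count (<= w) us)%N.
  apply: (@leq_ltn_trans (cnt w)); last by rewrite count_lt_le_mem.
  by apply: sub_count => u /= ux; lra.
by move/leq_trans; apply; apply: sub_count => u /= uw; lra.
Qed.

Lemma label_same s t : same_param s t -> label s = label t.
Proof. by move=> st; rewrite /label (frac_same_eq st). Qed.

Let frac_floor s t : (Num.floor t)%:~R <= s < (Num.floor t)%:~R + 1 ->
  frac s = s - (Num.floor t)%:~R.
Proof.
move=> h; apply: frac_eq; last lra.
by apply/same_paramP; exists (Num.floor t); rewrite subrK.
Qed.

Lemma label_leftof t : leftof t (fun s => label s = label t).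
Proof.
have tE := fracE t; have := frac_itv t; rewrite le_eqVlt => /andP[/orP[/eqP t0|t0] t1].
  (* At an integer parameter the count restarts from 0, while from the left it is n: the same label
     modulo n. *)
  have := leftof_shift (k := 1 - (Num.floor t)%:~R) (t := t); rewrite {1}tE -t0.
  have -> : 0 + (Num.floor t)%:~R + (1 - (Num.floor t)%:~R) = 1 :> R by lra.
  move=> /(_ _ (cnt_leftof 1)) h.
  apply: (leftof_and h (@leftof_gt _ t (t - 1) _)); first lra.
  move=> s st hs ts; rewrite !labelE -t0 cnt0 mod0n.
  rewrite (@frac_eq s (s + (1 - (Num.floor t)%:~R))); last lra.
    by rewrite hs cnt1 modnn.
  apply/same_paramP; exists (Num.floor t - 1); rewrite intrB; lra.
have := leftof_shift (k := - (Num.floor t)%:~R) (cnt_leftof (frac t)).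
move=> h; apply: (leftof_and h (@leftof_gt _ t (Num.floor t)%:~R _)); first lra.
move=> s st hs ts; rewrite !labelE (frac_floor (s := s) (t := t)); last lra.
by rewrite hs.
Qed.

Lemma label_rightof_cnt t : rightof t (fun s => label s = ((cnt (frac t) + under t) %% n)%N).
Proof.
have tE := fracE t; have /andP[t0 t1] := frac_itv t.
have := rightof_shift (k := - (Num.floor t)%:~R) (cnt_rightof (frac t)).
move=> h; apply: (rightof_and h (@rightof_lt _ t ((Num.floor t)%:~R + 1) _)); first lra.
move=> s st hs ts; rewrite !labelE (frac_floor (s := s) (t := t)); last lra.
by rewrite hs count_leE underE.
Qed.

Lemma label_rightof t : ~~ under t -> rightof t (fun s => label s = label t).
Proof.
by move=> /negbTE nu; have := label_rightof_cnt t; rewrite nu addn0 -labelE.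
Qed.

Lemma label_rightof_under t : under t -> rightof t (fun s => label s = (label t).+1 %% n)%N.
Proof.
by move=> u; have := label_rightof_cnt t; rewrite u addn1 labelE -[in X in _ -> X]addn1 modnDml addn1.
Qed.

Lemma label_lt t : (0 < n)%N -> (label t < n)%N.
Proof. by move=> n0; rewrite labelE ltn_mod. Qed.

(** The crossings are sorted by their under-parameters, so the number of undercrossings before a
    given one is its index in the list. *)
Lemma under_crossing t : under t ->
  (label t < n)%N /\ same_param t (crossing D (label t)).2.
Proof.
rewrite underE => tu; have iu : (index (frac t) us < n)%N by rewrite -size_us index_mem.
have e : cnt (frac t) = index (frac t) us.
  by rewrite -{1}(nth_index 0 tu) /cnt count_lt_nth // ?size_us // crossings_sorted.
have le : label t = index (frac t) us by rewrite labelE e modn_small.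
rewrite le; split=> //; rewrite /crossing -(nth_map _ 0) ?size_us //.
by rewrite nth_index // same_param_sym frac_same.
Qed.

Lemma label_crossing i : (i < n)%N -> label (crossing D i).2 = i.
Proof.
move=> iN; have e : (crossing D i).2 = nth 0 us i by rewrite /crossing (nth_map (0, 0)).
have mem : nth 0 us i \in us by rewrite mem_nth ?size_us.
rewrite labelE e (frac_id (us_itv mem)) /cnt count_lt_nth ?size_us ?crossings_sorted //.
by rewrite modn_small.
Qed.

Lemma classical_crossing o t : classical D o t ->
  let c := crossing D (label t) in
  [/\ (label t < n)%N, same_param t c.2 & same_param o c.1].
Proof.
move=> ot; have [l1 l2] := under_crossing (classical_under ot); split=> //.
case/hasP: ot => c cD /andP[oc tc].
suff -> : crossing D (label t) = c by [].
have iN : (index c (classical_crossings D) < n)%N by rewrite index_mem.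
rewrite (label_same tc) -{1}(nth_index (0, 0) cD) -/(crossing D _) label_crossing //.
by rewrite /crossing nth_index.
Qed.

Lemma crossing_classical i : (i < n)%N -> classical D (crossing D i).1 (crossing D i).2.
Proof.
by move=> iN; apply/hasP; exists (crossing D i); rewrite ?mem_nth // !same_param_refl.
Qed.

End Params.

Local Notation K := {fraction {poly int}}.
Local Notation HL := is_laurent_subring.

(** * Colorings *)

Section Cong.
Variables (g : nat) (Rel : set 'rV[K]_g).
Hypothesis HR : submodule is_laurent Rel.
Implicit Types x y z : 'rV[K]_g.

Definition cong x y := Rel (x - y).

Lemma cong_refl x : cong x x.
Proof. by rewrite /cong subrr; exact: submod0 HR. Qed.

Lemma congZ c x y : is_laurent c -> cong x y -> cong (c *: x) (c *: y).
Proof. by rewrite /cong -scalerBr => h1 h2; exact: (submodZ HR h1 h2). Qed.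

Lemma cong_sym x y : cong x y -> cong y x.
Proof.
by move=> h; have := submodZ HR (subringN HL (subring1 HL)) h; rewrite scaleN1r opprB.
Qed.

Lemma congD x y x' y' : cong x y -> cong x' y' -> cong (x + x') (y + y').
Proof. by move=> h h'; have := submodD HR h h'; rewrite /cong opprD addrACA. Qed.

Lemma cong_trans y x z : cong x y -> cong y z -> cong x z.
Proof. by move=> h h'; have := submodD HR h h'; rewrite addrA subrK. Qed.

Lemma cong_eq x y : x = y -> cong x y.
Proof. by move=> ->; exact: cong_refl. Qed.

End Cong.

Section Coloring.
Variable R : realType.
Variable D : diagram R.

Lemma curve_same s t : same_param s t -> curve D s = curve D t.
Proof.
have cn x (k : nat) : curve D (x + k%:R) = curve D x.
  by elim: k => [|k IH]; rewrite ?addr0 // -natr1 addrA curve_periodic.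
move/same_paramP => [[k|k] ->]; first exact: cn.
by rewrite -(cn _ k.+1) NegzE intrN addrNK.
Qed.

Lemma curve'_same s t : same_param s t -> derive1 (curve D) s = derive1 (curve D) t.
Proof.
move=> st; rewrite /derive1 (curve_same st).
rewrite (_ : (fun h : R => h^-1 *: (curve D (h + s) - curve D t)) =
  fun h : R => h^-1 *: (curve D (h + t) - curve D t)) //.
apply/funext => h; rewrite (@curve_same (h + s) (h + t)) //.
by move: st; rewrite /same_param opprD addrACA subrr add0r.
Qed.

Lemma twist_same o o' u u' : same_param o o' -> same_param u u' ->
  twist D (o, u) = twist D (o', u').
Proof. by move=> h h'; rewrite /twist /positive /= (curve'_same h) (curve'_same h'). Qed.

Lemma twist_laurent c : is_laurent (twist D c).
Proof.
by rewrite /twist; case: positive; [exact: laurent_Xinv | exact: laurent_tofrac].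
Qed.

Lemma twist_inv_laurent c : is_laurent (twist D c)^-1.
Proof.
by rewrite /twist; case: positive; rewrite ?invrK; [exact: laurent_tofrac | exact: laurent_Xinv].
Qed.

Lemma twist_neq0 c : twist D c != 0.
Proof. by rewrite /twist; case: positive; rewrite ?invr_eq0 X_neq0. Qed.

(** With T the twist of crossing i, row i of the Alexander matrix says that x_(i+1) is [cross T] of
    x_i and of the over-arc. *)
Definition cross T g (x y : 'rV[K]_g) : 'rV[K]_g := T *: x + (1 - T) *: y.

(* Colorings by the Alexander quandle 'rV_g / Rel; the value at an
   undercrossing is the color of the incoming arc. *)
Record coloring g (Rel : set 'rV[K]_g) (f : R -> 'rV[K]_g) : Prop := Coloring {
  col_in : forall t, mx_in is_laurent (f t);
  col_per : forall s t, same_param s t -> cong Rel (f s) (f t);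
  col_left : forall t, leftof t (fun s => cong Rel (f s) (f t));
  col_right : forall t, ~~ under D t -> rightof t (fun s => cong Rel (f s) (f t));
  col_cross : forall o t, classical D o t ->
    rightof t (fun s => cong Rel (f s) (cross (twist D (o, t)) (f t) (f o))) }.

Section CongCross.
Variables (g : nat) (Rel : set 'rV[K]_g).
Hypothesis HR : submodule is_laurent Rel.

Lemma cong_cross T x x' y y' : is_laurent T -> cong Rel x x' -> cong Rel y y' ->
  cong Rel (cross T x y) (cross T x' y').
Proof.
move=> LT h h'; apply: congD => //; apply: congZ => //.
exact: (subringB HL (subring1 HL) LT).
Qed.

Lemma crossxx T x : cross T x x = x :> 'rV[K]_g.
Proof. by rewrite /cross -scalerDl addrC subrK scale1r. Qed.

Lemma crossK T x y : T != 0 -> cross T^-1 (cross T x y) y = x :> 'rV[K]_g.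
Proof.
move=> T0; rewrite /cross scalerDr !scalerA mulVf // scale1r -addrA -scalerDl.
by rewrite mulrBr mulr1 mulVf // addrA subrK subrr scale0r addr0.
Qed.

End CongCross.

Section ColoringTheory.
Variables (g : nat) (Rel : set 'rV[K]_g) (f : R -> 'rV[K]_g).
Hypotheses (HR : submodule is_laurent Rel) (Hf : coloring Rel f).

Lemma col_const a b : a <= b -> (forall w, a <= w < b -> ~~ under D w) ->
  cong Rel (f a) (f b).
Proof.
move=> ab nu; apply: (@real_induction _ (fun t => cong Rel (f a) (f t)) a b); rewrite ?ab ?lexx //.
- exact: cong_refl.
- move=> t tab at_; apply: (rightof_imp (col_right Hf (nu _ tab))) => s _ h.
  by apply: cong_trans at_ _ => //; apply: cong_sym.
- move=> t /andP[at_ tb] h.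
  have [s st [h1 h2]] := leftof_ex (leftof_and (leftof_gt at_) (col_left Hf t)
    (S := fun s => a < s /\ cong Rel (f s) (f t)) (fun s _ p q => conj p q)).
  by apply: cong_trans (h s _) h2 => //; rewrite st ltW.
Qed.

End ColoringTheory.

Lemma coloring_linear g g' (Rel : set 'rV[K]_g) (Rel' : set 'rV[K]_g') f (X : 'M[K]_(g, g')) :
  mx_in is_laurent X -> (forall v, Rel v -> Rel' (v *m X)) ->
  coloring Rel f -> coloring Rel' (fun t => f t *m X).
Proof.
move=> LX hX Hf; have hc x y : cong Rel x y -> cong Rel' (x *m X) (y *m X).
  by rewrite /cong -mulmxBl; exact: hX.
split.
- by move=> t; apply: (mx_in_mul HL) => //; apply: col_in Hf _.
- by move=> s t /(col_per Hf) /hc.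
- by move=> t; apply: leftof_imp (col_left Hf t) _ => s _ /hc.
- by move=> t u; apply: rightof_imp (col_right Hf u) _ => s _ /hc.
- move=> o t u; apply: rightof_imp (col_cross Hf u) _ => s _ /hc.
  by rewrite /cross mulmxDl -!scalemxAl.
Qed.

(** [f] is a universal coloring, and its values include the generators up to relations. The link
    with the minors is a separate field because the number of generators need not be the size of the
    Alexander matrix. *)
Record presentation g (Rel : set 'rV[K]_g) (f : R -> 'rV[K]_g) : Prop := Presentation {
  pres_sub : submodule is_laurent Rel;
  pres_col : coloring Rel f;
  pres_univ : forall g' (Rel' : set 'rV[K]_g') f', submodule is_laurent Rel' ->
    coloring Rel' f' -> exists Y : 'M[K]_(g, g'),
    [/\ mx_in is_laurent Y, forall v, Rel v -> Rel' (v *m Y) &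
        forall t, cong Rel' (f t *m Y) (f' t)];
  pres_gen : exists ts : 'I_g -> R, forall j, cong Rel (f (ts j)) (delta_mx 0 j);
  pres_min : minors is_laurent (alexander_matrix D) = fitting is_laurent Rel }.

Let n := num_crossings D.
Let A := alexander_matrix D.

Let lab t : 'rV[K]_n := \row_j (j == label D t :> nat)%:R.

Lemma lab_mul g (t : R) (Y : 'M[K]_(n, g)) : (0 < n)%N ->
  exists2 j : 'I_n, j = label D t :> nat & lab t *m Y = row j Y.
Proof.
move=> n0; exists (Ordinal (label_lt t n0)) => //; rewrite rowE; congr (_ *m _).
by apply/rowP => j; rewrite !mxE -val_eqE.
Qed.

Lemma alexander_row_mul g (Y : 'M[K]_(n, g)) (i j k : 'I_n) :
  j = (i.+1 %% n)%N :> nat -> k = label D (crossing D i).1 :> nat ->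
  row i A *m Y = cross (twist D (crossing D i)) (row i Y) (row k Y) - row j Y.
Proof.
move=> jE kE; have kE' : arc_index D (crossing D i).1 = k.
  rewrite kE /label frac_id //.
  by have /crossings_range /andP[] : crossing D i \in classical_crossings D by rewrite mem_nth.
have -> : row i A = twist D (crossing D i) *: delta_mx 0 i - delta_mx 0 j
    + (1 - twist D (crossing D i)) *: delta_mx 0 k.
  by apply/rowP => l; rewrite !mxE /= kE' !mulr_natr -jE -!val_eqE.
by rewrite mulmxDl mulmxBl -!scalemxAl -!rowE /cross addrAC.
Qed.

Lemma alexander_laurent : mx_in is_laurent A.
Proof.
move=> i j; rewrite mxE.
have hn c (b : bool) : is_laurent c -> is_laurent (c *+ b).
  by move=> hc; rewrite -mulr_natr; apply: (subringM HL) => //; exact: (subring_nat HL).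
apply: (subringD HL); last first.
  by apply/hn/(subringB HL); [exact: (subring1 HL) | exact: twist_laurent].
by apply: (subringB HL); apply: hn; [exact: twist_laurent | exact: (subring1 HL)].
Qed.

Lemma lab_coloring : (0 < n)%N -> coloring (row_span is_laurent A) lab.
Proof.
move=> n0; have HR := row_span_submodule HL A.
have hl s t : label D s = label D t -> cong (row_span is_laurent A) (lab s) (lab t).
  by move=> e; apply: cong_eq => //; apply/rowP => j; rewrite !mxE e.
split.
- by move=> t i j; rewrite mxE; exact: (subring_nat HL).
- by move=> s t /label_same /hl.
- by move=> t; apply: leftof_imp (label_leftof D t) _ => s _ /hl.
- by move=> t u; apply: rightof_imp (label_rightof u) _ => s _ /hl.
move=> o t ot; have [ln tc oc] := classical_crossing ot.
apply: rightof_imp (label_rightof_under (classical_under ot)) _ => s _ ls.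
pose i := Ordinal ln; pose j := Ordinal (label_lt s n0); pose k := Ordinal (label_lt o n0).
have e := @alexander_row_mul _ 1%:M i j k ls (label_same D oc).
have rE t' (l : 'I_n) : l = label D t' :> nat -> row l 1%:M = lab t'.
  by move=> le; apply/rowP => m; rewrite !mxE -le -val_eqE eq_sym.
rewrite mulmx1 !(rE t i, rE s j, rE o k) // in e.
apply: cong_sym => //; rewrite /cong (twist_same oc tc) -surjective_pairing -e.
exact: (row_in_span HL).
Qed.

Lemma present : exists g (Rel : set 'rV[K]_g) f, presentation Rel f.
Proof.
have [n0|n0] := posnP n.
  (* Without crossings the matrix is empty but the circle is still one arc, so the module is free on
     one generator. Both ideals are then the unit ideal. *)
  exists 1%N, [set 0 : 'rV[K]_1], (fun=> const_mx 1).
  have HR : submodule is_laurent [set 0 : 'rV[K]_1].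
    by split=> // [x y /= -> ->|c x _ /= ->]; rewrite ?addr0 ?scaler0.
  have nocr : classical_crossings D = [::] by apply: size0nil.
  have nu t : ~~ under D t by rewrite /under nocr.
  have e1 : delta_mx 0 0 = const_mx 1 :> 'rV[K]_1.
    by apply/rowP => j; rewrite !ord1 !mxE.
  split=> //.
  - split.
    + by move=> t i j; rewrite mxE; exact: (subring1 HL).
    + by move=> s t _; exact: cong_refl.
    + by move=> t; apply: leftof_true => s _; exact: cong_refl.
    + by move=> t _; apply: rightof_true => s _; exact: cong_refl.
    + by move=> o t; rewrite /classical nocr.
  - move=> g' Rel' f' HR' Hf'; exists (f' 0); split.
    + exact: (col_in Hf').
    + by move=> v ->; rewrite mul0mx; exact: submod0 HR'.
    + move=> t; rewrite -e1 -rowE; have -> : row 0 (f' 0) = f' 0.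
        by apply/rowP => j; rewrite mxE.
      have [t0|t0] := leP 0 t; first by apply: (col_const HR' Hf').
      by apply: cong_sym => //; apply: (col_const HR' Hf') => //; exact: ltW.
  - by exists (fun=> 0) => j; rewrite ord1 e1; exact: cong_refl.
  (* The size of the matrix is generalized so that 0 can be substituted for it in the type. *)
  have gen : forall k (B : 'M[K]_k), k = 0%N -> minors is_laurent B = fitting is_laurent [set 0 : 'rV[K]_1].
    move=> k B k0; subst k; apply/seteqP; split=> h.
      move=> [c hc ->] I hI hdet; apply: (ideal_sum _ hI) => a _; apply: (ideal_sum _ hI) => b _.
      apply: (idealM hI) => //; rewrite det_mx00 -(det1 K 1); apply: hdet; first exact: (mx_in1 HL).
      by exists 0%N => i; rewrite ord1.
    move/(_ (minors is_laurent B)); apply; first exact: (ideal_minors HL).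
    move=> M LM _; rewrite det_mx11 -[M 0 0]mulr1; apply: (idealM (ideal_minors HL B)) => //.
    have := @minors_mxsub _ _ HL 0 B [ffun i => i] [ffun i => i].
    by rewrite det_mx00.
  exact: gen.
exists n, (row_span is_laurent A), lab.
have HR := row_span_submodule HL A.
split=> //.
- exact: lab_coloring.
- move=> g' Rel' f' HR' Hf'.
  (* The arc x_i ends at undercrossing i, where a coloring takes the color of the incoming arc. *)
  pose Y := \matrix_(i < n, k < g') f' (crossing D i).2 0 k.
  have rowY i : row i Y = f' (crossing D i).2 by apply/rowP => k; rewrite !mxE.
  have hY t : cong Rel' (lab t *m Y) (f' t).
    have [j jE ->] := lab_mul t Y n0; rewrite rowY.
    apply: (@cong_trans _ _ HR' (f' (frac t))); last exact: (col_per Hf' (frac_same t)).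
    have xt := frac_itv t; have un := underE D.
    set us := [seq c.2 | c <- classical_crossings D] in un.
    have uE i : (i < n)%N -> (crossing D i).2 = nth 0 us i.
      by move=> iN; rewrite (nth_map (0, 0)).
    have cE i : (i < n)%N -> count (< (crossing D i).2) us = i.
      by move=> iN; rewrite uE // count_lt_nth ?size_map // crossings_sorted.
    have u01 i : (i < n)%N -> 0 <= (crossing D i).2 < 1.
      by move=> iN; apply: (us_itv (D := D)); rewrite uE // mem_nth // size_map.
    have mem i : (i < n)%N -> (crossing D i).2 \in us by move=> iN; rewrite uE // mem_nth // size_map.
    have := labelE D t; rewrite -/us -/n -jE.
    set x := frac t in xt *; set k := count (< x) us.
    (* If k < n, the arc through t ends at undercrossing k. Otherwise t comes after the last
       undercrossing, and its arc passes through the parameter 1 and ends at undercrossing 0, one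
       turn later. *)
    have [kn|] := ltnP k n.
      rewrite modn_small // => jk; apply: cong_sym => //; apply: (col_const HR' Hf').
        rewrite leNgt; apply/negP => lt; have := @cnt_ltn _ D (crossing D j).2 x _ (mem j (ltn_ord j)).
        by rewrite lexx lt cE // -/us -/k -jk ltnn => /(_ isT).
      move=> w /andP[xw wu]; apply/negP; rewrite un frac_id; last first.
        by have := u01 j (ltn_ord j); lra.
      move=> wus; have := @cnt_ltn _ D x (crossing D j).2 w wus; rewrite xw wu cE // -/us -/k jk ltnn => /(_ isT).
      by [].
    have kle : (k <= n)%N by rewrite -[n](size_us D) count_size.
    move=> nk; have {nk kle} kn : k = n by apply/eqP; rewrite eqn_leq kle.
    rewrite kn modnn => j0.
    have := col_per Hf' (s := (crossing D j).2 + 1) (t := (crossing D j).2).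
    rewrite -[1]/(1%:~R) same_paramDl same_param_refl => /(_ isT) h.
    apply: cong_trans (cong_sym HR' h) _ => //; apply: cong_sym => //; apply: (col_const HR' Hf').
      by have := u01 j (ltn_ord j); lra.
    move=> w /andP[xw wu]; apply/negP; rewrite un.
    have [w1|w1] := ltP w 1.
      rewrite frac_id; last lra.
      move=> wus; have := @cnt_ltn _ D x 1 w wus; rewrite xw w1 => /(_ isT).
      by rewrite cnt1 -/us -/k kn ltnn.
    have := u01 j (ltn_ord j) => uj.
    rewrite (@frac_eq _ w (w - 1)); last lra.
      move=> wus; have := @cnt_ltn _ D 0 (crossing D j).2 (w - 1) wus; rewrite cE // j0 ltn0.
      by move=> hF; suff : false by []; apply: hF; rewrite -j0; lra.
    by rewrite -[- 1]/((-1)%:~R) same_param_sym same_paramDl same_param_refl.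
  have LY : mx_in is_laurent Y by move=> i k; rewrite mxE; apply: (col_in Hf').
  exists Y; split=> // v [w Lw ->].
  rewrite -mulmxA mulmx_sum_row; apply: (big_ind Rel').
  + exact: submod0 HR'.
  + exact: submodD HR'.
  move=> i _; apply: (submodZ HR'); first exact: Lw.
  rewrite row_mul.
  have ou := crossing_classical (ltn_ord i).
  have [s us [ls fs]] := rightof_ex (rightof_and (label_rightof_under (classical_under ou))
    (col_cross Hf' ou) (S := fun s => label D s = (label D (crossing D i).2).+1 %% n /\ _)%N
    (fun s _ p q => conj p q)).
  rewrite label_crossing // in ls.
  have [j jE jY] := lab_mul s Y n0.
  have [k kE kY] := lab_mul (crossing D i).1 Y n0.
  rewrite (@alexander_row_mul _ Y i j k) ?jE ?ls // -jY -kY rowY.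
  rewrite -surjective_pairing in fs.
  apply: (@cong_trans _ _ HR' (f' s)); last by apply: cong_sym.
  apply: cong_sym => //; apply: cong_trans fs _ => //.
  apply: cong_cross => //; first exact: twist_laurent.
    exact: cong_refl.
  exact: cong_sym.
- exists (fun j => (crossing D j).2) => j; apply: cong_eq => //.
  by apply/rowP => k; rewrite !mxE label_crossing.
- by apply: (minors_fitting HL) => //; exact: alexander_laurent.
Qed.

End Coloring.

(** * Comparison of diagrams by transfer of colorings *)

Section Transfer.
Variable R : realType.

(** [W] parametrizes the part of the diagrams that a move leaves alone; [phi1] and [phi2] give its
    parameters in each of them. *)
Definition transfer (D1 D2 : diagram R) (W : set R) (phi1 phi2 : R -> R) :=
  forall g (Rel : set 'rV[K]_g) f, submodule is_laurent Rel -> coloring D1 Rel f ->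
  exists f', coloring D2 Rel f' /\ forall t, W t -> cong Rel (f' (phi2 t)) (f (phi1 t)).

Definition determined (D : diagram R) (W : set R) (phi : R -> R) :=
  forall g (Rel : set 'rV[K]_g) f f', submodule is_laurent Rel -> coloring D Rel f ->
  coloring D Rel f' -> (forall t, W t -> cong Rel (f (phi t)) (f' (phi t))) ->
  forall t, cong Rel (f t) (f' t).

(** Transfer and universality yield maps X and Y between the two modules. The coloring [f2] followed
    by Y X agrees with [f2] on [W], hence everywhere, so Y X is the identity modulo [Rel2], as
    [fitting_sub] requires. *)
Lemma transfer_minors D1 D2 W phi1 phi2 : transfer D1 D2 W phi1 phi2 ->
  transfer D2 D1 W phi2 phi1 -> determined D2 W phi2 ->
  minors_ideal D1 `<=` minors_ideal D2.
Proof.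
move=> T12 T21 U2; have [g1 [Rel1 [f1 P1]]] := present D1.
have [g2 [Rel2 [f2 P2]]] := present D2.
have H1 := pres_sub P1; have H2 := pres_sub P2.
have [f1' [c1 e1]] := T12 _ _ _ H1 (pres_col P1).
have [f2' [c2 e2]] := T21 _ _ _ H2 (pres_col P2).
have [X [LX RX hX]] := pres_univ P1 H2 c2.
have [Y [LY RY hY]] := pres_univ P2 H1 c1.
have -> : minors_ideal D1 = minors is_laurent (alexander_matrix D1) by [].
have -> : minors_ideal D2 = minors is_laurent (alexander_matrix D2) by [].
rewrite (pres_min P1) (pres_min P2); apply: (fitting_sub HL LX LY RX) => j.
have RYX v : Rel2 v -> Rel2 (v *m Y *m X) by move=> /RY /RX.
have hX' x y : cong Rel1 x y -> cong Rel2 (x *m X) (y *m X).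
  by rewrite /cong -mulmxBl; exact: RX.
have key t : cong Rel2 (f2 t) (f2 t *m (Y *m X)).
  apply: (U2 _ _ _ (fun t => f2 t *m (Y *m X)) H2 (pres_col P2) _ _ t).
    apply: coloring_linear (pres_col P2); first exact: (mx_in_mul HL).
    by move=> v /RYX; rewrite mulmxA.
  move=> t' Wt; apply: cong_sym => //; rewrite mulmxA.
  apply: cong_trans (hX' _ _ (hY _)) _ => //.
  apply: cong_trans (hX' _ _ (e1 _ Wt)) _ => //.
  by apply: cong_trans (hX _) (e2 _ Wt).
have [ts hts] := pres_gen P2.
have -> : row j (1%:M - Y *m X) = delta_mx 0 j - delta_mx 0 j *m (Y *m X).
  by rewrite linearB /= row1 -rowE.
apply: (cong_trans H2 (cong_sym H2 (hts j))); apply: cong_trans (key _) _ => //.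
by rewrite /cong -mulmxBl mulmxA; apply: RYX; exact: hts.
Qed.

End Transfer.

(** * Derivatives, reparametrizations and planar isotopies *)

Section RealFunctions.
Variable R : realType.
Implicit Types (h dh : R -> R) (a b t : R).

Lemma is_derive_continuous h t d : is_derive t 1 h d -> {for t, continuous h}.
Proof. by move=> hd; apply/differentiable_continuous/derivable1_diffP/ex_derive. Qed.

Lemma IVT0 h a b : continuous h -> a <= b -> (h a <= 0 <= h b) || (h b <= 0 <= h a) ->
  exists2 c, a <= c <= b & h c = 0.
Proof.
move=> ch ab h0; have [|c] := @IVT R h a b 0 ab (continuous_subspaceT ch).
  by rewrite ge_min le_max; case/orP: h0 => /andP[-> ->]; rewrite ?orbT.
by rewrite in_itv => cab hc; exists c.
Qed.

Lemma derive_MVT h dh a b : (forall t, is_derive t 1 h (dh t)) -> a < b ->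
  exists2 c, a < c < b & h b - h a = dh c * (b - a).
Proof.
move=> hd ab; have [|c] := @MVT R h dh a b ab (fun t _ => hd t).
  by apply: continuous_subspaceT => t; exact: is_derive_continuous (hd t).
by rewrite in_itv => cab hc; exists c.
Qed.

Lemma derive_gt0_leftof h t d : is_derive t 1 h d -> 0 < d -> leftof t (fun s => h s < h t).
Proof.
move=> [hd <-] d0.
have hn : \forall k \near (0 : R)^', 0 < k^-1 *: (h (k *: (1 : R) + t) - h t).
  by apply: (cvgr_gt _ hd).
rewrite nearE /= /dnbhs /within /= in hn; have [e /= e0 he] := iffLR (nbhs_ballP _ _) hn.
exists e => // s /andP[s1 s2].
have := he (s - t); rewrite /ball /= sub0r normrN.
rewrite ltr0_norm; last lra.
have -> : (s - t) *: (1 : R) + t = s by rewrite /GRing.scale /= mulr1 subrK.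
move=> hh; have : 0 < (s - t)^-1 *: (h s - h t) by apply: hh; [lra | rewrite subr_eq0; lra].
by rewrite nmulr_rgt0 ?invr_lt0; lra.
Qed.

End RealFunctions.

Lemma continuous_pairl (T U : topologicalType) (s : T) (z : U) :
  {for s, continuous (fun s' : T => (s', z))}.
Proof.
move=> A hA.
apply: (@cvg_pair T T U (nbhs s) (nbhs s) (nbhs z) _ _ _ (fun x => x) (fun=> z) _ _ A hA).
  exact: cvg_id.
exact: cvg_cst.
Qed.

Lemma det2_continuous (R : realType) (u v : R -> R * R) (s : R) :
  {for s, continuous u} -> {for s, continuous v} ->
  {for s, continuous (fun x => det2 (u x) (v x))}.
Proof.
move=> cu cv.
have u1 : (fun x => (u x).1) @ s --> (u s).1 by apply: (cvg_comp _ _ cu); exact: cvg_fst.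
have u2 : (fun x => (u x).2) @ s --> (u s).2 by apply: (cvg_comp _ _ cu); exact: cvg_snd.
have v1 : (fun x => (v x).1) @ s --> (v s).1 by apply: (cvg_comp _ _ cv); exact: cvg_fst.
have v2 : (fun x => (v x).2) @ s --> (v s).2 by apply: (cvg_comp _ _ cv); exact: cvg_snd.
apply: (@cvgB _ _ _ _ _ (fun x => (u x).1 * (v x).2) (fun x => (u x).2 * (v x).1)).
  exact: (cvgM u1 v2).
exact: (cvgM u2 v1).
Qed.

Section Coordinates.
Variables (R : realType).

Lemma is_derive_fst (c : R -> R * R) t : derivable c t 1 ->
  is_derive t 1 (fun s => (c s).1) (derive1 c t).1.
Proof.
rewrite derive1E => hc.
have h : (fun k : R => k^-1 *: ((c (k *: 1 + t)).1 - (c t).1)) @ 0^' --> ('D_1 c t).1.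
  exact: (cvg_comp _ _ hc (cvg_fst (F := nbhs _) (G := nbhs _))).
by apply: DeriveDef; [apply/cvg_ex; exists ('D_1 c t).1 | exact: cvg_lim h].
Qed.

Lemma is_derive_snd (c : R -> R * R) t : derivable c t 1 ->
  is_derive t 1 (fun s => (c s).2) (derive1 c t).2.
Proof.
rewrite derive1E => hc.
have h : (fun k : R => k^-1 *: ((c (k *: 1 + t)).2 - (c t).2)) @ 0^' --> ('D_1 c t).2.
  exact: (cvg_comp _ _ hc (cvg_snd (F := nbhs _) (G := nbhs _))).
by apply: DeriveDef; [apply/cvg_ex; exists ('D_1 c t).2 | exact: cvg_lim h].
Qed.

Lemma derive1_pair (c : R -> R * R) t d : derivable c t 1 ->
  is_derive t 1 (fun s => (c s).1) d.1 -> is_derive t 1 (fun s => (c s).2) d.2 ->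
  derive1 c t = d.
Proof.
move=> hc [_ h1] [_ h2]; have [_ k1] := is_derive_fst hc; have [_ k2] := is_derive_snd hc.
by apply/eqP; rewrite -pair_eqE /pair_eq /= -h1 -h2 k1 k2 !eqxx.
Qed.

End Coordinates.

Section Reparametrization.
Variables (R : realType) (phi : R -> R).
Hypothesis Hphi : reparametrization phi.

Let phi_derive (t : R) : is_derive t 1 phi (derive1 phi t).
Proof. by case: Hphi => _ h _ _; rewrite derive1E; apply: DeriveDef => //. Qed.

Lemma reparam_lt s t : s < t -> phi s < phi t.
Proof.
move=> st; have [c _ e] := derive_MVT phi_derive st.
case: Hphi => _ _ _ h; rewrite -subr_gt0 e mulr_gt0 ?h ?subr_gt0 //.
Qed.

Lemma reparam_int t (k : int) : phi (t + k%:~R) = phi t + k%:~R.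
Proof.
have cn x (n : nat) : phi (x + n%:R) = phi x + n%:R.
  elim: n => [|n IH]; rewrite ?addr0 // -natr1 !addrA.
  by case: Hphi => h _ _ _; rewrite h IH.
case: k => [k|k]; first exact: cn.
by rewrite NegzE intrN -[in LHS](addrK k.+1%:R (phi _)) -cn addrNK.
Qed.

Lemma reparam_inv : exists psi, [/\ cancel phi psi, cancel psi phi &
  forall s t, s < t -> psi s < psi t].
Proof.
have sur y : exists x, phi x = y.
  have ch : continuous (fun x => phi x - y).
    by move=> x; apply: cvgB; [exact: is_derive_continuous | exact: cvg_cst].
  (* Since phi k = phi 0 + k for every integer k, this choice places y between phi k and phi (k +
     1). *)
  have := floor_itv (y - phi 0); set k := Num.floor _ => /andP[h1 h2].
  have [||c _ /eqP] := IVT0 ch (a := k%:~R) (b := (k + 1)%:~R).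
  - by rewrite ler_int; lia.
  - have := reparam_int 0 k; have := reparam_int 0 (k + 1); rewrite !add0r => -> ->.
    by apply/orP; left; lra.
  by rewrite subr_eq0 => /eqP; exists c.
have [psi hpsi] := boolp.choice sur.
have inj s t : phi s = phi t -> s = t.
  by case: (ltgtP s t) => // /reparam_lt; lra.
exists psi; split=> //; first by move=> x; apply: inj; rewrite hpsi.
move=> s t st; rewrite ltNge; apply/negP; rewrite le_eqVlt => /orP[/eqP e|/reparam_lt].
  by move: st; rewrite -(hpsi s) -(hpsi t) e ltxx.
by rewrite !hpsi; lra.
Qed.

Lemma reparam_same s t : same_param (phi s) (phi t) = same_param s t.
Proof.
apply/idP/idP => /same_paramP [k e]; apply/same_paramP; exists k; last by rewrite e reparam_int.
have [psi [can _ _]] := reparam_inv.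
by apply: (can_inj can); rewrite e reparam_int.
Qed.

End Reparametrization.

Section Recolor.
Variables (R : realType) (D1 D2 : diagram R) (phi psi : R -> R).
Hypotheses (phiK : cancel phi psi) (psiK : cancel psi phi).
Hypotheses (phi_lt : forall s t, s < t -> phi s < phi t)
  (psi_lt : forall s t, s < t -> psi s < psi t).

Lemma leftof_comp t P : leftof (phi t) P -> leftof t (P \o phi).
Proof.
case=> e e0 h; have lt : psi (phi t - e) < t by rewrite -[X in _ < X]phiK; apply: psi_lt; lra.
exists (t - psi (phi t - e)); first by rewrite subr_gt0.
move=> s /andP[s1 s2]; apply: h; rewrite phi_lt // andbT -[X in X < _]psiK.
by apply: phi_lt; lra.
Qed.

Lemma rightof_comp t P : rightof (phi t) P -> rightof t (P \o phi).
Proof.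
case=> e e0 h; have lt : t < psi (phi t + e) by rewrite -[X in X < _]phiK; apply: psi_lt; lra.
exists (psi (phi t + e) - t); first by rewrite subr_gt0.
move=> s /andP[s1 s2]; apply: h; rewrite phi_lt //= -[X in _ < X]psiK.
by apply: phi_lt; lra.
Qed.

Hypothesis phi_same : forall s t, same_param s t -> same_param (phi s) (phi t).
Hypothesis phi_classical : forall s t, classical D2 (phi s) (phi t) = classical D1 s t.
Hypothesis phi_positive : forall o u, classical D1 o u ->
  positive D2 (phi o, phi u) = positive D1 (o, u).

Lemma coloring_comp g (Rel : set 'rV[K]_g) f : coloring D2 Rel f -> coloring D1 Rel (f \o phi).
Proof.
move=> Hf; split.
- by move=> t; exact: (col_in Hf).
- by move=> s t st; apply/(col_per Hf)/phi_same.
- by move=> t; have := leftof_comp (col_left Hf (phi t)).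
- move=> t nu; have nu2 : ~~ under D2 (phi t).
    apply: contra nu => /under_classical [v]; rewrite -(psiK v) phi_classical.
    exact: classical_under.
  by have := rightof_comp (col_right Hf nu2).
- move=> o t ot; have ot2 : classical D2 (phi o) (phi t) by rewrite phi_classical.
  have := rightof_comp (col_cross Hf ot2).
  by rewrite /twist phi_positive.
Qed.

End Recolor.

Section Carries.
Variables (R : realType) (f : R * R -> R * R) (phi : R -> R) (D1 D2 : diagram R).
Hypothesis Hc : carries f phi D1 D2.

Lemma carries_minors : (forall o u, classical D1 o u ->
    positive D2 (phi o, phi u) = positive D1 (o, u)) ->
  minors_ideal D1 = minors_ideal D2.
Proof.
case: Hc => Hphi _ cl pos; have [psi [K1 K2 lt]] := reparam_inv Hphi.
have same2 s t : same_param s t -> same_param (psi s) (psi t).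
  by move=> st; rewrite -(reparam_same Hphi (psi s)) !K2.
have lt' : forall s t, s < t -> phi s < phi t by exact: reparam_lt.
have same1 s t : same_param s t -> same_param (phi s) (phi t).
  by rewrite (reparam_same Hphi).
have cl2 s t : classical D1 (psi s) (psi t) = classical D2 s t by rewrite -cl !K2.
have pos2 o u : classical D2 o u -> positive D1 (psi o, psi u) = positive D2 (o, u).
  by move=> ou; have := pos (psi o) (psi u); rewrite cl2 !K2 => ->.
have T12 : transfer D1 D2 setT id phi.
  move=> g Rel h HR Hh; exists (h \o psi); split.
    exact: (coloring_comp K2 K1 lt lt' same2 cl2 pos2 Hh).
  by move=> t _ /=; rewrite K1; exact: cong_refl.
have T21 : transfer D2 D1 setT phi id.
  move=> g Rel h HR Hh; exists (h \o phi); split; last by move=> t _; exact: cong_refl.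
  exact: (coloring_comp K1 K2 lt' lt same1 cl pos Hh).
apply/seteqP; split; [apply: transfer_minors T12 T21 _|apply: transfer_minors T21 T12 _].
  by move=> g Rel h h' HR _ _ e t; have := e (psi t) I; rewrite K2.
by move=> g Rel h h' HR _ _ e t; exact: e.
Qed.

Variables (J : R * R -> R * R -> R * R).
Hypothesis J_det : forall z v w, exists2 d, 0 < d & det2 (J z v) (J z w) = d * det2 v w.
Hypothesis J_derive : forall t, derive1 (f \o curve D1) t = J (curve D1 t) (derive1 (curve D1) t).

(** Differentiating [curve D2 (phi t) = f (curve D1 t)] shows that [det2] of the two tangent vectors
    changes only by positive factors: the two derivatives of [phi] and the determinant of [J] at the
    crossing point. *)
Lemma carries_positive o u : classical D1 o u ->
  positive D2 (phi o, phi u) = positive D1 (o, u).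
Proof.
case: Hc => Hphi e cl ou.
have d2 t : derive1 (f \o curve D1) t = derive1 phi t *: derive1 (curve D2) (phi t).
  have -> : f \o curve D1 = curve D2 \o phi by apply/funext => s /=; rewrite e.
  have dphi : differentiable phi t by apply/derivable1_diffP; case: Hphi.
  have dc : differentiable (curve D2) (phi t) by apply/derivable1_diffP/curve_derivable.
  have dcp := differentiable_comp dphi dc.
  rewrite (derive1E' dcp) (diff_comp dphi dc) (derive1E' dphi) (derive1E' dc).
  transitivity ('d (curve D2) (phi t) ('d phi t 1 *: (1 : R))); last exact: linearZ.
  by rewrite [_ *: 1]mulr1.
have [c cu] : exists z, curve D1 o = z /\ curve D1 u = z.
  exists (curve D1 u); split=> //; case/hasP: ou => c cD /andP[/curve_same -> /curve_same ->].
  by have [] := crossings_double cD.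
have [d d0 dE] := J_det c (derive1 (curve D1) o) (derive1 (curve D1) u).
have po : 0 < derive1 phi o by case: Hphi.
have pu : 0 < derive1 phi u by case: Hphi.
have pE D a b : positive D (a, b) = (0 < det2 (derive1 (curve D) a) (derive1 (curve D) b)) by [].
rewrite !pE; set X := det2 (derive1 (curve D2) (phi o)) _; set Y := det2 (derive1 (curve D1) o) (derive1 (curve D1) u).
have det2Z (x y : R) v w : det2 (x *: v) (y *: w) = x * y * det2 v w.
  by rewrite /det2 /=; rewrite /GRing.scale /=; ring.
have XY : d * Y = derive1 phi o * derive1 phi u * X.
  rewrite -det2Z -!d2 !J_derive; have [-> ->] := cu.
  by rewrite dE.
clearbody X Y; have pp : 0 < derive1 phi o * derive1 phi u by rewrite mulr_gt0.
by rewrite -(pmulr_rgt0 Y d0) XY (pmulr_rgt0 X pp).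
Qed.

End Carries.

Section Isotopy.
Variable R : realType.

(** The Jacobian determinant at a fixed point is continuous along the isotopy, never 0, and equal to
    1 at the start. It is thus positive at the end, and the signs of the crossings are preserved. *)
Lemma isotopy_minors (D1 D2 : diagram R) : planar_isotopic D1 D2 ->
  minors_ideal D1 = minors_ideal D2.
Proof.
case=> H [phi [[H0 Hs _ [Hd1 Hd2] Hdet] Hc]].
apply: (carries_minors Hc) => o u ou.
have dH s z : differentiable (H s) z by have [_] := Hs s.
apply: (carries_positive Hc (J := fun z => 'd (H 1) z)) ou.
  move=> z v w; exists (det2 ('d (H 1) z (1, 0)) ('d (H 1) z (0, 1))); last first.
    have dE v' : 'd (H 1) z v' = v'.1 *: 'd (H 1) z (1, 0) + v'.2 *: 'd (H 1) z (0, 1).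
      rewrite -!linearZ -linearD; congr ('d (H 1) z _).
      case: v' => x y; transitivity (x * 1 + y * 0, x * 0 + y * 1); last by [].
      by rewrite !mulr1 !mulr0 addr0 add0r.
    rewrite (dE v) (dE w) /det2 /= /GRing.scale /=; lra.
  pose h s := det2 ('D_((1, 0) : R * R) (H s) z) ('D_((0, 1) : R * R) (H s) z).
  have ch : continuous h.
    move=> s.
    have c1 : {for s, continuous (fun s' => 'D_((1, 0) : R * R) (H s') z)}.
      have := @continuous_comp _ _ _ (fun s' : R => (s', z)) _ s _ (Hd1 (s, z)).
      by apply; exact: continuous_pairl.
    have c2 : {for s, continuous (fun s' => 'D_((0, 1) : R * R) (H s') z)}.
      have := @continuous_comp _ _ _ (fun s' : R => (s', z)) _ s _ (Hd2 (s, z)).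
      by apply; exact: continuous_pairl.
    exact: det2_continuous c1 c2.
  have h0 : h 0 = 1.
    have Hid : H 0 = id by apply/funext => z'; exact: H0.
    by rewrite /h Hid !derive_id /det2 /= mulr1 mulr0 subr0.
  rewrite -!deriveE //.
  have [//|h1] := ltP 0 (h 1).
  have [|c _ hc] := IVT0 (a := 0) (b := 1) ch ler01; first by rewrite h0 h1 ler01 orbT.
  by have := Hdet (c, z); rewrite /= -/(h c) hc eqxx.
move=> t.
have dc : differentiable (curve D1) t by apply/derivable1_diffP/curve_derivable.
have dcp := differentiable_comp dc (dH 1 (curve D1 t)).
by rewrite (derive1E' dcp) (diff_comp dc (dH 1 _)) (derive1E' dc).
Qed.

End Isotopy.

(** * Changes of a diagram along arcs *)

Section Arcs.
Variable R : realType.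
Implicit Types (a b t x y : R).

(** The representative of t modulo 1 in [a, a + 1), where membership in the arc from a to b becomes
    the single inequality of [arcP]. *)
Definition rep a t := a + frac (t - a).

Lemma rep_itv a t : a <= rep a t < a + 1.
Proof. by have := frac_itv (t - a); rewrite /rep; lra. Qed.

Lemma rep_same a t : same_param (rep a t) t.
Proof. have := frac_same (t - a); rewrite /same_param /rep.
by congr (_ \is a _); lra. Qed.

Lemma rep_eq a t x : same_param t x -> a <= x < a + 1 -> rep a t = x.
Proof.
move=> tx ax; have := rep_itv a t => ar; apply: same_param_eq.
  exact: same_param_trans (rep_same _ _) tx.
by rewrite ltr_norml; lra.
Qed.

Lemma arcP a b t : b < a + 1 -> arc a b t <-> rep a t <= b.
Proof.
move=> ba; split=> [[k kab]|rb].
  by rewrite (@rep_eq a t (t + k%:~R)) ?same_paramDr ?same_param_refl //; lra.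
have /same_paramP[k e] := rep_same a t.
by exists k; rewrite -e rb andbT; case/andP: (rep_itv a t).
Qed.

Lemma arc_same a b s t : same_param s t -> arc a b s -> arc a b t.
Proof.
move=> /same_paramP[k ->] [l h]; exists (k + l).
by rewrite intrD addrA.
Qed.

Lemma arc_mem a b x : a <= x <= b -> arc a b x.
Proof. by exists 0; rewrite addr0. Qed.

Lemma arc_ex a b t : arc a b t -> exists2 x, a <= x <= b & same_param t x.
Proof. by case=> k h; exists (t + k%:~R); rewrite // same_paramDr same_param_refl. Qed.

Lemma not_arc_germs a b t : a < b < a + 1 -> ~ arc a b t ->
  leftof t (fun s => ~ arc a b s) /\ rightof t (fun s => ~ arc a b s).
Proof.
move=> ab nt; have ba : b < a + 1 by lra.
have /andP[r1 r2] := rep_itv a t.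
have rb : b < rep a t by rewrite ltNge; apply/negP => /(arcP _ ba).
have key s : b - rep a t < s - t < a + 1 - rep a t -> ~ arc a b s.
  move=> h /(arcP _ ba).
  rewrite (@rep_eq a s (rep a t + (s - t))); [lra | | lra].
  have := rep_same a t; rewrite /same_param => h'.
  have -> : s - (rep a t + (s - t)) = - (rep a t - t) by lra.
  by rewrite rpredN.
split; first by exists (rep a t - b); [lra | move=> s h; apply: key; lra].
by exists (a + 1 - rep a t); [lra | move=> s h; apply: key; lra].
Qed.

Lemma arc_end_germs a b : a < b < a + 1 ->
  leftof a (fun s => ~ arc a b s) /\ rightof b (fun s => ~ arc a b s).
Proof.
move=> ab; have ba : b < a + 1 by lra.
have key s x : same_param s x -> b < x < a + 1 -> ~ arc a b s.
  by move=> sx h /(arcP _ ba); rewrite (@rep_eq a s x) //; lra.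
split.
  exists (a + 1 - b); first lra.
  move=> s h; apply: (key s (s + 1)); last lra.
  by rewrite -[1]/(1%:~R) same_paramDr same_param_refl.
by exists (a + 1 - b); [lra | move=> s h; apply: (key s s); rewrite ?same_param_refl //; lra].
Qed.

End Arcs.

Section LocalDerivative.
Variable R : realType.

Lemma derive1_germ (c1 c2 : R -> R * R) t : c1 t = c2 t ->
  leftof t (fun s => c1 s = c2 s) -> rightof t (fun s => c1 s = c2 s) ->
  derive1 c1 t = derive1 c2 t.
Proof.
move=> e0 [e1 p1 h1] [e2 p2 h2]; rewrite !derive1E; apply: near_eq_derive.
apply/nbhs_ballP; exists (Num.min e1 e2); first by rewrite /= lt_min p1.
move=> s; rewrite /ball /= lt_min => /andP[]; rewrite !ltr_norml => /andP[a1 a2] /andP[b1 b2].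
have [st|ts|->//] := ltgtP s t; first by apply: h1; lra.
by apply: h2; lra.
Qed.

End LocalDerivative.

Section SameData.
Variables (R : realType) (D1 D2 : diagram R).

(** Colorings see a diagram only through its over-under pairs and their signs, so the identity on
    parameters transfers them. *)
Lemma same_crossings_minors : (forall s t, classical D1 s t = classical D2 s t) ->
  (forall o u, classical D1 o u -> positive D1 (o, u) = positive D2 (o, u)) ->
  minors_ideal D1 = minors_ideal D2.
Proof.
move=> cl pos.
have cl' s t : classical D2 s t = classical D1 s t by rewrite cl.
have pos1 o u : classical D2 o u -> positive D1 (o, u) = positive D2 (o, u).
  by rewrite cl' => /pos.
have pos2 o u : classical D1 o u -> positive D2 (o, u) = positive D1 (o, u).
  by move=> /pos /esym.
have idK : cancel (@id R) id by [].
have lt (s t : R) : s < t -> id s < id t by [].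
have sm (s t : R) : same_param s t -> same_param (id s) (id t) by [].
have T12 : transfer D1 D2 setT id id.
  move=> g Rel f HR Hf; exists f; split; last by move=> t _; exact: cong_refl.
  exact: (coloring_comp idK idK lt lt sm cl pos1 Hf).
have T21 : transfer D2 D1 setT id id.
  move=> g Rel f HR Hf; exists f; split; last by move=> t _; exact: cong_refl.
  exact: (coloring_comp idK idK lt lt sm cl' pos2 Hf).
have U (D : diagram R) : determined D setT id by move=> g Rel f f' _ _ _ e t; exact: e.
by apply/seteqP; split; [exact: (transfer_minors T12 T21 (U D2)) | exact: (transfer_minors T21 T12 (U D1))].
Qed.

End SameData.

Section Detour.
Variables (R : realType) (D1 D2 : diagram R).

(** All classical crossings lie off the arc, and so do neighbourhoods of their parameters; their
    tangent vectors are therefore unchanged. *)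
Lemma detour_minors : detour_move D1 D2 -> minors_ideal D1 = minors_ideal D2.
Proof.
case=> a [b [ab out cl inarc]].
have der t : ~ arc a b t -> derive1 (curve D1) t = derive1 (curve D2) t.
  move=> nt; have [l r] := not_arc_germs ab nt.
  apply: derive1_germ; first exact: out.
    by apply: leftof_imp l _ => s _; exact: out.
  by apply: rightof_imp r _ => s _; exact: out.
apply: (same_crossings_minors cl) => o u ou.
have no : ~ arc a b o by move=> h; have [/negP] := inarc o u h.
have nu : ~ arc a b u by move=> h; have [_ /negP] := inarc u o h.
have pE D : positive D (o, u) = (0 < det2 (derive1 (curve D) o) (derive1 (curve D) u)) by [].
by rewrite (pE D1) (pE D2) (der _ no) (der _ nu).
Qed.

End Detour.

Section CrossingFacts.
Variables (R : realType) (D : diagram R).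

Lemma classical_curve o u : classical D o u -> curve D o = curve D u.
Proof.
case/hasP => c cD /andP[/(curve_same D) -> /(curve_same D) ->].
by have [] := crossings_double cD.
Qed.

Lemma classical_neq o u : classical D o u -> ~~ same_param o u.
Proof.
case/hasP => c cD /andP[oc uc]; rewrite (same_param_l oc) (same_param_r _ uc).
have [ne _] := crossings_double cD; have /andP[r1 r2] := crossings_range cD.
apply: contra ne => /same_param_eq -> //.
by rewrite ltr_norml; lra.
Qed.

Lemma classical_asym o u : classical D o u -> ~~ classical D u o.
Proof.
case/hasP => c cD /andP[oc uc]; apply/negP => /hasP[c' cD' /andP[uc' oc']].
have /andP[r1 r2] := crossings_range cD; have /andP[r1' r2'] := crossings_range cD'.
have e1 : c.1 = c'.2.
  apply: same_param_eq; last by rewrite ltr_norml; lra.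
  by rewrite -(same_param_l oc).
have e2 : c.2 = c'.1.
  apply: same_param_eq; last by rewrite ltr_norml; lra.
  by rewrite -(same_param_l uc).
have cD1 : (c.1, c.2) \in classical_crossings D by rewrite -surjective_pairing.
have cD2 : (c.2, c.1) \in classical_crossings D by rewrite e2 e1 -surjective_pairing.
by have := crossings_asym cD1; rewrite cD2.
Qed.

Lemma classical_unique o o' u : classical D o u -> classical D o' u -> same_param o o'.
Proof.
move=> /classical_crossing [_ _ h] /classical_crossing [_ _ h'].
by rewrite (same_param_l h) same_param_sym.
Qed.

Variables (S : set R) (l : seq (R * R)).
Hypothesis Hl : crossings_on D S l.

Lemma crossings_on_classical c : c \in l -> classical D c.1 c.2.
Proof. by case: Hl => h _ /h []. Qed.

Lemma crossings_on_under x : S x -> under D x -> exists2 c, c \in l & same_param x c.2.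
Proof.
move=> Sx /under_classical [v vx]; have cl := classical_curve vx.
case: Hl => h1 /(_ x v Sx (esym cl)) [xv|[c cl' /orP[/andP[xc vc]|/andP[xc vc]]]].
- by have := classical_neq vx; rewrite same_param_sym xv.
- have [_] := h1 c cl'; rewrite -(classical_same D xc vc) => /classical_asym.
  by rewrite vx.
- by exists c.
Qed.

End CrossingFacts.

(** * Colorings along strands with prescribed undercrossings *)

Section Strands.
Variables (R : realType) (g : nat).
Local Notation V := 'rV[K]_g.

(* The colors along a strand with undercrossings at w1 < w2; those beyond the
   end of the strand are dummies. *)
Record strand := Strand {
  s_in : V; s_w1 : R; s_T1 : K; s_y1 : V; s_w2 : R; s_T2 : K; s_y2 : V }.

Definition strand_val s t : V :=
  if t <= s_w1 s then s_in s
  else if t <= s_w2 s then cross (s_T1 s) (s_in s) (s_y1 s)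
  else cross (s_T2 s) (cross (s_T1 s) (s_in s) (s_y1 s)) (s_y2 s).

(** The color just after t. It can differ from [strand_val] only at the two undercrossings. *)
Definition strand_out s t : V :=
  if t < s_w1 s then s_in s
  else if t < s_w2 s then cross (s_T1 s) (s_in s) (s_y1 s)
  else cross (s_T2 s) (cross (s_T1 s) (s_in s) (s_y1 s)) (s_y2 s).

Lemma strand_val_left s t : s_w1 s < s_w2 s -> leftof t (fun x => strand_val s x = strand_val s t).
Proof.
move=> w12; rewrite /strand_val; have [t1|t1] := leP t (s_w1 s).
  by apply: leftof_true => x xt; rewrite ifT //; lra.
have [t2|t2] := leP t (s_w2 s).
  apply: leftof_imp (leftof_gt t1) _ => x xt x1.
  by rewrite ifF ?ifT //; [lra | apply/negbTE; rewrite -ltNge].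
apply: leftof_imp (leftof_gt t2) _ => x xt x1.
by rewrite !ifF //; apply/negbTE; rewrite -ltNge; lra.
Qed.

Lemma strand_val_right s t : s_w1 s < s_w2 s -> rightof t (fun x => strand_val s x = strand_out s t).
Proof.
move=> w12; rewrite /strand_val /strand_out; have [t1|t1] := ltP t (s_w1 s).
  by apply: rightof_imp (rightof_lt t1) _ => x xt x1; rewrite ifT //; lra.
have [t2|t2] := ltP t (s_w2 s).
  apply: rightof_imp (rightof_lt t2) _ => x xt x1.
  by rewrite ifF ?ifT //; [lra | apply/negbTE; rewrite -ltNge; lra].
by apply: rightof_true => x xt; rewrite !ifF //; apply/negbTE; rewrite -ltNge; lra.
Qed.

Lemma strand_out_val s t : t != s_w1 s -> t != s_w2 s -> strand_out s t = strand_val s t.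
Proof. by move=> h1 h2; rewrite /strand_val !le_eqVlt (negPf h1) (negPf h2). Qed.

Lemma strand_out_w1 s : s_w1 s < s_w2 s -> strand_out s (s_w1 s) = cross (s_T1 s) (strand_val s (s_w1 s)) (s_y1 s).
Proof. by move=> h; rewrite /strand_out /strand_val lexx ltxx h. Qed.

Lemma strand_out_w2 s : s_w1 s < s_w2 s -> strand_out s (s_w2 s) = cross (s_T2 s) (strand_val s (s_w2 s)) (s_y2 s).
Proof. by move=> h; rewrite /strand_out /strand_val lexx ltxx (lt_gtF h) leNgt h. Qed.

Variable Rel : set V.
Hypothesis HR : submodule is_laurent Rel.

Definition crossed D (f : R -> V) w T y := exists o,
  [/\ classical D o w, twist D (o, w) = T & cong Rel (f o) y].

(** The crossing conditions are guarded by [<= b], so that the dummy undercrossings of a strand need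
    not be crossings of the diagram. *)
Definition follows D f a b s :=
  [/\ a <= s_w1 s < s_w2 s,
      forall x, a <= x <= b -> under D x -> x = s_w1 s \/ x = s_w2 s,
      s_w1 s <= b -> crossed D f (s_w1 s) (s_T1 s) (s_y1 s) &
      s_w2 s <= b -> crossed D f (s_w2 s) (s_T2 s) (s_y2 s)].

Lemma crossed_under D f w T y : crossed D f w T y -> under D w.
Proof. by case=> v [/classical_under]. Qed.

Lemma strand_out_rule D f a b s x : follows D f a b s -> a <= x <= b ->
  (~~ under D x -> strand_out s x = strand_val s x) /\
  (forall o, classical D o x -> (forall o', same_param o o' -> cong Rel (f o) (f o')) ->
    cong Rel (strand_out s x) (cross (twist D (o, x)) (strand_val s x) (f o))).
Proof.
case=> /andP[aw w12] un c1 c2 /andP[ax xb]; split.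
  move=> nu; apply: strand_out_val; apply: contra nu => /eqP e; rewrite e.
    by apply: crossed_under (c1 _); rewrite -e.
  by apply: crossed_under (c2 _); rewrite -e.
move=> o ox per; have xab : a <= x <= b by rewrite ax.
have key w T y : x = w -> crossed D f w T y ->
    cong Rel (cross T (strand_val s x) y) (cross (twist D (o, x)) (strand_val s x) (f o)).
  move=> xw [v' [vw <- fy]]; rewrite -xw in vw *.
  have oo' := classical_unique ox vw.
  rewrite -(twist_same D oo' (same_param_refl x)).
  apply: cong_cross => //; [exact: twist_laurent | exact: cong_refl |].
  by apply: cong_sym => //; apply: cong_trans (per _ oo') fy.
have [e|e] := un x xab (classical_under ox).
  by have := key _ _ _ e (c1 _); rewrite {1}e -strand_out_w1 // -e; apply.
by have := key _ _ _ e (c2 _); rewrite {1}e -strand_out_w2 // -e; apply.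
Qed.

(** Real induction along the strand: at each point the rule for colorings is the one that defines
    [strand_out], so the color at [a] determines all the others. *)
Lemma follows_coloring D f a b s : coloring D Rel f -> follows D f a b s ->
  a <= b -> cong Rel (f a) (s_in s) ->
  (forall x, a <= x <= b -> cong Rel (f x) (strand_val s x)) /\
  rightof b (fun x => cong Rel (f x) (strand_out s b)).
Proof.
move=> Hf Hs ab fa; have [/andP[aw w12] _ _ _] := Hs.
have step x : a <= x <= b -> cong Rel (f x) (strand_val s x) ->
    rightof x (fun y => cong Rel (f y) (strand_out s x)).
  move=> xab fx; have [r1 r2] := strand_out_rule Hs xab.
  have [/under_classical [v ox]|nu] := boolP (under D x).
    apply: rightof_imp (col_cross Hf ox) _ => y _ h.
    apply: cong_trans h _ => //; apply: cong_sym => //.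
    apply: cong_trans (r2 v ox (fun v' => @col_per _ _ _ _ _ Hf v v')) _ => //.
    apply: cong_cross => //; [exact: twist_laurent | exact: cong_sym | exact: cong_refl].
  apply: rightof_imp (col_right Hf nu) _ => y _ h.
  by rewrite r1 //; apply: cong_trans h fx.
have main x : a <= x <= b -> cong Rel (f x) (strand_val s x).
  move=> xab; move: x xab.
  apply: (@real_induction _ (fun x => cong Rel (f x) (strand_val s x)) a b).
  - by rewrite /strand_val aw.
  - move=> t /andP[at_ tb] ft; have tab : a <= t <= b by lra.
    apply: rightof_and (step t tab ft) (strand_val_right t w12) _ => y _ h1 ->.
    exact: h1.
  - move=> t /andP[at_ tb] h.
    have [y yt [[h1 h2] h3]] := leftof_ex (leftof_and (leftof_and (leftof_gt at_) (col_left Hf t)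
      (S := fun y => a < y /\ cong Rel (f y) (f t)) (fun _ _ p q => conj p q))
      (strand_val_left t w12)
      (S := fun y => (a < y /\ cong Rel (f y) (f t)) /\ strand_val s y = strand_val s t) (fun _ _ p q => conj p q)).
    apply: cong_trans (cong_sym HR h2) _ => //; rewrite -h3; apply: h.
    by rewrite yt ltW.
split=> //; apply: step; rewrite ?lexx ?andbT //; apply: main; rewrite lexx andbT //.
Qed.

End Strands.

Section ArcSystems.
Variables (R : realType) (I : finType) (a b : I -> R) (S : set R).

Definition arc_system :=
  [/\ forall i, a i < b i < a i + 1,
      forall t, S t <-> exists i, arc (a i) (b i) t &
      forall i j t, arc (a i) (b i) t -> arc (a j) (b j) t -> i = j].

Hypothesis HS : arc_system.

Lemma system_same s t : same_param s t -> S s -> S t.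
Proof.
case: HS => _ SE _ st /SE [i hi]; apply/SE; exists i.
exact: arc_same st hi.
Qed.

Lemma germs_all (Q : I -> R -> Prop) t :
  (forall i, leftof t (Q i)) -> leftof t (fun s => forall i, Q i s).
Proof.
move=> h; have := @leftof_seq _ _ t (enum I) Q (fun x _ => h x).
by move/leftof_imp; apply=> s _ hs i; apply: hs; rewrite mem_enum.
Qed.

Lemma germs_allr (Q : I -> R -> Prop) t :
  (forall i, rightof t (Q i)) -> rightof t (fun s => forall i, Q i s).
Proof.
move=> h; have := @rightof_seq _ _ t (enum I) Q (fun x _ => h x).
by move/rightof_imp; apply=> s _ hs i; apply: hs; rewrite mem_enum.
Qed.

Lemma system_germs t : ~ S t -> leftof t (fun s => ~ S s) /\ rightof t (fun s => ~ S s).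
Proof.
case: HS => ab SE _ nS.
have h i := not_arc_germs (ab i) (fun h => nS (iffRL (SE t) (ex_intro _ i h))).
split.
  apply: leftof_imp (germs_all (fun i => (h i).1)) _ => s _ hs /SE [i]; exact: hs.
apply: rightof_imp (germs_allr (fun i => (h i).2)) _ => s _ hs /SE [i]; exact: hs.
Qed.

Lemma system_end_germs i : leftof (a i) (fun s => ~ S s) /\ rightof (b i) (fun s => ~ S s).
Proof.
case: HS => ab SE dj.
have inA : arc (a i) (b i) (a i) by apply: arc_mem; have := ab i; lra.
have inB : arc (a i) (b i) (b i) by apply: arc_mem; have := ab i; lra.
have hA j : leftof (a i) (fun s => ~ arc (a j) (b j) s).
  have [<-|ij] := eqVneq i j; first by case: (arc_end_germs (ab i)).
  by case: (@not_arc_germs _ (a j) (b j) (a i) (ab j)) => // h; move/eqP: ij; apply; exact: dj inA h.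
have hB j : rightof (b i) (fun s => ~ arc (a j) (b j) s).
  have [<-|ij] := eqVneq i j; first by case: (arc_end_germs (ab i)).
  by case: (@not_arc_germs _ (a j) (b j) (b i) (ab j)) => // h; move/eqP: ij; apply; exact: dj inB h.
split.
  by apply: leftof_imp (germs_all hA) _ => s _ hs /SE [j]; exact: hs.
by apply: rightof_imp (germs_allr hB) _ => s _ hs /SE [j]; exact: hs.
Qed.

Section Determined.
Variables (D : diagram R) (g : nat) (Rel : set 'rV[K]_g) (f f' : R -> 'rV[K]_g).
Hypotheses (HR : submodule is_laurent Rel) (Hf : coloring D Rel f) (Hf' : coloring D Rel f').
Hypothesis ff' : forall t, (~` S) t -> cong Rel (f t) (f' t).

(** Just before [a i] the parameter is outside [S], where the colorings agree; left continuity
    carries the agreement to [a i]. *)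
Lemma cong_start i : cong Rel (f (a i)) (f' (a i)).
Proof.
have [h _] := system_end_germs i.
have [s _ [h1 h2]] := leftof_ex (leftof_and (leftof_and h (col_left Hf (a i))
  (S := fun s => cong Rel (f (a i)) (f' s))
  (fun s _ p q => cong_trans HR (cong_sym HR q) (ff' p)))
  (col_left Hf' (a i)) (S := fun s => cong Rel (f (a i)) (f' s) /\ cong Rel (f' s) (f' (a i)))
  (fun _ _ p q => conj p q)).
exact: cong_trans h1 h2.
Qed.

Lemma cong_arcs : (forall i x, a i <= x <= b i -> cong Rel (f x) (f' x)) ->
  forall t, cong Rel (f t) (f' t).
Proof.
case: HS => _ SE _ h t; have [/SE [i /arc_ex [x xi tx]]|nS] := pselect (S t); last exact: ff'.
apply: cong_trans (col_per Hf tx) _ => //; apply: cong_trans (h i x xi) _ => //.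
by apply: (col_per Hf'); rewrite same_param_sym.
Qed.

End Determined.

Section TransferStrands.
Variables (D1 D2 : diagram R) (g : nat) (Rel : set 'rV[K]_g) (f : R -> 'rV[K]_g).
Hypotheses (lc : local_change S D1 D2) (HR : submodule is_laurent Rel)
  (Hf : coloring D1 Rel f).
Variable st : I -> strand R g.
Hypothesis st_in : forall i, cong Rel (f (a i)) (s_in (st i)).
Hypothesis st_out : forall i, rightof (b i) (fun x => cong Rel (f x) (strand_out (st i) (b i))).
Hypothesis st_laurent : forall i x, mx_in is_laurent (strand_val (st i) x).
(** Stated for every [f'] that extends the strand colors: the colors of the over-strands inside [S]
    are values of the very function that is to be built. *)
Hypothesis st_follows : forall f',
  (forall i y t, a i <= y <= b i -> same_param t y -> f' t = strand_val (st i) y) ->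
  forall i, follows Rel D2 f' (a i) (b i) (st i).

(** [S] consists of the parameters of the points in the disc, so the two strands of a crossing are
    both in [S] or both outside. *)
Lemma outside_classical v t : ~ S t -> classical D2 v t -> ~ S v /\ classical D1 v t.
Proof.
case: lc => _ SE2 _ cl nS vt; have nv : ~ S v.
  by move=> /SE2; rewrite (classical_curve vt) => /SE2.
by split=> //; rewrite cl.
Qed.

Lemma outside_twist v t : ~ S v -> ~ S t -> twist D1 (v, t) = twist D2 (v, t).
Proof.
move=> nv nt; case: lc => _ _ ce _.
have der x : ~ S x -> derive1 (curve D1) x = derive1 (curve D2) x.
  move=> nx; have [l r] := system_germs nx.
  apply: derive1_germ; first exact: ce.
    by apply: leftof_imp l _ => s _; exact: ce.
  by apply: rightof_imp r _ => s _; exact: ce.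
have pE D : positive D (v, t) = (0 < det2 (derive1 (curve D) v) (derive1 (curve D) t)) by [].
by rewrite /twist (pE D1) (pE D2) (der _ nv) (der _ nt).
Qed.

Lemma transfer_strands : exists f', coloring D2 Rel f' /\
  forall t, (~` S) t -> cong Rel (f' t) (f t).
Proof.
case: (HS) => ab SE dj.
(* The arcs are pairwise disjoint, so [pick] finds the only arc containing t; off the arcs the old
   color is kept. *)
pose f' t := if [pick i | rep (a i) t <= b i] is Some i then strand_val (st i) (rep (a i) t) else f t.
have arcE i t : arc (a i) (b i) t <-> rep (a i) t <= b i by apply: arcP; have := ab i; lra.
have f'in i y t : a i <= y <= b i -> same_param t y -> f' t = strand_val (st i) y.
  move=> ay ty; have e : rep (a i) t = y by apply: rep_eq => //; have := ab i; lra.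
  have ai : arc (a i) (b i) t by apply/arcE; rewrite e; case/andP: ay.
  rewrite /f'; case: pickP => [j /arcE aj|/(_ i)]; last by rewrite e; case/andP: ay => _ ->.
  by rewrite -(dj i j t ai aj) e.
have f'out t : ~ S t -> f' t = f t.
  move=> nS; rewrite /f'; case: pickP => // i /arcE ai; case: nS.
  by apply/SE; exists i.
have Hfol := st_follows f'in.
exists f'; split; last by move=> t nt; rewrite f'out //; exact: cong_refl.
have out_per s t : same_param s t -> ~ S t -> f' s = f s /\ ~ S s.
  move=> st' nt; have ns : ~ S s by move=> /(system_same st').
  by rewrite f'out.
have inP t : S t -> exists i x, a i <= x <= b i /\ same_param t x.
  by move=> /SE [i /arc_ex [x xi tx]]; exists i, x.
have per s t : same_param s t -> cong Rel (f' s) (f' t).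
  move=> st'; have [/inP [i [x [xi tx]]]|nS] := pselect (S t).
    by rewrite (f'in i x s) ?(f'in i x t) //; [exact: cong_refl | exact: same_param_trans tx].
  by rewrite !f'out //; [exact: (col_per Hf) | case: (out_per _ _ st' nS)].
have shiftl t x P : same_param t x -> leftof x (fun y => forall t', same_param t' y -> P t') ->
    leftof t P.
  move=> /same_paramP [k tk]; have -> : x = t + (- k)%:~R by rewrite tk intrN addrK.
  move=> /leftof_shift /leftof_imp; apply=> s _; apply.
  by rewrite same_paramDr same_param_refl.
have shiftr t x P : same_param t x -> rightof x (fun y => forall t', same_param t' y -> P t') ->
    rightof t P.
  move=> /same_paramP [k tk]; have -> : x = t + (- k)%:~R by rewrite tk intrN addrK.
  move=> /rightof_shift /rightof_imp; apply=> s _; apply.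
  by rewrite same_paramDr same_param_refl.
have w12 i : a i <= s_w1 (st i) < s_w2 (st i) by case: (Hfol i).
have right_in i x : a i <= x <= b i ->
    rightof x (fun y => forall t', same_param t' y -> cong Rel (f' t') (strand_out (st i) x)).
  move=> /andP[ax]; rewrite le_eqVlt => /orP[/eqP xb|xb].
    have [_ rS] := system_end_germs i; rewrite xb.
    apply: rightof_and rS (st_out i) _ => y _ ny fy t' ty.
    have [-> _] := out_per _ _ ty ny.
    by apply: cong_trans fy => //; exact: (col_per Hf).
  have /andP[_ w] := w12 i.
  apply: rightof_and (rightof_lt xb) (strand_val_right x w) _ => y xy yb sy t' ty.
  by rewrite (f'in i y) // ?sy; [exact: cong_refl | lra].
have left_in i x : a i <= x <= b i ->
    leftof x (fun y => forall t', same_param t' y -> cong Rel (f' t') (strand_val (st i) x)).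
  move=> /andP[]; rewrite le_eqVlt => /orP[/eqP <-|ax] xb.
    have [lS _] := system_end_germs i; have /andP[aw _] := w12 i.
    apply: leftof_and lS (col_left Hf (a i)) _ => y _ ny fy t' ty.
    have [-> _] := out_per _ _ ty ny; rewrite /strand_val aw.
    by apply: cong_trans (st_in i) => //; apply: cong_trans fy => //; exact: (col_per Hf).
  have /andP[_ w] := w12 i.
  apply: leftof_and (leftof_gt ax) (strand_val_left x w) _ => y xy yb sy t' ty.
  by rewrite (f'in i y) // ?sy; [exact: cong_refl | lra].
split.
- move=> t; have [/inP [i [x [xi tx]]]|nS] := pselect (S t).
    by rewrite (f'in i x).
  by rewrite f'out //; exact: (col_in Hf).
- exact: per.
- move=> t; have [/inP [i [x [xi tx]]]|nS] := pselect (S t).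
    by rewrite (f'in i x t) //; apply: shiftl tx _; exact: left_in.
  have [lS _] := system_germs nS.
  by apply: leftof_and lS (col_left Hf t) _ => y _ ny; rewrite !f'out.
- move=> t nu; have [/inP [i [x [xi tx]]]|nS] := pselect (S t).
    rewrite (f'in i x t) //; have tx' := tx; apply: shiftr tx' _.
    have [h _] := strand_out_rule HR (Hfol i) xi.
    rewrite -h; last by rewrite -(under_same D2 tx).
    exact: right_in.
  have nu1 : ~~ under D1 t.
    apply: contra nu => /under_classical [v vt]; apply: (@classical_under _ _ v).
    case: lc => SE1 _ _ cl; rewrite -cl // => /SE1.
    by rewrite (classical_curve vt) => /SE1.
  have [_ rS] := system_germs nS.
  by apply: rightof_and rS (col_right Hf nu1) _ => y _ ny; rewrite !f'out.
- move=> v t vt; have [/inP [i [x [xi tx]]]|nS] := pselect (S t).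
    rewrite (f'in i x t) //; have tx' := tx; apply: shiftr tx' _.
    have vx : classical D2 v x by rewrite -(classical_same D2 (same_param_refl v) tx).
    have [_ h] := strand_out_rule HR (Hfol i) xi.
    rewrite (twist_same D2 (same_param_refl v) tx).
    apply: rightof_imp (right_in i x xi) _ => y _ hy t' ty.
    by apply: cong_trans (hy _ ty) _ => //; apply: h vx _ => v'; exact: per.
  have [nv vt1] := outside_classical nS vt.
  have [_ rS] := system_germs nS.
  apply: rightof_and rS (col_cross Hf vt1) _ => y _ ny.
  rewrite (f'out y ny) (f'out t nS) (f'out v nv) => h.
  exact: (eq_ind _ (fun T => cong Rel (f y) (cross T (f t) (f v))) h _ (outside_twist nv nS)).
Qed.

End TransferStrands.

End ArcSystems.

Section Along.
Variables (R : realType) (D : diagram R).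

(** The part of [follows] that depends on the diagram and not on the colors, shared by all colorings
    of a strand. *)
Definition along a b w1 T1 o1 w2 T2 o2 :=
  [/\ a <= w1 < w2,
      forall x, a <= x <= b -> under D x -> x = w1 \/ x = w2,
      w1 <= b -> classical D o1 w1 /\ twist D (o1, w1) = T1 &
      w2 <= b -> classical D o2 w2 /\ twist D (o2, w2) = T2].

Definition along0 a b := forall x, a <= x <= b -> ~~ under D x.

Variables (g : nat) (Rel : set 'rV[K]_g).
Hypothesis HR : submodule is_laurent Rel.
Implicit Types f : R -> 'rV[K]_g.

Lemma along_follows f a b w1 T1 o1 w2 T2 o2 L y1 y2 :
  along a b w1 T1 o1 w2 T2 o2 -> (w1 <= b -> cong Rel (f o1) y1) ->
  (w2 <= b -> cong Rel (f o2) y2) ->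
  follows Rel D f a b (Strand L w1 T1 y1 w2 T2 y2).
Proof.
case=> aw un c1 c2 f1 f2; split=> //= wb.
  by have [h1 h2] := c1 wb; exists o1; split=> //; exact: f1.
by have [h1 h2] := c2 wb; exists o2; split=> //; exact: f2.
Qed.

(** Both undercrossings are dummies, placed beyond the end [b]. *)
Definition const_strand (b : R) (L : 'rV[K]_g) := Strand L (b + 1) 1 L (b + 2) 1 L.
Definition strand1 (b : R) (L : 'rV[K]_g) w T y := Strand L w T y (b + 1) 1 L.

Lemma along0_along a b : a <= b -> along0 a b -> along a b (b + 1) 1 0 (b + 2) 1 0.
Proof.
move=> ab nu; split; [lra | | by move=> h; exfalso; lra | by move=> h; exfalso; lra].
by move=> x /nu /negP h /h.
Qed.

Lemma const_follows f a b L : a <= b -> along0 a b -> follows Rel D f a b (const_strand b L).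
Proof. by move=> ab /(along0_along ab) /along_follows; apply => h; exfalso; lra. Qed.

Lemma const_val b L x : x <= b -> strand_val (const_strand b L) x = L.
Proof. by move=> xb; rewrite /strand_val /= ifT //; lra. Qed.

Lemma const_out b L : strand_out (const_strand b L) b = L.
Proof. by rewrite /strand_out /= ifT //; lra. Qed.

Lemma strand1_val b L w T y x : x <= b ->
  strand_val (strand1 b L w T y) x = if x <= w then L else cross T L y.
Proof. by move=> xb; rewrite /strand_val /= [X in if _ then _ else X]ifT //; lra. Qed.

Lemma strand1_out b L w T y : w <= b -> strand_out (strand1 b L w T y) b = cross T L y.
Proof. by move=> wb; rewrite /strand_out /= ifF ?ifT //; [lra | apply/negbTE; rewrite -leNgt]. Qed.

Lemma along0_color f a b : coloring D Rel f -> a <= b -> along0 a b ->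
  (forall x, a <= x <= b -> cong Rel (f x) (f a)) /\
  rightof b (fun x => cong Rel (f x) (f a)).
Proof.
move=> Hf ab nu; have [h1 h2] := follows_coloring HR Hf (const_follows f (f a) ab nu) ab (cong_refl HR _).
split; last by rewrite const_out in h2.
by move=> x xab; have := h1 x xab; rewrite const_val //; case/andP: xab.
Qed.

Lemma along_det f f' a b w1 T1 o1 w2 T2 o2 : coloring D Rel f -> coloring D Rel f' ->
  a <= b -> along a b w1 T1 o1 w2 T2 o2 -> cong Rel (f a) (f' a) ->
  (w1 <= b -> cong Rel (f o1) (f' o1)) -> (w2 <= b -> cong Rel (f o2) (f' o2)) ->
  forall x, a <= x <= b -> cong Rel (f x) (f' x).
Proof.
move=> Hf Hf' ab al fa f1 f2 x xab.
pose s := Strand (f' a) w1 T1 (f' o1) w2 T2 (f' o2).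
have [h _] := follows_coloring HR Hf (along_follows (f' a) al f1 f2) ab fa.
have [h' _] := follows_coloring HR Hf' (along_follows (f' a) al
  (fun _ => cong_refl HR _) (fun _ => cong_refl HR (f' o2))) ab (cong_refl HR _).
by apply: cong_trans (h x xab) _ => //; apply: cong_sym => //; exact: h'.
Qed.

Lemma strand_val_laurent (s : strand R g) x : is_laurent (s_T1 s) -> is_laurent (s_T2 s) ->
  mx_in is_laurent (s_in s) -> mx_in is_laurent (s_y1 s) -> mx_in is_laurent (s_y2 s) ->
  mx_in is_laurent (strand_val s x).
Proof.
have cr T (y z : 'rV[K]_g) : is_laurent T -> mx_in is_laurent y -> mx_in is_laurent z ->
    mx_in is_laurent (cross T y z).
  move=> LT Ly Lz i j; rewrite !mxE; apply: (subringD HL).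
    exact: (subringM HL LT (Ly i j)).
  exact: (subringM HL (subringB HL (subring1 HL) LT) (Lz i j)).
move=> L1 L2 i1 y1 y2; rewrite /strand_val; case: ifP => // _.
have c1 := cr _ _ _ L1 i1 y1; case: ifP => _; [exact: c1 | exact: (cr _ _ _ L2 c1 y2)].
Qed.

End Along.

(** Self-distributivity of the Alexander quandle, the algebra behind the third move. *)
Lemma crossD g T S (x y z : 'rV[K]_g) :
  cross T (cross S x y) z = cross S (cross T x z) (cross T y z).
Proof. by apply/rowP => j; rewrite !mxE; ring. Qed.

(** The algebra behind the first move: if the outgoing color y is also the color of the over-strand,
    then the incoming color x equals y, because T is a unit. *)
Lemma cross_fixed (F : fieldType) g (T : F) (x y : 'rV[F]_g) : T != 0 ->
  y - x = T^-1 *: (y - (T *: x + (1 - T) *: y)).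
Proof. by move=> T0; apply/rowP => j; rewrite !mxE; field. Qed.

(** * The Reidemeister moves in terms of crossing data *)

Section R1.
Variables (R : realType) (D1 D2 : diagram R) (a b v u : R).
Hypotheses (ab : a < b < a + 1) (lc : local_change (arc a b) D1 D2).
Hypotheses (va : a <= v <= b) (ua : a <= u <= b).
Hypotheses (un1 : forall x, a <= x <= b -> under D1 x -> x = u) (vu : classical D1 v u).
Hypothesis un2 : along0 D2 a b.

Let ab' : a <= b. Proof. by case/andP: ab => /ltW. Qed.
Let T := twist D1 (v, u).

Let sys : arc_system (fun _ : unit => a) (fun=> b) (arc a b).
Proof.
split=> [//|t|[] [] //]; split=> [h|[_ //]]; by exists tt.
Qed.

Let al1 : along D1 a b u T v (b + 1) 1 0.
Proof. by split; [have := ua; lra | move=> x xab /un1 ->; [left | ] | | move=> h; exfalso; lra]. Qed.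

(** If the overcrossing of the kink comes first, the over-strand has the incoming color; otherwise
    it has the outgoing one, and [cross_fixed] identifies the two. Either way the kink does not
    change the color. *)
Let color1 g (Rel : set 'rV[K]_g) f : submodule is_laurent Rel -> coloring D1 Rel f ->
  (forall x, a <= x <= b -> cong Rel (f x) (f a)) /\
  rightof b (fun x => cong Rel (f x) (f a)).
Proof.
move=> HR Hf; have cr := cong_refl HR.
have fol := along_follows (Rel := Rel) (f := f) (y1 := f v) (y2 := f a) (f a) al1 (fun _ => cr (f v)).
have [|h1 h2] := follows_coloring HR Hf (fol _) ab' (cr _); first by move=> h; exfalso; lra.
have LT : is_laurent T by exact: twist_laurent.
have ub : u <= b by case/andP: ua.
have fv : cong Rel (f v) (f a).
  have := h1 v va; rewrite strand1_val; last by case/andP: va.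
  case: ifP => // _; rewrite /cong => h.
  have -> : f v - f a = T^-1 *: (f v - cross T (f a) (f v)).
    have T0 : T != 0 by exact: twist_neq0.
    exact: cross_fixed.
  by apply: (submodZ HR) h; exact: twist_inv_laurent.
have cT : cong Rel (cross T (f a) (f v)) (f a).
  rewrite -[X in cong _ _ X](crossxx T); apply: cong_cross => //; exact: cr.
split.
  move=> x xab; apply: cong_trans (h1 x xab) _ => //.
  by rewrite strand1_val; [case: ifP => _ | case/andP: xab].
apply: rightof_imp h2 _ => x _ h; apply: cong_trans h _ => //.
by rewrite strand1_out.
Qed.

Lemma r1_minors : minors_ideal D1 = minors_ideal D2.
Proof.
have lc' : local_change (arc a b) D2 D1.
  by case: lc => h1 h2 h3 h4; split=> // [t /h3|s t hs ht]; rewrite ?h4.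
have T12 : transfer D1 D2 (~` arc a b) id id.
  move=> g Rel f HR Hf; have [h1 h2] := color1 HR Hf.
  apply: (transfer_strands sys lc HR Hf (st := fun=> const_strand b (f a))).
  - by move=> i; exact: cong_refl.
  - by move=> i; rewrite const_out.
  - by move=> i x; apply: strand_val_laurent; try exact: (subring1 HL); exact: (col_in Hf).
  - by move=> f' _ i; exact: const_follows.
have T21 : transfer D2 D1 (~` arc a b) id id.
  move=> g Rel f HR Hf; have [h1 h2] := along0_color HR Hf ab' un2.
  have ub : u <= b by case/andP: ua.
  apply: (transfer_strands sys lc' HR Hf (st := fun=> strand1 b (f a) u T (f a))).
  - by move=> i; exact: cong_refl.
  - by move=> i; rewrite strand1_out // crossxx.
  - move=> i x; apply: strand_val_laurent; try exact: (col_in Hf); first exact: twist_laurent.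
    exact: (subring1 HL).
  - move=> f' hf' i; apply: along_follows al1 _ _ => [_|h]; last by exfalso; lra.
    rewrite (hf' i v v va (same_param_refl v)) strand1_val; last by case/andP: va.
    by rewrite crossxx if_same; exact: cong_refl.
have U1 : determined D1 (~` arc a b) id.
  move=> g Rel f f' HR Hf Hf' ff'; have st := cong_start sys HR Hf Hf' ff' tt.
  apply: (cong_arcs sys HR Hf Hf' ff') => _ x xab.
  have [h _] := color1 HR Hf; have [h' _] := color1 HR Hf'.
  apply: cong_trans (h x xab) _ => //; apply: cong_trans st _ => //.
  by apply: cong_sym => //; exact: h'.
have U2 : determined D2 (~` arc a b) id.
  move=> g Rel f f' HR Hf Hf' ff'; have st := cong_start sys HR Hf Hf' ff' tt.
  apply: (cong_arcs sys HR Hf Hf' ff') => _ x xab.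
  have [h _] := along0_color HR Hf ab' un2; have [h' _] := along0_color HR Hf' ab' un2.
  apply: cong_trans (h x xab) _ => //; apply: cong_trans st _ => //.
  by apply: cong_sym => //; exact: h'.
by apply/seteqP; split; [exact: (transfer_minors T12 T21 U2) | exact: (transfer_minors T21 T12 U1)].
Qed.

End R1.

Lemma local_change_sym (R : realType) S (D1 D2 : diagram R) :
  local_change S D1 D2 -> local_change S D2 D1.
Proof. by case=> h1 h2 h3 h4; split=> // [t /h3|s t hs ht]; rewrite ?h4. Qed.

Lemma arc_system2 (R : realType) (a b c d : R) : a < b < a + 1 -> c < d < c + 1 ->
  arc a b `&` arc c d = set0 ->
  arc_system (fun i : bool => if i then a else c) (fun i => if i then b else d)
    (arc a b `|` arc c d).
Proof.
move=> ab cd dj; split; first by case.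
- move=> t; split=> [[h|h]|[[|] h]]; [by exists true | by exists false | by left | by right].
- move=> [] [] t //= h h'; exfalso.
    by have : (arc a b `&` arc c d) t by []; rewrite dj.
  by have : (arc a b `&` arc c d) t by []; rewrite dj.
Qed.

Lemma arc_system3 (R : realType) (a b c d e f : R) :
  a < b < a + 1 -> c < d < c + 1 -> e < f < e + 1 ->
  arc a b `&` arc c d = set0 -> arc a b `&` arc e f = set0 -> arc c d `&` arc e f = set0 ->
  arc_system (fun i : option bool => if i is Some i' then if i' then c else e else a)
    (fun i => if i is Some i' then if i' then d else f else b)
    (arc a b `|` arc c d `|` arc e f).
Proof.
move=> ab cd ef dj1 dj2 dj3.
have no (A B : set R) t : A `&` B = set0 -> A t -> B t -> False.
  by move=> AB At Bt; have : (A `&` B) t by []; rewrite AB.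
split; first by case=> [[|]|].
- move=> t; split=> [[[h|h]|h]|[[[|]|] h]].
  + by exists None.
  + by exists (Some true).
  + by exists (Some false).
  + by left; right.
  + by right.
  + by left; left.
- move=> [[|]|] [[|]|] t //= h h'; exfalso.
  + exact: no dj3 h h'.
  + exact: no dj1 h' h.
  + exact: no dj3 h' h.
  + exact: no dj2 h' h.
  + exact: no dj1 h h'.
  + exact: no dj2 h h'.
Qed.

Section R2.
Variables (R : realType) (D1 D2 : diagram R) (a b c d : R).
Let S := arc a b `|` arc c d.
Hypotheses (ab : a < b < a + 1) (cd : c < d < c + 1) (dj : arc a b `&` arc c d = set0).
Hypothesis lc : local_change S D1 D2.
Variables (w1 w2 o1 o2 : R).
Hypotheses (cw : c <= w1 < w2) (wd : w2 <= d) (o1a : a <= o1 <= b) (o2a : a <= o2 <= b).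
Hypotheses (cl1 : classical D1 o1 w1) (cl2 : classical D1 o2 w2).
Hypothesis tw : twist D1 (o2, w2) = (twist D1 (o1, w1))^-1.
Hypothesis un : forall x, c <= x <= d -> under D1 x -> x = w1 \/ x = w2.
Hypotheses (up1 : along0 D1 a b) (up2 : along0 D2 a b) (low2 : along0 D2 c d).

Let ab' : a <= b. Proof. by case/andP: ab => /ltW. Qed.
Let cd' : c <= d. Proof. by case/andP: cd => /ltW. Qed.
Let T := twist D1 (o1, w1).

Let st (i : bool) := if i then a else c.
Let en (i : bool) := if i then b else d.

Let sys : arc_system st en S.
Proof. exact: arc_system2. Qed.

Let al1 : along D1 c d w1 T o1 w2 T^-1 o2.
Proof. by split=> //. Qed.

Let w1d : w1 <= d. Proof. by have := cw; have := wd; lra. Qed.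

Let low_strand g (x y : 'rV[K]_g) := Strand x w1 T y w2 T^-1 y.

(** The two undercrossings have opposite signs and the same over-color, so the second one undoes the
    first. *)
Let low_out g (x y : 'rV[K]_g) : strand_out (low_strand x y) d = x.
Proof.
rewrite /strand_out /= !ifF ?crossK //; last 2 first.
- by apply/negbTE; rewrite -leNgt ?w1d.
- by apply/negbTE; rewrite -leNgt ?w1d.
exact: twist_neq0.
Qed.

Lemma r2_minors : minors_ideal D1 = minors_ideal D2.
Proof.
have LT : is_laurent T by exact: twist_laurent.
have LT' : is_laurent T^-1 by exact: twist_inv_laurent.
have T12 : transfer D1 D2 (~` S) id id.
  move=> g Rel f HR Hf; have cr := cong_refl HR.
  have [h1 h2] := along0_color HR Hf ab' up1.
  have fol := along_follows (f c) al1 (fun _ => h1 _ o1a) (fun _ => h1 _ o2a).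
  have [h3 h4] := follows_coloring HR Hf fol cd' (cr _).
  rewrite [strand_out _ _]low_out in h4.
  apply: (transfer_strands sys lc HR Hf (st := fun i => const_strand (en i) (f (st i)))).
  - by move=> i; exact: cr.
  - by move=> [|]; rewrite const_out.
  - by move=> i x; apply: strand_val_laurent; try exact: (subring1 HL); exact: (col_in Hf).
  - by move=> f' _ [|]; exact: const_follows.
have T21 : transfer D2 D1 (~` S) id id.
  move=> g Rel f HR Hf; have cr := cong_refl HR.
  have [h1 h2] := along0_color HR Hf ab' up2.
  have [h3 h4] := along0_color HR Hf cd' low2.
  apply: (transfer_strands sys (local_change_sym lc) HR Hf
    (st := fun i => if i then const_strand b (f a) else low_strand (f c) (f a))).
  - by move=> [|]; exact: cr.
  - by move=> [|]; rewrite ?const_out ?low_out.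
  - move=> [|] x; apply: strand_val_laurent; try exact: (subring1 HL); try exact: (col_in Hf).
      exact: LT.
    exact: LT'.
  - move=> f' hf' [|]; first exact: const_follows.
    apply: (along_follows _ al1) => _.
      rewrite (hf' true o1 o1 o1a (same_param_refl _)) const_val; [exact: cr | by case/andP: o1a].
    rewrite (hf' true o2 o2 o2a (same_param_refl _)) const_val; [exact: cr | by case/andP: o2a].
have U1 : determined D1 (~` S) id.
  move=> g Rel f f' HR Hf Hf' ff'; have s := cong_start sys HR Hf Hf' ff'.
  have det := along_det HR Hf Hf'.
  have top := det _ _ _ _ _ _ _ _ ab' (along0_along ab' up1) (s true).
  have topx x : a <= x <= b -> cong Rel (f x) (f' x) by apply: top => h; exfalso; lra.
  apply: (cong_arcs sys HR Hf Hf' ff') => -[|] x; first exact: topx.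
  by apply: (det _ _ _ _ _ _ _ _ cd' al1 (s false)) => _; exact: topx.
have U2 : determined D2 (~` S) id.
  move=> g Rel f f' HR Hf Hf' ff'; have s := cong_start sys HR Hf Hf' ff'.
  have det := along_det HR Hf Hf'.
  apply: (cong_arcs sys HR Hf Hf' ff') => -[|] x.
    by apply: (det _ _ _ _ _ _ _ _ ab' (along0_along ab' up2) (s true)) => h; exfalso; lra.
  by apply: (det _ _ _ _ _ _ _ _ cd' (along0_along cd' low2) (s false)) => h; exfalso; lra.
by apply/seteqP; split; [exact: (transfer_minors T12 T21 U2) | exact: (transfer_minors T21 T12 U1)].
Qed.

End R2.

Section R3.
Variable (R : realType) (a b c d e f : R).
Let S := arc a b `|` arc c d `|` arc e f.
Hypotheses (ab : a < b < a + 1) (cd : c < d < c + 1) (ef : e < f < e + 1).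
Hypotheses (dj1 : arc a b `&` arc c d = set0) (dj2 : arc a b `&` arc e f = set0)
  (dj3 : arc c d `&` arc e f = set0).
Variables (m n : R) (T1 T2 T3 : K).
Hypotheses (mc : c <= m <= d) (ne : e <= n <= f).

(* The middle strand passes under the top one at u1, the bottom strand passes
   under the middle one at n and under the top one at u2. *)
Record r3_data (D : diagram R) (o1 u1 o2 u2 : R) : Prop := R3Data {
  r3_o1 : a <= o1 <= b; r3_o2 : a <= o2 <= b;
  r3_u1 : c <= u1 <= d; r3_u2 : e <= u2 <= f;
  r3_m : u1 != m; r3_n : u2 != n;
  r3_c1 : classical D o1 u1; r3_c2 : classical D o2 u2; r3_c3 : classical D m n;
  r3_t1 : twist D (o1, u1) = T1; r3_t2 : twist D (o2, u2) = T2; r3_t3 : twist D (m, n) = T3;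
  r3_top : along0 D a b;
  r3_mid : forall x, c <= x <= d -> under D x -> x = u1;
  r3_bot : forall x, e <= x <= f -> under D x -> x = n \/ x = u2 }.

Let ab' : a <= b. Proof. by case/andP: ab => /ltW. Qed.
Let cd' : c <= d. Proof. by case/andP: cd => /ltW. Qed.
Let ef' : e <= f. Proof. by case/andP: ef => /ltW. Qed.

Let st (i : option bool) := if i is Some i' then if i' then c else e else a.
Let en (i : option bool) := if i is Some i' then if i' then d else f else b.

Let sys : arc_system st en S.
Proof. exact: arc_system3. Qed.

Let mid_strand g (x z : 'rV[K]_g) u1 := strand1 d x u1 T1 z.

Let bot_strand g (x y z : 'rV[K]_g) u2 :=
  if n < u2 then Strand x n T3 y u2 T2 z else Strand x u2 T2 z n T3 y.

(** The color of the middle strand where it passes over the bottom one, which depends on whether it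
    has already passed under the top strand. *)
Let mid_m g (x z : 'rV[K]_g) u1 := if u1 < m then cross T1 x z else x.

Section Data.
Variables (D : diagram R) (o1 u1 o2 u2 : R).
Hypothesis HD : r3_data D o1 u1 o2 u2.

Lemma along_mid : along D c d u1 T1 o1 (d + 1) 1 0.
Proof.
split.
- by have := r3_u1 HD; lra.
- by move=> x xc /(r3_mid HD xc) ->; left.
- by move=> _; split; [exact: r3_c1 HD | exact: r3_t1 HD].
- by move=> h; exfalso; lra.
Qed.

Lemma along_bot : if n < u2 then along D e f n T3 m u2 T2 o2 else along D e f u2 T2 o2 n T3 m.
Proof.
have hu := r3_u2 HD; have hn := ne; have nn := r3_n HD.
have c2 : classical D o2 u2 /\ twist D (o2, u2) = T2 by split; [exact: r3_c2 HD | exact: r3_t2 HD].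
have c3 : classical D m n /\ twist D (m, n) = T3 by split; [exact: r3_c3 HD | exact: r3_t3 HD].
case: ltgtP nn => [nu|un|->]; rewrite ?eqxx // => _; split=> //.
- by rewrite nu andbT; case/andP: hn.
- exact: r3_bot HD.
- by rewrite un andbT; case/andP: hu.
- by move=> x xe /(r3_bot HD xe) [|]; [right | left].
Qed.

Variables (g : nat) (Rel : set 'rV[K]_g).
Hypothesis HR : submodule is_laurent Rel.

Lemma follows_mid (h : R -> 'rV[K]_g) x z : cong Rel (h o1) z ->
  follows Rel D h c d (mid_strand x z u1).
Proof.
by move=> hz; apply: (along_follows _ along_mid) => // hh; exfalso; lra.
Qed.

Lemma follows_bot (h : R -> 'rV[K]_g) x y z : cong Rel (h m) y -> cong Rel (h o2) z ->
  follows Rel D h e f (bot_strand x y z u2).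
Proof.
by move=> hy hz; have := along_bot; rewrite /bot_strand; case: ifP => _ al; apply: (along_follows _ al).
Qed.

Lemma mid_val (x z : 'rV[K]_g) : strand_val (mid_strand x z u1) m = mid_m x z u1.
Proof.
rewrite strand1_val; last by case/andP: mc.
rewrite /mid_m; have := r3_m HD; case: ltgtP => // _; by rewrite ?eqxx.
Qed.

Lemma mid_out (x z : 'rV[K]_g) : strand_out (mid_strand x z u1) d = cross T1 x z.
Proof. by rewrite strand1_out //; case/andP: (r3_u1 HD). Qed.

Lemma bot_out (x y z : 'rV[K]_g) : strand_out (bot_strand x y z u2) f =
  if n < u2 then cross T2 (cross T3 x y) z else cross T3 (cross T2 x z) y.
Proof.
have /andP[_ hu] := r3_u2 HD; have /andP[_ hn] := ne.
by rewrite /bot_strand; case: ifP => _; rewrite /strand_out /= !ifF //; apply/negbTE; rewrite -leNgt.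
Qed.

Lemma r3_top_color (h : R -> 'rV[K]_g) : coloring D Rel h ->
  (forall x, a <= x <= b -> cong Rel (h x) (h a)) /\ rightof b (fun x => cong Rel (h x) (h a)).
Proof. by move=> Hh; exact: (along0_color HR Hh ab' (r3_top HD)). Qed.

Lemma r3_m_color (h : R -> 'rV[K]_g) : coloring D Rel h ->
  cong Rel (h m) (mid_m (h c) (h a) u1) /\
  rightof d (fun x => cong Rel (h x) (cross T1 (h c) (h a))).
Proof.
move=> Hh; have [top _] := r3_top_color Hh.
have [h1 h2] := follows_coloring HR Hh (follows_mid (h c) (top _ (r3_o1 HD))) cd' (cong_refl HR _).
split; first by rewrite -mid_val; exact: h1.
by rewrite mid_out in h2.
Qed.

Lemma r3_bot_color (h : R -> 'rV[K]_g) : coloring D Rel h ->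
  rightof f (fun x => cong Rel (h x)
    (strand_out (bot_strand (h e) (mid_m (h c) (h a) u1) (h a) u2) f)).
Proof.
move=> Hh; have [top _] := r3_top_color Hh; have [hm _] := r3_m_color Hh.
have bi : cong Rel (h e) (s_in (bot_strand (h e) (mid_m (h c) (h a) u1) (h a) u2)).
  by rewrite /bot_strand; case: ifP => _; exact: cong_refl.
by have [_] := follows_coloring HR Hh (follows_bot (h e) hm (top _ (r3_o2 HD))) ef' bi.
Qed.

Lemma r3_laurent : is_laurent T1 /\ is_laurent T2 /\ is_laurent T3.
Proof.
by rewrite -(r3_t1 HD) -(r3_t2 HD) -(r3_t3 HD); split; [|split]; exact: twist_laurent.
Qed.

Lemma r3_determined : determined D (~` S) id.
Proof.
move=> g' Rel' h h' HR' Hh Hh' hh'; have s := cong_start sys HR' Hh Hh' hh'.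
have det := along_det HR' Hh Hh'.
have top x : a <= x <= b -> cong Rel' (h x) (h' x).
  by apply: (det _ _ _ _ _ _ _ _ ab' (along0_along ab' (r3_top HD)) (s None)) => hb; exfalso; lra.
have mid x : c <= x <= d -> cong Rel' (h x) (h' x).
  apply: (det _ _ _ _ _ _ _ _ cd' along_mid (s (Some true))) => hb; last by exfalso; lra.
  exact: top (r3_o1 HD).
apply: (cong_arcs sys HR' Hh Hh' hh') => -[[|]|] x; [exact: mid | | exact: top].
have := along_bot; case: ifP => _ al; apply: (det _ _ _ _ _ _ _ _ ef' al (s (Some false))) => _.
- exact: mid.
- exact: top (r3_o2 HD).
- exact: top (r3_o2 HD).
- exact: mid.
Qed.

End Data.

(** The move reverses the order of the two crossings on both lower strands. If the top strand meets
    these with equal twists, the equality is self-distributivity; if the twists are inverse to each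
    other, it follows from self-distributivity after cancellation of [T1] on the middle strand. *)
Lemma bot_out_eq g (x y z : 'rV[K]_g) D D' o1 u1 o2 u2 p1 v1 p2 v2 :
  r3_data D o1 u1 o2 u2 -> r3_data D' p1 v1 p2 v2 ->
  (u1 < m < v1) || (v1 < m < u1) -> (u2 < n < v2) || (v2 < n < u2) ->
  T2 = (if (u1 < m) == (u2 < n) then T1 else T1^-1) ->
  strand_out (bot_strand x (mid_m y z u1) z u2) f = strand_out (bot_strand x (mid_m y z v1) z v2) f.
Proof.
move=> HD HD' mo no T2E; rewrite (bot_out HD) (bot_out HD') /mid_m.
have T10 : T1 != 0 by rewrite -(r3_t1 HD); exact: twist_neq0.
have kk (w : 'rV[K]_g) : cross T1^-1 (cross T1 w z) z = w by exact: crossK.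
have hm : ((u1 < m) = true /\ (v1 < m) = false) \/ ((u1 < m) = false /\ (v1 < m) = true).
  by case/orP: mo => /andP[h1 h2]; [left | right]; rewrite ?h1 ?h2 ?(lt_gtF h1) ?(lt_gtF h2).
have hn : [/\ (u2 < n) = true, (n < u2) = false & (n < v2) = true] \/
    [/\ (u2 < n) = false, (n < u2) = true & (n < v2) = false].
  by case/orP: no => /andP[k1 k2]; [left | right]; rewrite ?k1 ?k2 ?(lt_gtF k1) ?(lt_gtF k2).
case: hm => -[e1 e2]; case: hn => -[e3 e4 e5]; rewrite e1 e2 e4 e5; move: T2E; rewrite e1 e3 /= => ->.
- by rewrite [RHS]crossD.
- by rewrite [LHS]crossD kk.
- by rewrite [RHS]crossD kk.
- by rewrite [LHS]crossD.
Qed.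

Lemma r3_transfer D D' o1 u1 o2 u2 p1 v1 p2 v2 : local_change S D D' ->
  r3_data D o1 u1 o2 u2 -> r3_data D' p1 v1 p2 v2 ->
  (u1 < m < v1) || (v1 < m < u1) -> (u2 < n < v2) || (v2 < n < u2) ->
  T2 = (if (u1 < m) == (u2 < n) then T1 else T1^-1) ->
  transfer D D' (~` S) id id.
Proof.
move=> lc HD HD' mo no T2E g Rel h HR Hh; have cr := cong_refl HR.
have [L1 [L2 L3]] := r3_laurent HD.
have [_ top] := r3_top_color HD HR Hh; have [_ mid] := r3_m_color HD HR Hh.
have bot := r3_bot_color HD HR Hh.
pose mm := mid_m (h c) (h a) v1.
have Lh t : mx_in is_laurent (h t) by exact: (col_in Hh).
have Lmm : mx_in is_laurent mm.
  by rewrite /mm -(mid_val HD'); apply: strand_val_laurent; first [exact: Lh | exact: L1 | exact: (subring1 HL)].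
apply: (transfer_strands sys lc HR Hh (st := fun i => if i is Some i' then
    if i' then mid_strand (h c) (h a) v1 else bot_strand (h e) mm (h a) v2
  else const_strand b (h a))).
- move=> [[|]|]; [exact: cr | | exact: cr].
  by rewrite /bot_strand; case: ifP => _; exact: cr.
- move=> [[|]|] /=.
  + by rewrite (mid_out HD').
  + by rewrite -(bot_out_eq _ _ _ HD HD' mo no T2E).
  + by rewrite const_out.
- move=> [[|]|] x.
  + by apply: strand_val_laurent; first [exact: Lh | exact: L1 | exact: (subring1 HL)].
  + rewrite /bot_strand; case: ifP => _; apply: strand_val_laurent;
      first [exact: L2 | exact: L3 | exact: Lmm | exact: Lh].
  + by apply: strand_val_laurent; first [exact: Lh | exact: (subring1 HL)].
- move=> h' hh'.
  have ha t : a <= t <= b -> h' t = h a.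
    by move=> ta; rewrite (hh' None t t ta (same_param_refl _)) const_val //; case/andP: ta.
  have hm : h' m = mm by rewrite (hh' (Some true) m m mc (same_param_refl _)) (mid_val HD').
  move=> [[|]|].
  + by apply: (follows_mid HD'); rewrite (ha _ (r3_o1 HD')); exact: cr.
  + by apply: (follows_bot HD'); [rewrite hm | rewrite (ha _ (r3_o2 HD'))]; exact: cr.
  + exact: const_follows ab' (r3_top HD').
Qed.

Lemma r3_minors D D' o1 u1 o2 u2 p1 v1 p2 v2 : local_change S D D' ->
  r3_data D o1 u1 o2 u2 -> r3_data D' p1 v1 p2 v2 ->
  (u1 < m < v1) || (v1 < m < u1) -> (u2 < n < v2) || (v2 < n < u2) ->
  T2 = (if (u1 < m) == (u2 < n) then T1 else T1^-1) ->
  minors_ideal D = minors_ideal D'.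
Proof.
move=> lc HD HD' mo no T2E.
have T12 := r3_transfer lc HD HD' mo no T2E.
have T21 : transfer D' D (~` S) id id.
  apply: r3_transfer (local_change_sym lc) HD' HD _ _ _; rewrite 1?orbC // T2E.
  (* Both orders are reversed between the diagrams, so whether they agree does not change. *)
  have flip (w w' k : R) : (w < k < w') || (w' < k < w) -> (w < k) = ~~ (w' < k).
    by case/orP => /andP[h1 h2]; rewrite h1 (lt_gtF h2).
  by rewrite (flip _ _ _ mo) (flip _ _ _ no) eqb_negLR negbK.
by apply/seteqP; split; [exact: (transfer_minors T12 T21 (r3_determined HD'))
  | exact: (transfer_minors T21 T12 (r3_determined HD))].
Qed.

End R3.

(** * Geometry of the Reidemeister moves *)

Section Signs.
Variable R : realType.

Lemma leftof_ex2 (t : R) P Q : leftof t P -> leftof t Q -> exists2 s, s < t & P s /\ Q s.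
Proof. by move=> h1 h2; apply/leftof_ex/(leftof_and h1 h2) => s _; split. Qed.

Lemma rightof_ex2 (t : R) P Q : rightof t P -> rightof t Q -> exists2 s, t < s & P s /\ Q s.
Proof. by move=> h1 h2; apply/rightof_ex/(rightof_and h1 h2) => s _; split. Qed.

Implicit Types (h dh : R -> R) (a b t p q : R).

Lemma derive_gt0_rightof h t d : is_derive t 1 h d -> 0 < d -> rightof t (fun s => h t < h s).
Proof.
move=> [hd <-] d0.
have hn : \forall k \near (0 : R)^', 0 < k^-1 *: (h (k *: (1 : R) + t) - h t).
  by apply: (cvgr_gt _ hd).
rewrite nearE /= /dnbhs /within /= in hn; have [e /= e0 he] := iffLR (nbhs_ballP _ _) hn.
exists e => // s /andP[s1 s2].
have := he (s - t); rewrite /ball /= sub0r normrN.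
rewrite gtr0_norm; last lra.
have -> : (s - t) *: (1 : R) + t = s by rewrite /GRing.scale /= mulr1 subrK.
move=> hh; have : 0 < (s - t)^-1 *: (h s - h t) by apply: hh; [lra | rewrite subr_eq0; lra].
by rewrite pmulr_rgt0 ?invr_gt0; lra.
Qed.

Lemma derive_lt0_leftof h t d : is_derive t 1 h d -> d < 0 -> leftof t (fun s => h t < h s).
Proof.
move=> hd d0; have hN : is_derive t 1 (- h) (- d) by exact: is_deriveN.
have d0' : 0 < - d by lra.
apply: leftof_imp (derive_gt0_leftof hN d0') _ => s _.
by rewrite /GRing.opp /=; lra.
Qed.

Lemma derive_lt0_rightof h t d : is_derive t 1 h d -> d < 0 -> rightof t (fun s => h s < h t).
Proof.
move=> hd d0; have hN : is_derive t 1 (- h) (- d) by exact: is_deriveN.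
have d0' : 0 < - d by lra.
apply: rightof_imp (derive_gt0_rightof hN d0') _ => s _.
by rewrite /GRing.opp /=; lra.
Qed.

(** Valid at the end points too: a nonzero derivative would show on whichever side of [t] lies in
    the interval. *)
Lemma derive_const0 h c d t r : c < d -> c <= t <= d -> is_derive t 1 h r ->
  (forall s, c <= s <= d -> h s = 0) -> r = 0.
Proof.
move=> cd ctd hr h0.
have key (k : R -> R) (e : R) : is_derive t 1 k e -> (forall s, c <= s <= d -> k s = 0) -> e <= 0.
  move=> hk k0; rewrite leNgt; apply/negP => e0; have kt : k t = 0 by exact: k0.
  have [ct|tc] := ltP c t.
    have [s st [/= h1 h2]] := leftof_ex2 (leftof_gt ct) (derive_gt0_leftof hk e0).
    by move: h2; rewrite kt k0; lra.
  have td : t < d by lra.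
  have [s st [/= h1 h2]] := rightof_ex2 (rightof_lt td) (derive_gt0_rightof hk e0).
  by move: h2; rewrite kt k0; lra.
have r1 : r <= 0 by exact: key hr h0.
have r2 : - r <= 0.
  by apply: (key _ _ (is_deriveN hr)) => s /h0 e; rewrite /GRing.opp /= e oppr0.
by lra.
Qed.

Variables (h dh : R -> R).
Hypothesis hd : forall t, is_derive t 1 h (dh t).

Let hc : continuous h. Proof. by move=> t; exact: is_derive_continuous (hd t). Qed.

(** A positive derivative at [p] would make h negative just before [p], and h would have an earlier
    zero. *)
Lemma pos_before a b p : a <= p <= b -> 0 < h a ->
  (forall x, a <= x < p -> h x != 0) -> h p = 0 -> dh p != 0 -> dh p < 0.
Proof.
move=> ap ha nz hp dp; rewrite lt_neqAle dp /= leNgt; apply/negP => d0.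
have ap' : a < p by rewrite lt_neqAle; case/andP: ap => -> _; rewrite andbT; apply: contraTneq ha => ->; lra.
have [s sp [/= s1 s2]] := leftof_ex2 (leftof_gt ap') (derive_gt0_leftof (hd p) d0).
have [|c cs hc0] := IVT0 hc (ltW s1).
  by apply/orP; right; rewrite ltW //= ; lra.
by have := nz c; rewrite hc0 eqxx => /(_ _)/negP; apply => //; lra.
Qed.

Lemma pos_after a b p : a <= p <= b -> 0 < h b ->
  (forall x, p < x <= b -> h x != 0) -> h p = 0 -> dh p != 0 -> 0 < dh p.
Proof.
move=> ap hb nz hp dp; rewrite lt_neqAle eq_sym dp /= leNgt; apply/negP => d0.
have pb : p < b by rewrite lt_neqAle; case/andP: ap => _ ->; rewrite andbT; apply: contraTneq hb => <-; lra.
have [s sp [/= s1 s2]] := rightof_ex2 (rightof_lt pb) (derive_lt0_rightof (hd p) d0).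
have [|c cs hc0] := IVT0 hc (ltW s1).
  by apply/orP; left; rewrite [0 <= _]ltW // andbT; lra.
by have := nz c; rewrite hc0 eqxx => /(_ _)/negP; apply => //; lra.
Qed.

Lemma leftof_neg c : h c < 0 -> leftof c (fun s => h s < 0).
Proof.
move=> h0; have : \forall s \near c, h s < 0 by have hcc : h @ c --> h c := @hc c; apply: (cvgr_lt _ hcc).
by move=> /nbhs_ballP [e /= e0 he]; exists e => // s sc; apply: he; rewrite /ball /= ltr_norml; lra.
Qed.

Lemma rightof_neg c : h c < 0 -> rightof c (fun s => h s < 0).
Proof.
move=> h0; have : \forall s \near c, h s < 0 by have hcc : h @ c --> h c := @hc c; apply: (cvgr_lt _ hcc).
by move=> /nbhs_ballP [e /= e0 he]; exists e => // s sc; apply: he; rewrite /ball /= ltr_norml; lra.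
Qed.

End Signs.

Lemma sq_le_between (R : realType) (x y : R) : y * y <= x * x ->
  (x - y <= 0 <= - x - y) || (- x - y <= 0 <= x - y).
Proof.
move=> yx; have [x0|x0] := lerP 0 x; apply/orP; [right | left];
  by apply/andP; split; rewrite leNgt; apply/negP => h; nra.
Qed.

Section Curves.
Variables (R : realType) (D : diagram R).

(* Opaque definitions, because comparing the terms they stand for by
   conversion is very slow. *)
Lemma cx_sig : {f : R -> R | forall t, f t = (curve D t).1}.
Proof. by exists (fun t => (curve D t).1). Qed.

Lemma cy_sig : {f : R -> R | forall t, f t = (curve D t).2}.
Proof. by exists (fun t => (curve D t).2). Qed.

Lemma dx_sig : {f : R -> R | forall t, f t = (derive1 (curve D) t).1}.
Proof. by exists (fun t => (derive1 (curve D) t).1). Qed.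

Lemma dy_sig : {f : R -> R | forall t, f t = (derive1 (curve D) t).2}.
Proof. by exists (fun t => (derive1 (curve D) t).2). Qed.

Definition cx := sval cx_sig.
Definition cy := sval cy_sig.
Definition dx := sval dx_sig.
Definition dy := sval dy_sig.

Lemma cxE : cx = fun t => (curve D t).1.
Proof. by apply/funext; exact: (svalP cx_sig). Qed.

Lemma cyE : cy = fun t => (curve D t).2.
Proof. by apply/funext; exact: (svalP cy_sig). Qed.

Lemma dxE : dx = fun t => (derive1 (curve D) t).1.
Proof. by apply/funext; exact: (svalP dx_sig). Qed.

Lemma dyE : dy = fun t => (derive1 (curve D) t).2.
Proof. by apply/funext; exact: (svalP dy_sig). Qed.

Lemma cx_derive (t : R) : is_derive t 1 cx (dx t).
Proof. by rewrite cxE dxE; exact: (is_derive_fst (@curve_derivable _ D t)). Qed.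

Lemma cy_derive (t : R) : is_derive t 1 cy (dy t).
Proof. by rewrite cyE dyE; exact: (is_derive_snd (@curve_derivable _ D t)). Qed.

Lemma lin_derive (u v : R) (t : R) : is_derive t 1 (fun t => u * cx t + v * cy t) (u * dx t + v * dy t).
Proof.
have h1 := is_deriveZ u (cx_derive t); have h2 := is_deriveZ v (cy_derive t).
exact: is_deriveD.
Qed.

Lemma sq_derive (t : R) : is_derive t 1 (fun t => cx t * cx t + cy t * cy t - 1)
  (cx t * dx t + cx t * dx t + (cy t * dy t + cy t * dy t)).
Proof.
have h1 := is_deriveM (cx_derive t) (cx_derive t).
have h2 := is_deriveM (cy_derive t) (cy_derive t).
have h3 := is_deriveD h1 h2.
have h4 := is_deriveB h3 (is_derive_cst (1 : R) t (1 : R)).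
by rewrite subr0 in h4.
Qed.

Lemma dx_continuous : continuous dx.
Proof.
move=> t; have c := @curve_C1 _ D t; rewrite dxE.
by apply: (cvg_comp _ _ c); exact: cvg_fst.
Qed.

Lemma positiveE s t : positive D (s, t) = (0 < dx s * dy t - dy s * dx t).
Proof. by rewrite dxE dyE. Qed.

Lemma transverseE s t : curve D s = curve D t -> ~~ same_param s t ->
  dx s * dy t - dy s * dx t != 0.
Proof. by rewrite dxE dyE; exact: curve_transverse. Qed.

Lemma immersedE t : dx t = 0 -> dy t = 0 -> False.
Proof.
rewrite dxE dyE => hx hy; have := curve_immersed D t.
by rewrite -pair_eqE /pair_eq /= hx hy eqxx.
Qed.

Lemma curveE t : curve D t = (cx t, cy t).
Proof. by rewrite cxE cyE; exact: surjective_pairing. Qed.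

Section Diameter.
Variables (c d sl : R).
Hypotheses (cd : c < d) (line : forall t, c <= t <= d -> cy t = sl * cx t).
Hypothesis disc : forall t, c <= t <= d -> cx t * cx t + cy t * cy t <= 1.
Hypotheses (out_c : leftof c (fun t => 1 < cx t * cx t + cy t * cy t))
  (out_d : rightof d (fun t => 1 < cx t * cx t + cy t * cy t)).

Lemma diameter_slope t : c <= t <= d -> dy t = sl * dx t.
Proof.
move=> ct; have h := lin_derive sl (-1) t.
have : sl * dx t + -1 * dy t = 0.
  by apply: (derive_const0 cd ct h) => s /line ->; lra.
by lra.
Qed.

Lemma diameter_dx t : c <= t <= d -> dx t != 0.
Proof.
move=> ct; apply/negP => /eqP h; have := diameter_slope ct; rewrite h mulr0.
exact: immersedE.
Qed.

Lemma diameter_sign s t : c <= s <= d -> c <= t <= d -> (0 < dx s) = (0 < dx t).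
Proof.
have key u v : c <= u <= d -> c <= v <= d -> u <= v -> (0 < dx u) = (0 < dx v).
  move=> hu hv uv; have nz := diameter_dx.
  have nI : ~ ((dx u <= 0 <= dx v) || (dx v <= 0 <= dx u)).
    move=> /(IVT0 dx_continuous uv) [w wuv w0].
    by have := nz w; rewrite w0 eqxx => /(_ _)/negP; apply => //; lra.
  case: (ltP 0 (dx u)) => h1; case: (ltP 0 (dx v)) => h2 //; exfalso; apply: nI.
    by apply/orP; right; rewrite h2 ltW.
  by apply/orP; left; rewrite h1 ltW.
move=> hs ht; have [st|ts] := leP s t; first exact: key.
exact: (esym (key t s ht hs (ltW ts))).
Qed.

Let sqc : cx c * cx c + cy c * cy c = 1.
Proof.
have h1 : c <= c <= d by have := cd; lra.
apply/eqP; rewrite eq_le disc //= leNgt; apply/negP => h.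
have hn : cx c * cx c + cy c * cy c - 1 < 0 by lra.
have [s _ [/= p q]] := leftof_ex2 out_c (leftof_neg sq_derive hn).
by lra.
Qed.

Let sqd : cx d * cx d + cy d * cy d = 1.
Proof.
have h1 : c <= d <= d by have := cd; lra.
apply/eqP; rewrite eq_le disc //= leNgt; apply/negP => h.
have hn : cx d * cx d + cy d * cy d - 1 < 0 by lra.
have [s _ [/= p q]] := rightof_ex2 out_d (rightof_neg sq_derive hn).
by lra.
Qed.

(** The ends lie on the circle and on the line, and they differ because [dx] never vanishes; so they
    are opposite, and everything between them is attained. Hence whatever meets the diameter in the
    disc meets this strand. *)
Lemma diameter_onto z : z.2 = sl * z.1 -> z.1 * z.1 + z.2 * z.2 <= 1 ->
  exists2 t, c <= t <= d & curve D t = z.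
Proof.
move=> zl zd; have hc : c <= c <= d by have := cd; lra.
have hd : c <= d <= d by have := cd; lra.
have ec := sqc; have ed := sqd; rewrite (line hc) in ec; rewrite (line hd) in ed.
have xc2 : cx c * cx c = cx d * cx d.
  have : (cx c * cx c - cx d * cx d) * (1 + sl * sl) = 0 by lra.
  move=> /eqP; rewrite mulf_eq0 => /orP[/eqP|/eqP]; [lra|].
  have := sqr_ge0 sl; rewrite expr2; lra.
have xcd : cx c != cx d.
  have [t tcd e] := derive_MVT cx_derive cd; apply/negP => /eqP h.
  have : dx t * (d - c) = 0 by rewrite -e h subrr.
  move=> /eqP; rewrite mulf_eq0 => /orP[|/eqP]; last by have := cd; lra.
  by apply/negP/diameter_dx; lra.
have xdE : cx d = - cx c.
  have : (cx c - cx d) * (cx c + cx d) = 0 by lra.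
  by move=> /eqP; rewrite mulf_eq0 subr_eq0 (negPf xcd) /= => /eqP; lra.
have zx : z.1 * z.1 <= cx c * cx c.
  have h : z.1 * z.1 * (1 + sl * sl) <= cx c * cx c * (1 + sl * sl) by rewrite zl in zd; lra.
  have p : 0 < 1 + sl * sl by have := sqr_ge0 sl; rewrite expr2; lra.
  by rewrite -(ler_pM2r p).
have cc : continuous (fun t => cx t - z.1).
  by move=> t; apply: cvgB; [exact: is_derive_continuous (cx_derive t) | exact: cvg_cst].
have [|t tcd e] := IVT0 cc (ltW cd).
  by rewrite xdE; exact: sq_le_between.
exists t; first exact: tcd.
have e1 : cx t = z.1 by lra.
have e2 : cy t = z.2 by rewrite line // e1 zl.
by rewrite curveE e1 e2 -surjective_pairing.
Qed.

Lemma diameter_lt s t : c <= s <= d -> c <= t <= d -> s < t -> (cx s < cx t) = (0 < dx c).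
Proof.
move=> hs ht st; have [w ws e] := derive_MVT cx_derive st.
have hc : c <= c <= d by have := cd; lra.
have hw : c <= w <= d by lra.
rewrite -(diameter_sign hw hc) -subr_gt0 e pmulr_lgt0 //; lra.
Qed.

End Diameter.

End Curves.

Local Notation sqnorm D t := (cx D t * cx D t + cy D t * cy D t).

Section Twist.
Variables (R : realType) (D : diagram R).

Definition unit_twist (b : bool) : K := if b then (tofrac 'X)^-1 else tofrac 'X.

Lemma twist_unit c : twist D c = unit_twist (positive D c). Proof. by []. Qed.

Lemma unit_twistN b : unit_twist (~~ b) = (unit_twist b)^-1.
Proof. by case: b; rewrite /= ?invrK. Qed.

End Twist.

Section Rep.
Variable R : realType.

Lemma rep_mem (a b t : R) : a < b < a + 1 -> arc a b t -> a <= rep a t <= b.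
Proof.
move=> ab h; have ba : b < a + 1 by lra.
by case/andP: (rep_itv a t) => -> _ /=; exact/(arcP _ ba).
Qed.

Lemma unit_disc_coord (D : diagram R) t :
  unit_disc (curve D t) <-> sqnorm D t <= 1.
Proof. by rewrite /unit_disc /= !expr2 cxE cyE. Qed.

End Rep.

Section Reidemeister1.
Variables (R : realType) (D1 D2 : diagram R).

Lemma reidemeister1_minors : reidemeister1 D1 D2 -> minors_ideal D1 = minors_ideal D2.
Proof.
case=> a [b [v [u [ab lc on1 on2]]]].
have [Sv vu] : arc a b v /\ classical D1 v u by case: on1 => h _; apply: (h (v, u)); rewrite inE.
have Su : arc a b u.
  by case: lc => SE _ _ _; apply/SE; rewrite -(classical_curve vu); apply/SE.
have va := rep_mem ab Sv; have ua := rep_mem ab Su.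
apply: (@r1_minors _ D1 D2 a b (rep a v) (rep a u) ab lc va ua).
- move=> x xab ux; have [c] := crossings_on_under on1 (arc_mem xab) ux.
  rewrite inE => /eqP -> /= xu; symmetry; apply: rep_eq; last by lra.
  by rewrite same_param_sym.
- by rewrite (classical_same D1 (rep_same a v) (rep_same a u)).
- by move=> x xab; apply/negP => ux; have [c] := crossings_on_under on2 (arc_mem xab) ux.
Qed.

End Reidemeister1.

Section Discs.
Variables (R : realType) (I : finType) (a b : I -> R) (S : set R) (D1 D2 : diagram R).
Hypotheses (sys : arc_system a b S) (lc : local_change S D1 D2).

Lemma arc_out i : leftof (a i) (fun t => 1 < sqnorm D1 t) /\
  rightof (b i) (fun t => 1 < sqnorm D1 t).
Proof.
have [l r] := system_end_germs sys i; case: lc => SE _ _ _.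
have key s : ~ S s -> 1 < sqnorm D1 s.
  by move=> ns; rewrite ltNge; apply/negP => /unit_disc_coord /SE.
by split; [apply: leftof_imp l _ | apply: rightof_imp r _] => s _; exact: key.
Qed.

Lemma arc_derive1 i x : (forall t, arc (a i) (b i) t -> curve D1 t = curve D2 t) ->
  a i <= x <= b i -> derive1 (curve D1) x = derive1 (curve D2) x.
Proof.
move=> h xi; have [l r] := system_end_germs sys i; case: lc => _ _ out _.
apply: derive1_germ; first by apply/h/arc_mem.
  have [ax|xa] := ltP (a i) x.
    by apply: leftof_imp (leftof_gt ax) _ => s sx ay; apply/h/arc_mem; lra.
  have -> : x = a i by lra.
  by apply: leftof_imp l _ => s _; exact: out.
have [xb|bx] := ltP x (b i).
  by apply: rightof_imp (rightof_lt xb) _ => s sx ay; apply/h/arc_mem; lra.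
have -> : x = b i by lra.
by apply: rightof_imp r _ => s _; exact: out.
Qed.

End Discs.

Section Closure.
Variables (R : realType) (D1 D2 : diagram R).

(** A local change controls the curves only outside the arcs; this extends the agreement to the end
    points of the arcs. *)
Lemma curve_eq_closure (t : R) :
  (forall e, 0 < e -> exists2 s, t - e < s < t + e & curve D1 s = curve D2 s) ->
  curve D1 t = curve D2 t.
Proof.
move=> h.
have key (h1 h2 : R -> R) d1 d2 : is_derive t 1 h1 d1 -> is_derive t 1 h2 d2 ->
    (forall e, 0 < e -> exists2 s, t - e < s < t + e & h1 s = h2 s) -> h1 t = h2 t.
  move=> hd1 hd2 he; apply/eqP; rewrite -subr_eq0; apply/negP => /negP ne.
  pose k s := (h1 s - h2 s) ^+ 2.
  have ck : k @ t --> k t.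
    have c1 := is_derive_continuous hd1; have c2 := is_derive_continuous hd2.
    by apply: cvgM; apply: cvgB.
  have k0 : 0 < k t by rewrite exprn_even_gt0.
  have : \forall s \near t, 0 < k s by apply: (cvgr_gt _ ck).
  move=> /nbhs_ballP [r /= r0 hr]; have [s st e1] := he r r0.
  have := hr s; rewrite /ball /= /k e1 subrr expr0n /= ltxx => hF.
  by suff : false by []; apply: hF; rewrite ltr_norml; lra.
rewrite (curveE D1) (curveE D2); congr (_, _).
  apply: (key _ _ _ _ (cx_derive D1 t) (cx_derive D2 t)) => e /h [s st].
  by rewrite (curveE D1) (curveE D2) => -[]; exists s.
apply: (key _ _ _ _ (cy_derive D1 t) (cy_derive D2 t)) => e /h [s st].
by rewrite (curveE D1) (curveE D2) => -[]; exists s.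
Qed.

Lemma curve_eq_left (t : R) : leftof t (fun s => curve D1 s = curve D2 s) ->
  curve D1 t = curve D2 t.
Proof.
move=> h; apply: curve_eq_closure => e e0.
have te : t - e < t by lra.
by have [s st [p q]] := leftof_ex2 (leftof_gt te) h; exists s; [lra | ].
Qed.

Lemma curve_eq_right (t : R) : rightof t (fun s => curve D1 s = curve D2 s) ->
  curve D1 t = curve D2 t.
Proof.
move=> h; apply: curve_eq_closure => e e0.
have te : t < t + e by lra.
by have [s st [p q]] := rightof_ex2 (rightof_lt te) h; exists s; [lra | ].
Qed.

End Closure.

Lemma ends_eq (R : realType) (I : finType) (a b : I -> R) (S : set R) (D1 D2 : diagram R) i :
  arc_system a b S -> local_change S D1 D2 ->
  curve D1 (a i) = curve D2 (a i) /\ curve D1 (b i) = curve D2 (b i).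
Proof.
move=> sys [_ _ out _]; have [l r] := system_end_germs sys i; split.
  by apply: curve_eq_left; apply: leftof_imp l _ => s _; exact: out.
by apply: curve_eq_right; apply: rightof_imp r _ => s _; exact: out.
Qed.

Lemma crossings_on_same (R : realType) (D : diagram R) S (l l' : seq (R * R)) :
  (forall s t, same_param s t -> S s -> S t) ->
  (forall c, c \in l' -> exists2 c0, c0 \in l & same_param c.1 c0.1 && same_param c.2 c0.2) ->
  (forall c0, c0 \in l -> exists2 c, c \in l' & same_param c.1 c0.1 && same_param c.2 c0.2) ->
  crossings_on D S l -> crossings_on D S l'.
Proof.
move=> Sp ll' l'l [h1 h2]; split.
  move=> c /ll' [c0 /h1 [S0 cl0] /andP[e1 e2]].
  by rewrite (classical_same D e1 e2); split=> //; apply: Sp S0; rewrite same_param_sym.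
move=> s t Ss e; have [st|[c0 /l'l [c cl /andP[e1 e2]] h]] := h2 s t Ss e; first by left.
by right; exists c => //; rewrite !(same_param_r _ e1) !(same_param_r _ e2).
Qed.

Section Reidemeister2.
Variables (R : realType) (D1 D2 : diagram R) (a b c d : R).
Let upper := arc a b.
Let lower := arc c d.
Let S := upper `|` lower.
Hypotheses (ab : a < b < a + 1) (cd : c < d < c + 1) (dj : upper `&` lower = set0).
Hypothesis lc : local_change S D1 D2.
Hypothesis low : forall t, lower t -> curve D1 t = curve D2 t /\ (curve D1 t).2 = 0.
Hypothesis up2 : forall t, upper t -> 0 < (curve D2 t).2.

Let sys := arc_system2 ab cd dj.
Let ab' : a < b. Proof. by case/andP: ab. Qed.
Let cd' : c < d. Proof. by case/andP: cd. Qed.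

Let disj t : upper t -> ~ lower t.
Proof. by move=> h h'; have : (upper `&` lower) t by []; rewrite dj. Qed.

Let line t : c <= t <= d -> cy D1 t = 0 * cx D1 t.
Proof. by move=> /arc_mem /low [_]; rewrite curveE mul0r. Qed.

Let disc t : c <= t <= d -> sqnorm D1 t <= 1.
Proof.
by move=> ct; apply/unit_disc_coord; case: lc => SE _ _ _; apply/SE; right; exact: arc_mem.
Qed.

Let out_c := (arc_out sys lc false).1.
Let out_d := (arc_out sys lc false).2.

(** In [D2] the whole upper strand is above the diameter, and the two diagrams agree at its ends. *)
Let ends : 0 < cy D1 a /\ 0 < cy D1 b.
Proof.
have [/= e1 e2] := ends_eq true sys lc.
have h1 : upper a by apply: arc_mem; have := ab'; lra.
have h2 : upper b by apply: arc_mem; have := ab'; lra.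
by have := up2 h1; have := up2 h2; rewrite -e1 -e2 !curveE.
Qed.

(** The upper strand begins and ends above the line of the lower one and meets it only at p and q,
    so it descends through the first point and rises through the second, while the lower strand
    keeps its direction. *)
Lemma r2_signs p q u w : a <= p <= b -> a <= q <= b -> c <= u <= d -> c <= w <= d -> p < q ->
  classical D1 p u -> classical D1 q w ->
  crossings_on D1 S [:: (p, u); (q, w)] ->
  positive D1 (p, u) = (0 < dx D1 c) /\ positive D1 (q, w) = ~~ (0 < dx D1 c).
Proof.
move=> pa qa uc wc pq pu qw [_ on].
have hc : c <= c <= d by have := cd'; lra.
have dyu t : c <= t <= d -> dy D1 t = 0.
  by move=> tc; rewrite (diameter_slope cd' line tc) mul0r.
have low0 t : c <= t <= d -> cy D1 t = 0 by move=> /line; rewrite mul0r.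
have cr s t : a <= s <= b -> c <= t <= d -> classical D1 s t -> cy D1 s = 0 /\ dy D1 s != 0.
  move=> sa tc st; have e := classical_curve st; split.
    by move: e; rewrite !curveE => -[_ ->]; exact: low0.
  have := transverseE e (classical_neq st); rewrite (dyu t tc) mulr0 sub0r oppr_eq0 mulf_eq0.
  by rewrite negb_or => /andP[].
have [p0 dp] := cr p u pa uc pu; have [q0 dq] := cr q w qa wc qw.
have zero x : a <= x <= b -> cy D1 x = 0 -> x = p \/ x = q.
  move=> xa x0; have Ux : upper x by exact: arc_mem.
  have xd : sqnorm D1 x <= 1.
    by apply/unit_disc_coord; case: lc => SE _ _ _; apply/SE; left.
  (* A zero of [cy] on the upper strand is a point of the diameter, which the lower strand covers,
     so it is one of the listed crossings. *)
  have [t tc tx] : exists2 t, c <= t <= d & curve D1 t = curve D1 x.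
    apply: (diameter_onto cd' line disc out_c out_d); rewrite curveE /= ?mul0r //.
  have Lt : lower t by exact: arc_mem.
  have ax y : upper y -> a <= y <= b -> same_param x y -> x = y.
    by move=> _ ya xy; apply: same_param_eq => //; rewrite ltr_norml; have := ab; lra.
  have [xt|[z]] := on x t (or_introl Ux) (esym tx).
    by case: (disj Ux); apply: arc_same Lt; rewrite same_param_sym.
  rewrite !inE => /orP[] /eqP -> /= /orP[] /andP[h1 h2].
  - by left; apply: ax h1 => //; exact: arc_mem.
  - by case: (disj Ux); apply: (arc_same (s := u)); [rewrite same_param_sym | exact: arc_mem].
  - by right; apply: ax h1 => //; exact: arc_mem.
  - by case: (disj Ux); apply: (arc_same (s := w)); [rewrite same_param_sym | exact: arc_mem].
have [Ya Yb] := ends.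
have np : dy D1 p < 0.
  apply: (pos_before (cy_derive D1) pa Ya _ p0 dp) => x xap; apply/negP => /eqP x0.
  by have [||] := zero x _ x0; lra.
have nq : 0 < dy D1 q.
  apply: (pos_after (cy_derive D1) qa Yb _ q0 dq) => x xap; apply/negP => /eqP x0.
  by have [||] := zero x _ x0; lra.
have sgn t : c <= t <= d -> (0 < dx D1 t) = (0 < dx D1 c).
  by move=> tc; exact: (diameter_sign cd' line tc hc).
have nz t (tc : c <= t <= d) := diameter_dx cd' line tc.
split.
  rewrite positiveE (dyu u uc) mulr0 sub0r -mulNr pmulr_rgt0 ?sgn //; lra.
rewrite positiveE (dyu w wc) mulr0 sub0r -mulrN pmulr_rgt0 // oppr_gt0 -(sgn w wc).
by rewrite lt_neqAle nz //= leNgt.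
Qed.

End Reidemeister2.

Lemma reidemeister2_minors (R : realType) (D1 D2 : diagram R) :
  reidemeister2 D1 D2 -> minors_ideal D1 = minors_ideal D2.
Proof.
case=> a [b [c [d [v1 [u1 [v2 [u2 [[ab cd dj] lc low up2 [[U1 L1] [U2 L2] n12 on1 on2]]]]]]]]].
have sys := arc_system2 ab cd dj; have Sp := system_same sys.
have disj t : arc a b t -> ~ arc c d t.
  by move=> h h'; have : (arc a b `&` arc c d) t by []; rewrite dj.
pose p1 := rep a v1; pose p2 := rep a v2; pose w1 := rep c u1; pose w2 := rep c u2.
have p1a : a <= p1 <= b := rep_mem ab U1; have p2a : a <= p2 <= b := rep_mem ab U2.
have w1c : c <= w1 <= d := rep_mem cd L1; have w2c : c <= w2 <= d := rep_mem cd L2.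
have sp1 := rep_same a v1; have sp2 := rep_same a v2.
have sw1 := rep_same c u1; have sw2 := rep_same c u2.
have on1' : crossings_on D1 (arc a b `|` arc c d) [:: (p1, w1); (p2, w2)].
  apply: crossings_on_same Sp _ _ on1 => z.
    rewrite !inE => /orP[] /eqP ->; [exists (v1, u1) | exists (v2, u2)];
      by rewrite ?inE ?eqxx ?orbT // ?sp1 ?sp2 ?sw1 ?sw2.
  rewrite !inE => /orP[] /eqP ->; [exists (p1, w1) | exists (p2, w2)];
    by rewrite ?inE ?eqxx ?orbT // ?sp1 ?sp2 ?sw1 ?sw2.
have on1'' : crossings_on D1 (arc a b `|` arc c d) [:: (p2, w2); (p1, w1)].
  by apply: crossings_on_same Sp _ _ on1' => z; rewrite !inE orbC => hz; exists z;
    rewrite ?inE // !same_param_refl.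
have cl1 : classical D1 p1 w1 by apply: (crossings_on_classical (c := (p1, w1)) on1'); rewrite !inE eqxx.
have cl2 : classical D1 p2 w2 by apply: (crossings_on_classical (c := (p2, w2)) on1'); rewrite !inE eqxx orbT.
have p12 : p1 != p2.
  apply: contra n12 => /eqP e; rewrite -(same_param_l sp1) -/p1 e; exact: sp2.
(* Otherwise p1, p2 and w2 would be three parameters of one point. *)
have w12 : w1 != w2.
  apply/negP => /eqP e; have := curve_no_triple (s := p1) (t := w1) (u := p2).
  move=> /(_ D1 (classical_curve cl1)); rewrite e (classical_curve cl2) => /(_ erefl).
  have l2 : arc c d w2 by exact: arc_mem.
  have nu p : a <= p <= b -> ~~ same_param p w2.
    by move=> /arc_mem pa; apply/negP => pw; exact: (disj _ (arc_same pw pa) l2).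
  rewrite (negPf (nu _ p1a)) same_param_sym (negPf (nu _ p2a)) /=.
  by rewrite (same_param_l sp1) (same_param_r _ sp2) (negPf n12).
have neg : positive D1 (p2, w2) = ~~ positive D1 (p1, w1).
  have sg := @r2_signs _ D1 D2 a b c d ab cd dj lc low up2.
  case: (ltgtP p1 p2) p12 => // [lt|gt] _.
    by have [-> ->] := sg p1 p2 w1 w2 p1a p2a w1c w2c lt cl1 cl2 on1'.
  by have [-> ->] := sg p2 p1 w2 w1 p2a p1a w2c w1c gt cl2 cl1 on1''; rewrite negbK.
have un x : c <= x <= d -> under D1 x -> x = w1 \/ x = w2.
  move=> xc ux; have [z] := crossings_on_under on1' (or_intror (arc_mem xc)) ux.
  have e y : c <= y <= d -> same_param x y -> x = y.
    by move=> yc xy; apply: same_param_eq => //; rewrite ltr_norml; lra.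
  by rewrite !inE => /orP[] /eqP -> /= h; [left | right]; apply: e.
have up1 : along0 D1 a b.
  move=> x xa; apply/negP => ux; have [z] := crossings_on_under on1' (or_introl (arc_mem xa)) ux.
  have e y : c <= y <= d -> same_param x y -> False.
    by move=> /arc_mem yc xy; apply: (disj x (arc_mem xa)); apply: arc_same yc; rewrite same_param_sym.
  by rewrite !inE => /orP[] /eqP -> /=; apply: e.
have none x : (arc a b `|` arc c d) x -> ~~ under D2 x.
  by move=> Sx; apply/negP => ux; have [z] := crossings_on_under on2 Sx ux.
have upD2 : along0 D2 a b by move=> x /arc_mem xa; apply: none; left.
have lowD2 : along0 D2 c d by move=> x /arc_mem xa; apply: none; right.
(* The crossings are listed in no particular order; [r2_minors] wants them in their order along the
   lower strand. *)
case: (ltgtP w1 w2) w12 => // [lt|gt] _.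
  have h1 : c <= w1 < w2 by lra.
  have h2 : w2 <= d by lra.
  apply: (@r2_minors _ D1 D2 a b c d ab cd dj lc w1 w2 p1 p2) => //.
  by rewrite !twist_unit neg unit_twistN.
have h1 : c <= w2 < w1 by lra.
have h2 : w1 <= d by lra.
apply: (@r2_minors _ D1 D2 a b c d ab cd dj lc w2 w1 p2 p1) => //.
  by rewrite !twist_unit neg unit_twistN invrK.
by move=> x xc /(un x xc) [|]; [right | left].
Qed.

Lemma pos_oppr (R : realType) (x : R) : x != 0 -> (0 < - x) = ~~ (0 < x).
Proof. by move=> x0; rewrite oppr_gt0 -leNgt lt_neqAle x0. Qed.

Section R3Strand.
Variables (R : realType) (D : diagram R) (a b c d s v u m : R).
Hypotheses (cd : c < d) (line : forall t, c <= t <= d -> cy D t = s * cx D t).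
Hypothesis disc : forall t, c <= t <= d -> sqnorm D t <= 1.
Hypotheses (out_c : leftof c (fun t => 1 < sqnorm D t))
  (out_d : rightof d (fun t => 1 < sqnorm D t)).
Hypotheses (s1 : s = 1 \/ s = -1) (va : a <= v <= b) (uc : c <= u <= d) (mc : c <= m <= d).
Hypotheses (m0 : cy D m = 0) (vu : curve D v = curve D u) (nvu : ~~ same_param v u)
  (u0 : cy D u != 0).
Hypothesis uniq_v : forall x, a <= x <= b -> (exists2 t, c <= t <= d & curve D t = curve D x) -> x = v.
Hypothesis disc_top : forall x, a <= x <= b -> sqnorm D x <= 1.
Hypothesis hb : `|cy D b| < cx D b.

Let hc : c <= c <= d. Proof. by have := cd; lra. Qed.

Let ss : s * s = 1. Proof. by case: s1 => ->; lra. Qed.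

Let sgn t : c <= t <= d -> (0 < dx D t) = (0 < dx D c).
Proof. by move=> tc; exact: (diameter_sign cd line tc hc). Qed.

Let nz t : c <= t <= d -> dx D t != 0.
Proof. by move=> tc; exact: (diameter_dx cd line tc). Qed.

Let sgns t : c <= t <= d -> (0 < s * dx D t) = (0 < s * dx D c).
Proof.
move=> tc; case: s1 => ->; first by rewrite !mul1r sgn.
by rewrite !mulN1r !pos_oppr ?nz // sgn.
Qed.

(** On the top strand x - s y vanishes only at [v], and it is positive at the right end, where |y| <
    x. Hence it increases at [v]: the top strand crosses the diameter in the same direction whether
    it passes above or below the center. *)
Let strand_sign : positive D (v, u) = (0 < s * dx D m).
Proof.
rewrite (sgns mc) -(sgns uc) positiveE (diameter_slope cd line uc).
have e : dx D v * (s * dx D u) - dy D v * dx D u = s * dx D u * (1 * dx D v + - s * dy D v).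
  have -> : dy D v * dx D u = s * s * (dy D v * dx D u) by rewrite ss mul1r.
  by ring.
have dg : 0 < 1 * dx D v + - s * dy D v.
  apply: (pos_after (h := fun t => 1 * cx D t + - s * cy D t)
    (dh := fun t => 1 * dx D t + - s * dy D t) (lin_derive D 1 (- s)) va).
  - move: hb; rewrite ltr_norml => /andP[]; case: s1 => ->; lra.
  - move=> x xv; apply/eqP => x0; have xa : a <= x <= b by have := va; lra.
    have : x = v; last by lra.
    apply: uniq_v => //; apply: (diameter_onto cd line disc out_c out_d).
      rewrite curveE /=; have -> : cx D x = s * cy D x by lra.
      by rewrite mulrA ss mul1r.
    by rewrite curveE /=; exact: disc_top.
  - have := vu; rewrite !curveE => -[-> ->]; rewrite (line uc) mulNr mulrA ss; lra.
  - have := transverseE vu nvu; rewrite (diameter_slope cd line uc) e.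
    by rewrite mulf_eq0 negb_or => /andP[].
by rewrite e pmulr_lgt0.
Qed.

Let strand_neq : u != m.
Proof. by apply: contra u0 => /eqP ->; rewrite m0. Qed.

(** The strand is at the origin at [m], with vertical velocity [s * dx D m] there, and never turns
    back. So it reaches [u] after [m] exactly when it moves towards the half-plane of [u]. *)
Let strand_order : (m < u) = ((0 < cy D u) == (0 < s * dx D m)).
Proof.
have xm : cx D m = 0.
  have := line mc; rewrite m0 => e; have : s * (s * cx D m) = 0 by rewrite -e mulr0.
  by rewrite mulrA ss mul1r.
have xu0 : cx D u != 0 by apply: contra u0 => /eqP h; rewrite (line uc) h mulr0.
have key : (m < u) = ((0 < cx D u) == (0 < dx D c)).
  have [lt|gt|e] := ltgtP m u; last by have := strand_neq; rewrite e eqxx.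
    by have := diameter_lt cd line mc uc lt; rewrite xm => ->; rewrite eqxx.
  have := diameter_lt cd line uc mc gt; rewrite xm => <-.
  by rewrite -oppr_gt0 pos_oppr //; case: (0 < cx D u).
rewrite key (sgns mc) (line uc); case: s1 => ->; first by rewrite !mul1r.
by rewrite !mulN1r !pos_oppr ?nz // eqb_negLR negbK.
Qed.

Lemma strand_facts : [/\ positive D (v, u) = (0 < s * dx D m), u != m &
  (m < u) = ((0 < cy D u) == (0 < s * dx D m))].
Proof. by split. Qed.

End R3Strand.

Section R3Geometry.
Variables (R : realType) (D : diagram R) (a b c d e f sg : R).
Let top := arc a b.
Let mid := arc c d.
Let bot := arc e f.
Let S := top `|` mid `|` bot.
Hypotheses (ab : a < b < a + 1) (cd : c < d < c + 1) (ef : e < f < e + 1).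
Hypotheses (dj1 : top `&` mid = set0) (dj2 : top `&` bot = set0) (dj3 : mid `&` bot = set0).
Hypothesis SE : forall t, unit_disc (curve D t) <-> S t.
Hypothesis sg1 : sg = 1 \/ sg = -1.
Hypotheses (mid_line : forall t, mid t -> cy D t = sg * cx D t)
  (bot_line : forall t, bot t -> cy D t = - sg * cx D t).
Hypothesis hb : `|cy D b| < cx D b.
Variables (m n v1 u1 v2 u2 : R).
Hypotheses (mc : c <= m <= d) (ne : e <= n <= f) (v1a : a <= v1 <= b) (u1c : c <= u1 <= d)
  (v2a : a <= v2 <= b) (u2e : e <= u2 <= f).
Hypothesis on : crossings_on D S [:: (m, n); (v1, u1); (v2, u2)].
Hypotheses (y1 : cy D u1 != 0) (y2 : cy D u2 != 0).

Let sys := arc_system3 ab cd ef dj1 dj2 dj3.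

Let no (A B : set R) t : A `&` B = set0 -> A t -> B t -> False.
Proof. by move=> AB At Bt; have : (A `&` B) t by []; rewrite AB. Qed.

Let out i := system_end_germs sys i.

Let outside t : ~ S t -> 1 < sqnorm D t.
Proof. by move=> nS; rewrite ltNge; apply/negP => /unit_disc_coord /SE. Qed.

Let inside t : S t -> sqnorm D t <= 1.
Proof. by move=> St; apply/unit_disc_coord/SE. Qed.

Let topS x : a <= x <= b -> S x. Proof. by move=> /arc_mem h; left; left. Qed.
Let midS x : c <= x <= d -> S x. Proof. by move=> /arc_mem h; left; right. Qed.
Let botS x : e <= x <= f -> S x. Proof. by move=> /arc_mem h; right. Qed.

Let apart (x y a1 b1 a2 b2 : R) : arc a1 b1 `&` arc a2 b2 = set0 ->
  a1 <= x <= b1 -> a2 <= y <= b2 -> same_param x y -> False.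
Proof. by move=> dj /arc_mem xa /arc_mem yb xy; apply: (no dj (arc_same xy xa) yb). Qed.

Let inj (x y a1 b1 : R) : a1 < b1 < a1 + 1 -> a1 <= x <= b1 -> a1 <= y <= b1 ->
  same_param x y -> x = y.
Proof. by move=> h hx hy xy; apply: same_param_eq => //; rewrite ltr_norml; lra. Qed.

Let clas p : p \in [:: (m, n); (v1, u1); (v2, u2)] -> classical D p.1 p.2.
Proof. exact: (crossings_on_classical on). Qed.

Let c3 : classical D m n. Proof. by apply: (clas (p := (m, n))); rewrite !inE eqxx. Qed.
Let c1 : classical D v1 u1. Proof. by apply: (clas (p := (v1, u1))); rewrite !inE eqxx orbT. Qed.
Let c2 : classical D v2 u2. Proof. by apply: (clas (p := (v2, u2))); rewrite !inE eqxx !orbT. Qed.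

Let mn0 : cy D m = 0 /\ cy D n = 0.
Proof.
have := classical_curve c3; rewrite !curveE => -[ex ey].
have h1 := mid_line (arc_mem mc); have h2 := bot_line (arc_mem ne).
by case: sg1 h1 h2 => ->; lra.
Qed.

Let meet x t : a <= x <= b -> S t -> curve D t = curve D x ->
  [\/ same_param x t, same_param x v1 /\ same_param t u1 | same_param x v2 /\ same_param t u2].
Proof.
move=> xa St tx; case: on => _ /(_ x t (topS xa) (esym tx)) [h|[z]]; first by constructor 1.
rewrite !inE => /or3P[] /eqP -> /= /orP[] /andP[h1 h2].
- by case: (apart dj1 xa mc h1).
- by case: (apart dj2 xa ne h1).
- by constructor 2.
- by case: (apart dj1 xa u1c h1).
- by constructor 3.
- by case: (apart dj2 xa u2e h1).
Qed.

Let mid_facts : [/\ positive D (v1, u1) = (0 < sg * dx D m), u1 != m &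
  (m < u1) = ((0 < cy D u1) == (0 < sg * dx D m))].
Proof.
have cd' : c < d by case/andP: cd.
have line t : c <= t <= d -> cy D t = sg * cx D t by move=> /arc_mem /mid_line.
have disc t : c <= t <= d -> sqnorm D t <= 1 by move=> /midS /inside.
have oc : leftof c (fun t => 1 < sqnorm D t).
  by apply: leftof_imp (out (Some true)).1 _ => s _; exact: outside.
have od : rightof d (fun t => 1 < sqnorm D t).
  by apply: rightof_imp (out (Some true)).2 _ => s _; exact: outside.
have un x : a <= x <= b -> (exists2 t, c <= t <= d & curve D t = curve D x) -> x = v1.
  move=> xa [t tc tx]; have [h|[h _]|[_ h]] := meet xa (midS tc) tx.
  - by case: (apart dj1 xa tc h).
  - exact: (inj ab xa v1a h).
  - by case: (apart dj3 tc u2e h).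
have [m0 _] := mn0; have dt x (xa : a <= x <= b) := inside (topS xa).
exact: (strand_facts cd' line disc oc od sg1 v1a u1c mc m0 (classical_curve c1)
  (classical_neq c1) y1 un dt hb).
Qed.

Let bot_facts : [/\ positive D (v2, u2) = (0 < - sg * dx D n), u2 != n &
  (n < u2) = ((0 < cy D u2) == (0 < - sg * dx D n))].
Proof.
have ef' : e < f by case/andP: ef.
have line t : e <= t <= f -> cy D t = - sg * cx D t by move=> /arc_mem /bot_line.
have disc t : e <= t <= f -> sqnorm D t <= 1 by move=> /botS /inside.
have oc : leftof e (fun t => 1 < sqnorm D t).
  by apply: leftof_imp (out (Some false)).1 _ => s _; exact: outside.
have od : rightof f (fun t => 1 < sqnorm D t).
  by apply: rightof_imp (out (Some false)).2 _ => s _; exact: outside.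
have un x : a <= x <= b -> (exists2 t, e <= t <= f & curve D t = curve D x) -> x = v2.
  move=> xa [t tc tx]; have [h|[_ h]|[h _]] := meet xa (botS tc) tx.
  - by case: (apart dj2 xa tc h).
  - by case: (apart dj3 u1c tc); rewrite same_param_sym.
  - exact: (inj ab xa v2a h).
have [_ n0] := mn0; have dt x (xa : a <= x <= b) := inside (topS xa).
have sgN : - sg = 1 \/ - sg = -1 by case: sg1 => ->; [right | left; rewrite opprK].
exact: (strand_facts ef' line disc oc od sgN v2a u2e ne n0 (classical_curve c2)
  (classical_neq c2) y2 un dt hb).
Qed.

(** The twists with the top strand are expressed by the directions of the diameters, which are
    common to the two diagrams of the move; both can thus share the same T1 and T2. *)
Lemma r3_geometry :
  [/\ (m < u1) = ((0 < cy D u1) == (0 < sg * dx D m)),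
      (n < u2) = ((0 < cy D u2) == (0 < - sg * dx D n)) &
      r3_data a b c d e f m n (unit_twist (0 < sg * dx D m)) (unit_twist (0 < - sg * dx D n))
        (twist D (m, n)) D v1 u1 v2 u2].
Proof.
have [p1 n1 o1] := mid_facts; have [p2 n2 o2] := bot_facts; split=> //.
have un x : S x -> under D x -> [\/ same_param x n, same_param x u1 | same_param x u2].
  move=> Sx /(crossings_on_under on Sx) [z]; rewrite !inE.
  by case/or3P => /eqP -> h; [constructor 1 | constructor 2 | constructor 3].
split=> //.
- by rewrite twist_unit p1.
- by rewrite twist_unit p2.
- move=> x xa; apply/negP => /(un x (topS xa)) [h|h|h].
  + exact: (apart dj2 xa ne h).
  + exact: (apart dj1 xa u1c h).
  + exact: (apart dj2 xa u2e h).
- move=> x xc /(un x (midS xc)) [h|h|h].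
  + by case: (apart dj3 xc ne h).
  + exact: (inj cd xc u1c h).
  + by case: (apart dj3 xc u2e h).
- move=> x xe /(un x (botS xe)) [h|h|h].
  + by left; exact: (inj ef xe ne h).
  + by case: (apart dj3 u1c xe); rewrite same_param_sym.
  + by right; exact: (inj ef xe u2e h).
Qed.

End R3Geometry.

Lemma reidemeister3_minors (R : realType) (D1 D2 : diagram R) :
  reidemeister3 D1 D2 -> minors_ideal D1 = minors_ideal D2.
Proof.
case=> a [b [c [d [e [f [sigma [v1 [u1 [v2 [u2 [p1 [w1 [p2 [w2 [m [n]]]]]]]]]]]]]]]].
move=> [[[ab cd ef] [dj1 dj2 dj3]] lc [mid bot ha hb] [[Mm Bn] [T1 M1 T2 B2] [T1' M1' T2' B2']]
  [on1 [y1 y2] on2 [y1' y2']]].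
set sg : R := (-1) ^+ sigma in mid bot.
have sg1 : sg = 1 \/ sg = -1 by rewrite /sg; case: (sigma); [right | left]; rewrite ?expr1 ?expr0.
have sys := arc_system3 ab cd ef dj1 dj2 dj3; have Sp := system_same sys.
have [SE1 SE2 _ _] := lc.
have [_ eb] := ends_eq None sys lc.
have midc t : arc c d t -> cy D1 t = sg * cx D1 t /\ cy D2 t = sg * cx D2 t.
  by move=> /mid; rewrite !curveE /= => -[[-> ->] ->].
have botc t : arc e f t -> cy D1 t = - sg * cx D1 t /\ cy D2 t = - sg * cx D2 t.
  by move=> /bot; rewrite !curveE /= => -[[-> ->] ->].
(* The diameters are parts of both diagrams, so their velocities at the center agree. *)
have mE : derive1 (curve D1) (rep c m) = derive1 (curve D2) (rep c m).
  apply: (arc_derive1 sys lc (i := Some true)); last exact: rep_mem.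
  by move=> t /mid [].
have nE : derive1 (curve D1) (rep e n) = derive1 (curve D2) (rep e n).
  apply: (arc_derive1 sys lc (i := Some false)); last exact: rep_mem.
  by move=> t /bot [].
have conv D o i o' i' : crossings_on D (arc a b `|` arc c d `|` arc e f) [:: (m, n); (o, i); (o', i')] ->
    crossings_on D (arc a b `|` arc c d `|` arc e f)
      [:: (rep c m, rep e n); (rep a o, rep c i); (rep a o', rep e i')].
  apply: crossings_on_same Sp _ _ => z; rewrite !inE => /or3P[] /eqP ->.
  - by exists (m, n); rewrite ?inE ?eqxx ?orbT //= !rep_same.
  - by exists (o, i); rewrite ?inE ?eqxx ?orbT //= !rep_same.
  - by exists (o', i'); rewrite ?inE ?eqxx ?orbT //= !rep_same.
  - by exists (rep c m, rep e n); rewrite ?inE ?eqxx ?orbT //= !rep_same.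
  - by exists (rep a o, rep c i); rewrite ?inE ?eqxx ?orbT //= !rep_same.
  - by exists (rep a o', rep e i'); rewrite ?inE ?eqxx ?orbT //= !rep_same.
have cyu D o i (k : R) : classical D o i -> cy D (rep k i) = (curve D o).2.
  by move=> oi; rewrite (classical_curve oi) -(curve_same D (rep_same k i)) curveE.
have c11 : classical D1 v1 u1 by apply: (crossings_on_classical (c := (v1, u1)) on1); rewrite !inE eqxx orbT.
have c12 : classical D1 v2 u2 by apply: (crossings_on_classical (c := (v2, u2)) on1); rewrite !inE eqxx !orbT.
have c21 : classical D2 p1 w1 by apply: (crossings_on_classical (c := (p1, w1)) on2); rewrite !inE eqxx orbT.
have c22 : classical D2 p2 w2 by apply: (crossings_on_classical (c := (p2, w2)) on2); rewrite !inE eqxx !orbT.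
have Y1 := cyu _ _ _ c c11; have Y2 := cyu _ _ _ e c12.
have Y1' := cyu _ _ _ c c21; have Y2' := cyu _ _ _ e c22.
rewrite -Y1 in y1; rewrite -Y2 in y2; rewrite -Y1' in y1'; rewrite -Y2' in y2'.
have hb1 : `|cy D1 b| < cx D1 b by rewrite curveE in hb.
have hb2 : `|cy D2 b| < cx D2 b by move: hb; rewrite eb curveE.
have mc := rep_mem cd Mm; have ne := rep_mem ef Bn.
have [i1 i2 r1] := r3_geometry ab cd ef dj1 dj2 dj3 SE1 sg1 (fun t h => (midc t h).1)
  (fun t h => (botc t h).1) hb1 mc ne (rep_mem ab T1) (rep_mem cd M1) (rep_mem ab T2)
  (rep_mem ef B2) (conv _ _ _ _ _ on1) (lt0r_neq0 y1) (lt0r_neq0 y2).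
have [i1' i2' r2] := r3_geometry ab cd ef dj1 dj2 dj3 SE2 sg1 (fun t h => (midc t h).2)
  (fun t h => (botc t h).2) hb2 mc ne (rep_mem ab T1') (rep_mem cd M1') (rep_mem ab T2')
  (rep_mem ef B2') (conv _ _ _ _ _ on2) (ltr0_neq0 y1') (ltr0_neq0 y2').
have dm : dx D1 (rep c m) = dx D2 (rep c m) by rewrite !dxE mE.
have dn : dx D1 (rep e n) = dx D2 (rep e n) by rewrite !dxE nE.
have dm' : dy D1 (rep c m) = dy D2 (rep c m) by rewrite !dyE mE.
have dn' : dy D1 (rep e n) = dy D2 (rep e n) by rewrite !dyE nE.
have tw : twist D2 (rep c m, rep e n) = twist D1 (rep c m, rep e n).
  by rewrite !twist_unit !positiveE dm dn dm' dn'.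
rewrite -dm -dn tw in r2; rewrite -dm in i1'; rewrite -dn in i2'.
rewrite y1 in i1; rewrite y2 in i2.
rewrite (lt_gtF y1') in i1'; rewrite (lt_gtF y2') in i2'.
have nm := r3_m r1; have nm' := r3_m r2; have nn := r3_n r1; have nn' := r3_n r2.
(* The top strand meets the diameter above the center in [D1] and below it in [D2], hence at
   parameters on different sides of that of the center. *)
have opp (x y z : R) (P : bool) : x != y -> z != y -> (y < x) = (true == P) -> (y < z) = (false == P) ->
    (x < y < z) || (z < y < x).
  move=> xy zy h1 h2; case: P h1 h2 => h1 h2.
    by rewrite h1 orbC andbT ltNge le_eqVlt h2 eq_sym (negPf zy).
  by rewrite h2 andbT ltNge le_eqVlt h1 eq_sym (negPf xy).
apply: (r3_minors ab cd ef dj1 dj2 dj3 mc ne lc r1 r2).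
- exact: opp nm nm' i1 i1'.
- exact: opp nn nn' i2 i2'.
have flip (x y : R) (P : bool) : x != y -> (y < x) = (true == P) -> (x < y) = ~~ P.
  by move=> xy h; rewrite ltNge le_eqVlt h eq_sym (negPf xy).
rewrite (flip _ _ _ nm i1) (flip _ _ _ nn i2) eqb_negLR negbK -unit_twistN.
by case: (0 < sg * _); case: (0 < - sg * _).
Qed.

Lemma move_minors (R : realType) (D1 D2 : diagram R) : Defs.move D1 D2 ->
  minors_ideal D1 = minors_ideal D2.
Proof.
case=> [||| [|]].
- exact: isotopy_minors.
- exact: detour_minors.
- exact: reidemeister1_minors.
- exact: reidemeister2_minors.
- exact: reidemeister3_minors.
Qed.

Lemma equivalent_minors (R : realType) (D1 D2 : diagram R) : equivalent D1 D2 ->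
  minors_ideal D1 = minors_ideal D2.
Proof.
elim=> [D D' /move_minors //|D //|D D' _ -> //|D D' D'' _ -> _ -> //].
Qed.

(** * Periodic diagrams *)

Section Rotation.
Variables (R : realType) (q : nat).
Hypothesis q0 : (0 < q)%N.
Let theta : R := 2 * pi / q%:R.

Lemma rotation_iter j (z : R * R) : iter j (rotation q) z =
  (cos (theta *+ j) * z.1 - sin (theta *+ j) * z.2, sin (theta *+ j) * z.1 + cos (theta *+ j) * z.2).
Proof.
elim: j => [|j IH]; first by rewrite /= mulr0n cos0 sin0 !mul1r !mul0r subr0 add0r -surjective_pairing.
rewrite iterS IH /rotation -/theta mulrS cosD sinD /=; congr (_, _); ring.
Qed.

Let q_neq0 : q%:R != 0 :> R. Proof. by rewrite pnatr_eq0 -lt0n. Qed.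

Lemma rotation_iter_q (z : R * R) : iter q (rotation q) z = z.
Proof.
have -> : iter q (rotation q) z = (cos (theta *+ q) * z.1 - sin (theta *+ q) * z.2,
    sin (theta *+ q) * z.1 + cos (theta *+ q) * z.2) by exact: rotation_iter.
have -> : theta *+ q = pi *+ 2 by rewrite -mulr_natr divfK // mulr_natl.
by rewrite cos2pi sin2pi !mul1r !mul0r subr0 add0r -surjective_pairing.
Qed.

(** A nonzero fixed point would force cos t = 1, where t is the angle of the j-th iterate; but 0 < t
    / 2 < pi gives sin (t / 2) > 0, hence cos t < 1. *)
Lemma rotation_iter_free j (z : R * R) : (0 < j < q)%N -> z != 0 -> iter j (rotation q) z != z.
Proof.
move=> /andP[j0 jq]; apply: contra => /eqP; rewrite rotation_iter.
set t := theta *+ j; case: z => x y /= [ex ey].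
have c1 : cos t < 1.
  have tE : t = (t / 2) *+ 2 by rewrite -mulr_natr divfK // pnatr_eq0.
  have th : t / 2 = pi * (j%:R / q%:R).
    by rewrite /t /theta -mulr_natr; field; exact: q_neq0.
  have s0 : 0 < sin (t / 2).
    apply: sin_gt0_pi; rewrite th mulr_gt0 ?pi_gt0 ?divr_gt0 ?ltr0n //=.
    by rewrite gtr_pMr ?pi_gt0 // ltr_pdivrMr ?ltr0n // mul1r ltr_nat.
  rewrite tE cos_mulr2n; have := cos2Dsin2 (t / 2); nra.
have h : (1 - cos t) * (x * x + y * y) = 0.
  have e1 : (1 - cos t) * x = - (sin t * y) by lra.
  have e2 : (1 - cos t) * y = sin t * x by lra.
  by rewrite mulrDr !mulrA e1 e2; ring.
have xy : x * x + y * y = 0.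
  by move/eqP: h; rewrite mulf_eq0 => /orP[/eqP|/eqP]; lra.
have := sqr_ge0 x; have := sqr_ge0 y; rewrite !expr2 => yy xx.
have /eqP : x * x = 0 by lra.
rewrite mulf_eq0 orbb => /eqP x0; have /eqP : y * y = 0 by lra.
by rewrite mulf_eq0 orbb x0 => /eqP ->.
Qed.

Lemma rotation_positive (D : diagram R) phi v u : carries (rotation q) phi D D ->
  classical D v u -> positive D (phi v, phi u) = positive D (v, u).
Proof.
move=> Hc; pose J (w : R * R) := (cos theta * w.1 - sin theta * w.2, sin theta * w.1 + cos theta * w.2).
apply: (carries_positive Hc (J := fun _ => J)).
  move=> _ w w'; exists 1; first exact: ltr01.
  rewrite /det2 /J /= mul1r; have := cos2Dsin2 theta; rewrite !expr2 => cs.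
  rewrite -[RHS]mul1r -cs; ring.
move=> t; have [Hphi e _] := Hc.
have ce : rotation q \o curve D = curve D \o phi by apply/funext => s /=; rewrite e.
apply: derive1_pair.
- rewrite ce; apply/derivable1_diffP; apply: differentiable_comp.
    by apply/derivable1_diffP; case: Hphi.
  by apply/derivable1_diffP/curve_derivable.
- have -> : (fun s => ((rotation q \o curve D) s).1) = fun s => cos theta * cx D s + - sin theta * cy D s.
    by apply/funext => s /=; rewrite curveE /= mulNr.
  by have := lin_derive D (cos theta) (- sin theta) t; rewrite dxE dyE /= -mulNr.
- have -> : (fun s => ((rotation q \o curve D) s).2) = fun s => sin theta * cx D s + cos theta * cy D s.
    by apply/funext => s /=; rewrite curveE.
  by have := lin_derive D (sin theta) (cos theta) t; rewrite dxE dyE.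
Qed.

End Rotation.

(** The hypotheses say that c has order q in Z/n. It then generates the multiples of n / q, one of
    which is n / Q; the factor [j] comes from a Bezout relation. *)
Lemma order_shift (c n q Q : nat) : (0 < n)%N -> (1 < q)%N -> (n %| q * c)%N ->
  (forall j, (0 < j < q)%N -> ~~ (n %| j * c)%N) -> (Q %| q)%N ->
  exists j, n = (Q * (n %/ Q))%N /\ (j * c = n %/ Q %[mod n])%N.
Proof.
move=> n0 q1 nq nj Qq.
have c0 : (0 < c)%N by rewrite lt0n; apply: contra (nj 1%N _) => // /eqP ->; rewrite muln0 dvdn0.
pose d := gcdn c n; have d0 : (0 < d)%N by rewrite gcdn_gt0 c0.
have nd : n = (n %/ d * d)%N by rewrite divnK // dvdn_gcdr.
have cd : c = (c %/ d * d)%N by rewrite divnK // dvdn_gcdl.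
have ndc : (n %| n %/ d * c)%N by rewrite [X in (X %| _)%N]nd cd mulnA mulnAC dvdn_mulr.
have cop : coprime (n %/ d) (c %/ d).
  rewrite /coprime -(eqn_pmul2r d0) mul1n muln_gcdl -nd -cd gcdnC.
  by rewrite eqxx.
have dq : (n %/ d %| q)%N.
  rewrite -(Gauss_dvdl _ cop) -(dvdn_pmul2r d0) -nd -mulnA -cd //.
have qE : (n %/ d = q)%N.
  apply/eqP; rewrite eqn_leq (dvdn_leq _ dq) ?(ltnW q1) //= leqNgt; apply/negP => lt.
  have := nj (n %/ d)%N; rewrite ndc lt andbT divn_gt0 // => /(_ (dvdn_leq n0 (dvdn_gcdr _ _))).
  by [].
have Q0 : (0 < Q)%N by apply: dvdn_gt0 Qq; exact: ltnW.
have nE : n = (q * d)%N by rewrite -qE.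
have nQ : (n %/ Q = q %/ Q * d)%N by rewrite nE -divn_mulAC.
case: (egcdnP n c0) => km kn e _; exists (km * (q %/ Q))%N; split.
  by rewrite nQ mulnA [(Q * _)%N]mulnC divnK.
rewrite mulnAC e mulnDl nQ -/d [(d * _)%N]mulnC -mulnA [(n * _)%N]mulnC mulnA.
by rewrite modnMDl.
Qed.

Section Period.
Variables (R : realType) (D : diagram R) (q : nat) (phi : R -> R).
Hypotheses (q1 : (1 < q)%N) (D0 : forall t, curve D t != 0) (Hc : carries (rotation q) phi D D).
Let n := num_crossings D.
Hypothesis n0 : (0 < n)%N.

Let Hphi : reparametrization phi. Proof. by case: Hc. Qed.

Let under_phi t : under D (phi t) = under D t.
Proof.
case: Hc => _ _ cl; have [psi [K1 K2 _]] := reparam_inv Hphi.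
apply/idP/idP => /under_classical [v vt]; last by apply: (@classical_under _ _ (phi v)); rewrite cl.
by apply: (@classical_under _ _ (psi v)); rewrite -cl K2.
Qed.

(** The rotation preserves undercrossings, so the labels of t and of [phi t] jump together and their
    difference modulo n is constant along the curve. *)
Lemma label_shift : exists c, forall t, label D (phi t) = ((label D t + c) %% n)%N.
Proof.
have [psi [K1 K2 lt]] := reparam_inv Hphi.
have lt' : forall s t, s < t -> phi s < phi t by exact: reparam_lt.
have l0 : (label D 0%R < n)%N by exact: label_lt.
(* The difference of the two labels modulo n, written so that the subtraction of natural numbers
   does not truncate. *)
pose c := (label D (phi 0%R) + (n - label D 0%R))%N; exists c.
have c0 : label D (phi 0%R) = ((label D 0%R + c) %% n)%N.
  rewrite /c addnCA subnKC ?modnDr ?modn_small //; [exact: label_lt | exact: ltnW].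
have main t : 0 <= t <= 1 -> label D (phi t) = ((label D t + c) %% n)%N.
  move: t; apply: (@real_induction _ (fun t => label D (phi t) = ((label D t + c) %% n)%N)) => //.
  - move=> t _ ht; have [u|nu] := boolP (under D t).
      have u' : under D (phi t) by rewrite under_phi.
      apply: rightof_and (rightof_comp K1 K2 lt' lt (label_rightof_under u')) (label_rightof_under u) _.
      by move=> s _ /= -> ->; rewrite ht -[in LHS]addn1 -[in RHS]addn1 !modnDml addnAC.
    have nu' : ~~ under D (phi t) by rewrite under_phi.
    apply: rightof_and (rightof_comp K1 K2 lt' lt (label_rightof nu')) (label_rightof nu) _.
    by move=> s _ /= -> ->.
  - move=> t /andP[t0 _] h.
    have [s st [/= e1 [e2 e3]]] := leftof_ex2 (leftof_gt t0)
      (leftof_and (leftof_comp K1 K2 lt' lt (label_leftof D (phi t))) (label_leftof D t)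
        (S := fun s => label D (phi s) = label D (phi t) /\ label D s = label D t)
        (fun _ _ p p' => conj p p')).
    by rewrite -e2 -e3; apply: h; rewrite st ltW.
move=> t; have ft := frac_same t.
rewrite -(label_same D ft) -main; last by have := frac_itv t; lra.
by apply: label_same; rewrite (reparam_same Hphi) same_param_sym.
Qed.

Let curve_iter j t : curve D (iter j phi t) = iter j (rotation q) (curve D t).
Proof. by elim: j => // j IH; rewrite !iterS; case: Hc => _ -> _; rewrite IH. Qed.

Let under_iter j t : under D (iter j phi t) = under D t.
Proof. by elim: j => // j IH; rewrite iterS under_phi. Qed.

(** Only one of the two parameters of a crossing is its under-parameter, and a third parameter would
    make a triple point. *)
Lemma curve_under_inj s t : curve D s = curve D t -> under D s -> under D t -> same_param s t.
Proof.
move=> e us /under_classical [v vt].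
have := curve_no_triple e (esym (classical_curve vt)).
rewrite [same_param t v]same_param_sym (negPf (classical_neq vt)) /= => /orP[//|sv].
have uv : under D v by rewrite -(under_same D sv).
have [w wv] := under_classical uv.
have := curve_no_triple (classical_curve wv) (classical_curve vt).
rewrite (negPf (classical_neq wv)) (negPf (classical_neq vt)) /= => wt.
by have := classical_asym vt; rewrite -(classical_same D wt (same_param_refl v)) wv.
Qed.

Section Shift.
Variable c : nat.
Hypothesis cE : forall t, label D (phi t) = ((label D t + c) %% n)%N.

Let label_iter j t : label D (iter j phi t) = ((label D t + j * c) %% n)%N.
Proof.
elim: j => [|j IH]; first by rewrite addn0 modn_small // label_lt.
by rewrite iterS cE IH modnDml mulSn -addnA [(j * c + c)%N]addnC.
Qed.

(** If n divides j c, the j-th iterate sends the undercrossing at [t0] to one with the same label,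
    hence to itself. Its point is then fixed by that rotation, which cannot happen away from the
    origin for 0 < j < q. *)
Lemma shift_order : (n %| q * c)%N /\ (forall j, (0 < j < q)%N -> ~~ (n %| j * c)%N).
Proof.
pose t0 := (crossing D 0).2.
have u0 : under D t0 by apply: classical_under (crossing_classical n0).
have l0 : label D t0 = 0%N by exact: label_crossing.
have q0 : (0 < q)%N by exact: ltnW.
split.
  have := label_iter q t0; rewrite l0 add0n => h; rewrite /dvdn -h -l0; apply/eqP.
  apply: label_same; apply: curve_under_inj; rewrite ?under_iter //.
  by rewrite curve_iter rotation_iter_q.
move=> j jq; apply/negP => /eqP h; have := label_iter j t0; rewrite l0 add0n h => lj.
have uj : under D (iter j phi t0) by rewrite under_iter.
have [_] := under_crossing uj; rewrite lj => /(curve_same D) e0; move: e0; rewrite curve_iter => e.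
by have := rotation_iter_free q0 jq (D0 t0); rewrite e eqxx.
Qed.

Let pairE c' : positive D c' = positive D (c'.1, c'.2).
Proof. by case: c'. Qed.

Lemma crossing_shift k i : (i < n)%N ->
  positive D (crossing D ((i + k * c) %% n)%N) = positive D (crossing D i) /\
  label D (crossing D ((i + k * c) %% n)%N).1 = ((label D (crossing D i).1 + k * c) %% n)%N.
Proof.
move=> iN; elim: k => [|k [IH1 IH2]].
  by rewrite !addn0 !modn_small // label_lt.
set i' := ((i + k * c) %% n)%N in IH1 IH2; have i'N : (i' < n)%N by rewrite ltn_mod.
have -> : ((i + k.+1 * c) %% n = (i' + c) %% n)%N.
  by rewrite modnDml mulSn -addnA [(k * c + c)%N]addnC.
have cl := crossing_classical i'N; case: (Hc) => _ _ clE.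
have cl' : classical D (phi (crossing D i').1) (phi (crossing D i').2) by rewrite clE.
set i'' := ((i' + c) %% n)%N.
have i''E : label D (phi (crossing D i').2) = i'' by rewrite cE (label_crossing i'N).
have [_] := classical_crossing cl'; rewrite i''E => s2 s1; split.
  rewrite -IH1.
  rewrite (pairE (crossing D i'')) (pairE (crossing D i')).
  have dE s t : same_param s t -> dx D s = dx D t /\ dy D s = dy D t.
    move=> st; have e := curve'_same D st; rewrite dxE dyE.
    by split; [exact: (congr1 fst e) | exact: (congr1 snd e)].
  have [x1 y1] := dE _ _ s1; have [x2 y2] := dE _ _ s2.
  by rewrite -(rotation_positive Hc cl) !positiveE x1 y1 x2 y2.
rewrite -(label_same D s1) cE IH2 modnDml mulSn -addnA [(k * c + c)%N]addnC //.
Qed.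

End Shift.

(** The entries of the Alexander matrix multiplied by X, which makes them polynomials; [s] is X
    times the twist. *)
Definition alexander_entry i j : {poly int} :=
  let s := if positive D (crossing D i) then 1 else 'X^2 in
  s *+ (j == i)%N - 'X *+ (j == i.+1 %% n)%N + ('X - s) *+ (j == label D (crossing D i).1)%N.

Lemma alexander_entryE :
  alexander_matrix D = \matrix_(i < n, j < n) (X^-1 * tofrac (alexander_entry i j)).
Proof.
apply/matrixP => i j; rewrite !mxE /alexander_entry /twist /=.
have lE : arc_index D (crossing D i).1 = label D (crossing D i).1.
  rewrite /label frac_id //.
  by have /crossings_range /andP[] : crossing D i \in classical_crossings D by rewrite mem_nth.
rewrite lE tofracD tofracB !tofracMn tofracB mulrDr mulrBr !mulrnAr mulrBr mulVf ?X_neq0 //.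
have -> : X^-1 * tofrac (if positive D (crossing D i) then 1 else 'X^2) =
    (if positive D (crossing D i) then X^-1 else X).
  case: positive; first by rewrite tofrac1 mulr1.
  by rewrite tofracXn expr2 mulKf // X_neq0.
by [].
Qed.

Lemma alexander_entry_row i : (i < n)%N -> \sum_(j < n) alexander_entry i j = 0.
Proof.
move=> iN; rewrite /alexander_entry big_split sumrB /=.
have pick (x : {poly int}) k : (k < n)%N -> \sum_(j < n) x *+ (j == k :> nat)%N = x.
  move=> kn; rewrite (bigD1 (Ordinal kn)) //= eqxx big1 ?addr0 ?mulr1n // => j.
  by rewrite -val_eqE /= => /negPf ->.
by rewrite !pick ?ltn_mod ?label_lt //; ring.
Qed.

Lemma alexander_entry_shift Q : (Q %| q)%N -> (0 < Q)%N ->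
  n = (Q * (n %/ Q))%N /\
  forall i j, (i < n)%N -> (j < n)%N ->
    alexander_entry ((i + n %/ Q) %% n)%N ((j + n %/ Q) %% n)%N = alexander_entry i j.
Proof.
move=> Qq Q0; have [c cE] := label_shift; have [nq nj] := shift_order cE.
have [k [nE kE]] := order_shift n0 q1 nq nj Qq; split=> // i j iN jN.
set m := (n %/ Q)%N in nE kE *.
have mE x : ((x + m) %% n = (x + k * c) %% n)%N by rewrite -modnDmr -kE modnDmr.
have [h1 h2] := crossing_shift cE k iN.
have eqm x y : (x < n)%N -> (y < n)%N -> ((x + m) %% n == (y + m) %% n)%N = (x == y).
  by move=> xn yn; rewrite eqn_modDr !modn_small.
rewrite /alexander_entry mE h1 h2 -!mE (eqm j i jN iN) (eqm j _ jN (label_lt _ n0)).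
have -> : (((i + m) %% n).+1 %% n = (i.+1 %% n + m) %% n)%N.
  by rewrite -[in LHS]addn1 -[in RHS]addn1 !modnDml addnAC.
by rewrite eqm ?ltn_mod.
Qed.

End Period.

(** * From periods to the span of the Alexander polynomial *)

Lemma alexander_minorsE (R : realType) (D : diagram R) n : num_crossings D = n ->
  minors_ideal D =
  minors is_laurent (\matrix_(i < n, j < n) (X^-1 * tofrac (alexander_entry D i j))).
Proof.
move=> <-; have -> : minors_ideal D = minors is_laurent (alexander_matrix D) by [].
by rewrite alexander_entryE.
Qed.

Lemma minors0 (L : set K) (A : 'M[K]_0) : L 1 -> minors L A 1.
Proof.
move=> L1; exists (fun _ _ => 1) => //.
have card1 : #|{ffun 'I_0.-1 -> 'I_0}| = 1%N by rewrite card_ffun !card_ord expn0.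
rewrite (eq_bigr (fun _ => 1)) => [|g _]; first by rewrite sumr_const card1.
rewrite (eq_bigr (fun _ => 1)) => [|h _]; first by rewrite sumr_const card1.
by rewrite mul1r det_mx00.
Qed.

Lemma period_prime_power (R : realType) (D : diagram R) Delta q phi p s :
  (1 < q)%N -> (forall t, curve D t != 0) -> carries (rotation q) phi D D ->
  is_laurent Delta -> minors_ideal D = [set h | exists2 c, is_laurent c & h = c * Delta] ->
  prime p -> (p %| q)%N -> span_mod p Delta s -> (0 < s)%N -> (p ^ logn p q <= s.+1)%N.
Proof.
move=> q1 D0 Hc LD mD pp pq sp s0; set Q := (p ^ logn p q)%N.
(* Without crossings the ideal contains 1, so Delta is a unit and its span is 0, against [s0]. *)
have [n0|] := posnP (num_crossings D).
  have := @minors0 is_laurent (\matrix_(i < 0, j < 0) (X^-1 * tofrac (alexander_entry D i j)))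
    (subring1 is_laurent_subring).
  rewrite -(alexander_minorsE n0) mD => /(span_mod_unit pp LD) /(_ sp) s00.
  by rewrite s00 in s0.
move=> n0; have Q1 : (1 < Q)%N.
  have lq : (0 < logn p q)%N by rewrite logn_gt0 mem_primes pp (ltnW q1) pq.
  by rewrite -(expn0 p) ltn_exp2l ?prime_gt1.
have [nQ shift] := alexander_entry_shift q1 D0 Hc n0 (pfactor_dvdnn p q) (ltnW Q1).
have [n nE] : {n | num_crossings D = n.+1} by exists (num_crossings D).-1; rewrite prednK.
have m0 : (0 < num_crossings D %/ Q)%N.
  by move: n0; rewrite {1}nQ muln_gt0 => /andP[].
have row i := alexander_entry_row (i := i) n0.
rewrite nE in nQ m0 row shift.
have := periodic_span pp m0 nQ row shift.
rewrite -(alexander_minorsE nE) => /(_ _ mD _ Q1 sp s0); rewrite -ltnS prednK //.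
Qed.

(** Each p-part of q is at most B and so divides B!; the p-parts for different primes are
    coprime. *)
Lemma dvdn_fact_of_prime_powers q B :
  (0 < q)%N -> (forall p, prime p -> (p %| q)%N -> (p ^ logn p q <= B)%N) -> (q %| B`!)%N.
Proof.
move=> q0 h; apply/dvdn_partP => // p.
rewrite mem_primes => /and3P[pp _ pq]; rewrite p_part dvdn_fact //.
by rewrite expn_gt0 prime_gt0 //= h.
Qed.

Theorem corollary6p3 (R : realType) (K : virtual_knot R)
    (Delta : {fraction {poly int}})
    (HK : almost_classical K)
    (HDelta : alexander_polynomial K Delta)
    (Hspan : forall p : nat, prime p ->
       exists2 s : nat, span_mod p Delta s & (0 < s)%N) :
  finite_set [set q : nat | period K q].
Proof.
have [B hB] := span_mod_bounded Delta.
have [LD [D1 [K1 m1]]] := HDelta.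
apply: (@sub_finite_set _ _ `I_(B.+1)`!.+1); last exact: finite_II.
move=> q [q1 [D [KD D0 [phi Hc]]]] /=.
rewrite ltnS dvdn_leq ?fact_gt0 //; apply: dvdn_fact_of_prime_powers => [|p pp pq].
  exact: ltnW.
have [D2 KE] := virtual_knot_class K; rewrite KE in KD K1.
have mD : minors_ideal D = minors_ideal D1.
  by rewrite -(equivalent_minors KD) -(equivalent_minors K1).
have [s sp s0] := Hspan p pp.
apply: leq_trans (period_prime_power q1 D0 Hc LD _ pp pq sp s0) _; first by rewrite mD.
by rewrite ltnS; exact: hB pp sp.
Qed.
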